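(* Let $\mathbb{W}$ be a union of lines and ACM points in $\mathbb{P}^1\times\mathbb{P}^1$, $I=I_{\mathbb{W}}$, and let $\mathcal{G}(I)=A\sqcup B$ be a partition of its standard generating set into nonempty sets, with $J=\langle A\rangle$ and $K=\langle B\rangle$. Then $I=J+K$ is a Betti splitting if and only if $J\cap K$ is principal, i.e. $J\cap K$ is minimally generated by exactly one element.
   Context: $R=\mathbb{C}[x_0,x_1,y_0,y_1]$ is bigraded with $\deg x_i=(1,0)$, $\deg y_i=(0,1)$. For $A=[a_0:a_1]\in\mathbb{P}^1$ let $H_A=a_1x_0-a_0x_1$ and for $B=[b_0:b_1]$ let $V_B=b_1y_0-b_0y_1$; the same symbol denotes the form and its zero set (horizontal, resp. vertical, line or ruling). $I_{A\times B}=\langle H_A,V_B\rangle$, $I_{\mathbb{X}}=\bigcap_{P\in\mathbb{X}}I_P$, and a finite set $\mathbb{X}$ is ACM if $R/I_{\mathbb{X}}$ is Cohen–Macaulay. A union of lines and points is $\mathbb{W}=\{P_1,\dots,P_r,H_1,\dots,H_t,V_1,\dots,V_p\}$ (distinct points, horizontal lines and vertical lines, no point on any of the lines), with $\mathbb{X}_{\mathbb{W}}=\{P_1,\dots,P_r\}$ and $I_{\mathbb{W}}=\bigcap_iI_{P_i}\cap\bigcap_i\langle H_i\rangle\cap\bigcap_j\langle V_j\rangle$; it is a union of lines and ACM points if $\mathbb{X}_{\mathbb{W}}$ is ACM. For ACM $\mathbb{X}$ with $\pi_1(\mathbb{X})=\{A_1,\dots,A_h\}$, $\pi_2(\mathbb{X})=\{B_1,\dots,B_v\}$,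 labelled so that $\alpha_i=|\{P\in\mathbb{X}:P\in H_{A_i}\}|$ satisfies $\alpha_1\ge\cdots\ge\alpha_h$ and the counts on $V_{B_j}$ are nonincreasing, $I_{\mathbb{X}}$ is minimally generated by $\{H_{A_1}\cdots H_{A_h},\ V_{B_1}\cdots V_{B_v}\}\cup\{H_{A_1}\cdots H_{A_i}V_{B_1}\cdots V_{B_{\alpha_{i+1}}}:\alpha_{i+1}<\alpha_i\}$. The standard generating set of $I_{\mathbb{W}}$ is this set for $\mathbb{X}=\mathbb{X}_{\mathbb{W}}$, each element multiplied by $\Lambda=\prod_iH_i\prod_jV_j$. For a bihomogeneous ideal $I$, $\beta_{i,\delta}(I)$ are its bigraded Betti numbers. If $\mathcal{G}(I)=A\sqcup B$ is a partition of a minimal generating set into nonempty sets, $J=\langle A\rangle$, $K=\langle B\rangle$, then $I=J+K$ is a Betti splitting if $\beta_{i,\delta}(I)=\beta_{i,\delta}(J)+\beta_{i,\delta}(K)+\beta_{i-1,\delta}(J\cap K)$ for all $i\ge0$ and all $\delta\in\mathbb{N}^2$, with $\beta_{-1,\delta}(J\cap K)=0$. *)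

(* Defs.v *)
From HB Require Import structures.
From mathcomp Require Import all_boot all_algebra.
From mathcomp Require Import mpoly.
From mathcomp Require Import complex.
From mathcomp Require Import reals.
From Stdlib Require Import ClassicalEpsilon.

Set Implicit Arguments.
Unset Strict Implicit.
Unset Printing Implicit Defensive.

Import GRing.Theory.
Local Open Scope ring_scope.

Section P1xP1.
Variable R : realType.

Definition CC := R[i].

Definition Rpoly := {mpoly CC[4]}.

Definition v0 : 'I_4 := @Ordinal 4 0 isT.
Definition v1 : 'I_4 := @Ordinal 4 1 isT.
Definition v2 : 'I_4 := @Ordinal 4 2 isT.
Definition v3 : 'I_4 := @Ordinal 4 3 isT.

Definition x0 : Rpoly := 'X_v0.
Definition x1 : Rpoly := 'X_v1.
Definition y0 : Rpoly := 'X_v2.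
Definition y1 : Rpoly := 'X_v3.

(* A point [a0:a1] of P^1 is given by a representative (a0,a1) <> (0,0). *)
Definition P1rep (A : CC * CC) : bool := (A.1 != 0) || (A.2 != 0).

Definition P1eq (A B : CC * CC) : bool := A.1 * B.2 == A.2 * B.1.

Definition pt0 : CC * CC := (0, 0).

Definition Hform (A : CC * CC) : Rpoly := A.2 *: x0 - A.1 *: x1.
Definition Vform (B : CC * CC) : Rpoly := B.2 *: y0 - B.1 *: y1.

Definition mbideg (m : 'X_{1..4}) : nat * nat :=
  ((m v0 + m v1)%N, (m v2 + m v3)%N).

Definition bihomog (d : nat * nat) (p : Rpoly) : Prop :=
  forall m, m \in msupp p -> mbideg m = d.

Definition ideal_gen (gs : seq Rpoly) (p : Rpoly) : Prop :=
  exists cs : seq Rpoly, size cs = size gs /\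
    p = \sum_(k < size gs) cs`_k * gs`_k.

Definition is_ideal (I : Rpoly -> Prop) : Prop :=
  I 0 /\ (forall a b, I a -> I b -> I (a + b)) /\ (forall r a, I a -> I (r * a)).

Definition ideal_sum (I : Rpoly -> Prop) (gs : seq Rpoly) (p : Rpoly) : Prop :=
  exists a b, I a /\ ideal_gen gs b /\ p = a + b.

Definition prime_ideal (P : Rpoly -> Prop) : Prop :=
  is_ideal P /\ ~ P 1 /\ (forall a b, P (a * b) -> P a \/ P b).

Definition prime_chain (I : Rpoly -> Prop) (n : nat) : Prop :=
  exists ps : seq (Rpoly -> Prop), size ps = n.+1 /\
    (forall k, (k < n.+1)%N ->
       prime_ideal (nth I ps k) /\ (forall p, I p -> nth I ps k p)) /\
    (forall k, (k < n)%N ->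
       (forall p, nth I ps k p -> nth I ps k.+1 p) /\
       exists p, nth I ps k.+1 p /\ ~ nth I ps k p).

Definition krull_dim_quot (I : Rpoly -> Prop) (n : nat) : Prop :=
  prime_chain I n /\ ~ prime_chain I n.+1.

Definition irrelevant : Rpoly -> Prop := ideal_gen [:: x0; x1; y0; y1].

Definition regular_seq (I : Rpoly -> Prop) (fs : seq Rpoly) : Prop :=
  (forall k, (k < size fs)%N -> irrelevant fs`_k) /\
  (forall k, (k < size fs)%N -> forall g,
      ideal_sum I (take k fs) (fs`_k * g) -> ideal_sum I (take k fs) g) /\
  ~ ideal_sum I fs 1.

Definition depth_quot (I : Rpoly -> Prop) (n : nat) : Prop :=
  (exists fs, size fs = n /\ regular_seq I fs) /\
  ~ (exists fs, size fs = n.+1 /\ regular_seq I fs).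

Definition CohenMacaulay_quot (I : Rpoly -> Prop) : Prop :=
  exists n, depth_quot I n /\ krull_dim_quot I n.

Definition Pt := ((CC * CC) * (CC * CC))%type.

Definition ptI (P : Pt) : Rpoly -> Prop := ideal_gen [:: Hform P.1; Vform P.2].

Definition I_X (X : seq Pt) (p : Rpoly) : Prop := forall P, P \in X -> ptI P p.

Definition ACM (X : seq Pt) : Prop := CohenMacaulay_quot (I_X X).

Definition lines_points (X : seq Pt) (Hs Vs : seq (CC * CC)) : Prop :=
  (forall P, P \in X -> P1rep P.1 /\ P1rep P.2) /\
  (forall A, A \in Hs -> P1rep A) /\ (forall B, B \in Vs -> P1rep B) /\
  (forall k l, (k < size X)%N -> (l < size X)%N -> k <> l ->
     ~~ (P1eq (nth X`_0 X k).1 (nth X`_0 X l).1 && P1eq (nth X`_0 X k).2 (nth X`_0 X l).2)) /\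
  (forall k l, (k < size Hs)%N -> (l < size Hs)%N -> k <> l -> ~~ P1eq Hs`_k Hs`_l) /\
  (forall k l, (k < size Vs)%N -> (l < size Vs)%N -> k <> l -> ~~ P1eq Vs`_k Vs`_l) /\
  (forall P A, P \in X -> A \in Hs -> ~~ P1eq P.1 A) /\
  (forall P B, P \in X -> B \in Vs -> ~~ P1eq P.2 B).

Definition I_W (X : seq Pt) (Hs Vs : seq (CC * CC)) (p : Rpoly) : Prop :=
  I_X X p /\ (forall A, A \in Hs -> ideal_gen [:: Hform A] p) /\
  (forall B, B \in Vs -> ideal_gen [:: Vform B] p).

Definition row_count (X : seq Pt) (A : CC * CC) : nat := count (fun P => P1eq P.1 A) X.
Definition col_count (X : seq Pt) (B : CC * CC) : nat := count (fun P => P1eq P.2 B) X.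

(* alpha_i (0-based index k = i-1) *)
Definition alpha (X : seq Pt) (As : seq (CC * CC)) (k : nat) : nat :=
  row_count X (nth pt0 As k).

Definition labelling (X : seq Pt) (As Bs : seq (CC * CC)) : Prop :=
  (forall A, A \in As -> P1rep A) /\ (forall B, B \in Bs -> P1rep B) /\
  (forall k l, (k < size As)%N -> (l < size As)%N -> k <> l -> ~~ P1eq As`_k As`_l) /\
  (forall k l, (k < size Bs)%N -> (l < size Bs)%N -> k <> l -> ~~ P1eq Bs`_k Bs`_l) /\
  (forall P, P \in X -> has (P1eq P.1) As /\ has (P1eq P.2) Bs) /\
  (forall A, A \in As -> has (fun P => P1eq P.1 A) X) /\
  (forall B, B \in Bs -> has (fun P => P1eq P.2 B) X) /\
  (forall k, (k.+1 < size As)%N -> (alpha X As k.+1 <= alpha X As k)%N) /\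
  (forall k, (k.+1 < size Bs)%N -> (col_count X (nth pt0 Bs k.+1) <= col_count X (nth pt0 Bs k))%N).

Definition prodH (As : seq (CC * CC)) : Rpoly := \prod_(A <- As) Hform A.
Definition prodV (Bs : seq (CC * CC)) : Rpoly := \prod_(B <- Bs) Vform B.


(* {H_A1..H_Ah, V_B1..V_Bv} u {H_A1..H_Ai V_B1..V_B(alpha_(i+1)) : alpha_(i+1) < alpha_i},
   i = 1..h-1 (written 0-based: k = i-1 = 0..h-2) *)
Definition std_gens_X (X : seq Pt) (As Bs : seq (CC * CC)) : seq Rpoly :=
  [:: prodH As; prodV Bs] ++
  [seq prodH (take k.+1 As) * prodV (take (alpha X As k.+1) Bs)
     | k <- iota 0 (size As).-1 & (alpha X As k.+1 < alpha X As k)%N].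

Definition Lambda (Hs Vs : seq (CC * CC)) : Rpoly := prodH Hs * prodV Vs.

Definition std_gens_W (X : seq Pt) (Hs Vs As Bs : seq (CC * CC)) : seq Rpoly :=
  undup [seq Lambda Hs Vs * g | g <- std_gens_X X As Bs].

(* beta_{i,delta}(I) = dim_C Tor_i^R(I, C)_delta = dim_C H_i(K(x0,x1,y0,y1) (x) I)_delta *)

Definition lin_indep (V : lmodType CC) (s : seq V) : Prop :=
  forall c : seq CC, size c = size s ->
    \sum_(k < size s) c`_k *: s`_k = 0 -> forall k, (k < size s)%N -> c`_k = 0.

Definition has_dim (V : lmodType CC) (P : V -> Prop) (n : nat) : Prop :=
  (exists s : seq V, size s = n /\ (forall k, (k < n)%N -> P s`_k) /\ lin_indep s) /\
  ~ (exists s : seq V, size s = n.+1 /\ (forall k, (k < n.+1)%N -> P s`_k) /\ lin_indep s).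

Definition vdim (V : lmodType CC) (P : V -> Prop) : nat :=
  epsilon (inhabits 0%N) (has_dim P).

Definition Kchain := {ffun {set 'I_4} -> Rpoly}.

(* bidegree of the basis element e_S *)
Definition sdeg (S : {set 'I_4}) : nat * nat :=
  (#|S :&: [set v0; v1]|, #|S :&: [set v2; v3]|).

Definition homog_shift (d e : nat * nat) (p : Rpoly) : Prop :=
  if (e.1 <= d.1)%N && (e.2 <= d.2)%N then bihomog ((d.1 - e.1)%N, (d.2 - e.2)%N) p
  else p = 0.

(* (K_i (x) I)_delta *)
Definition in_chain (I : Rpoly -> Prop) (i : nat) (d : nat * nat) (phi : Kchain) : Prop :=
  forall S : {set 'I_4},
    if #|S| == i then I (phi S) /\ homog_shift d (sdeg S) (phi S) else phi S = 0.

(* Koszul differential: d(f e_S) = sum_{k in S} (-1)^{#{j in S | j < k}} x_k f e_{S \ k} *)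
Definition kdiff (phi : Kchain) : Kchain :=
  [ffun T : {set 'I_4} => \sum_(k : 'I_4 | k \notin T)
      ((-1) ^+ #|[set j in T | (j < k)%N]| * 'X_k * phi (k |: T))].

Definition cycles (I : Rpoly -> Prop) (i : nat) (d : nat * nat) (phi : Kchain) : Prop :=
  in_chain I i d phi /\ kdiff phi = 0.

Definition boundaries (I : Rpoly -> Prop) (i : nat) (d : nat * nat) (phi : Kchain) : Prop :=
  exists psi, in_chain I i.+1 d psi /\ phi = kdiff psi.

Definition betti (I : Rpoly -> Prop) (i : nat) (d : nat * nat) : nat :=
  (vdim (cycles I i d) - vdim (boundaries I i d))%N.

Definition ideal_cap (J K : Rpoly -> Prop) (p : Rpoly) : Prop := J p /\ K p.

Definition betti_splitting (I J K : Rpoly -> Prop) : Prop :=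
  forall (i : nat) (d : nat * nat),
    betti I i d = (betti J i d + betti K i d +
                   (if i is i'.+1 then betti (ideal_cap J K) i' d else 0))%N.

Definition principal (I : Rpoly -> Prop) : Prop :=
  exists f : Rpoly, f != 0 /\ forall p, I p <-> ideal_gen [:: f] p.

End P1xP1.

(* Main.v *)
(** The generators of I_W are products u_i w_j, u_i a product of i + t horizontal
    and w_j of j + p vertical forms, arranged along a staircase: i increases
    while j decreases.  A consecutive splitting of a staircase has as
    intersection the principal ideal (u_(i') w_j), (i, j) and (i', j') being the
    generators at the cut; adding generators one by one, this gives
    Tor_2(I, C) = 0.  If the partition cuts the staircase at least twice, take
    x, m, y with x and y on one side and m, like everything between x and y, on
    the other: the relation between lcm(x, m) and lcm(m, y) is a class of
    Tor_1(J \cap K, C) in the bidegree of lcm(x, y); it cannot be a boundary because J \cap K vanishes in all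
    bidegrees strictly below.  This contradicts a Betti splitting, which forces
    Tor_1(J \cap K, C) = 0.  Conversely, if J \cap K is principal then it is free,
    and it lies in mJ and in mK because the bidegrees of the generators are
    pairwise incomparable; the long exact sequence of Tor then splits and gives
    the formula for the Betti numbers.

    The staircase itself comes from depth (R/I_X) >= 2: functions on the union
    of the planes V(I_P) extend over the origin.  If two rows are incomparable,
    take two with the fewest common columns; a function supported on one of
    them extends to a polynomial whose bidegree is too small. *)
Require Import Defs.
From HB Require Import structures.
From mathcomp Require Import all_boot all_algebra.
From mathcomp Require Import zify.
From mathcomp Require Import mpoly.
From Stdlib Require Import Classical ClassicalEpsilon FunctionalExtensionality.
From Stdlib Require Import PropExtensionality.

Set Implicit Arguments.
Unset Strict Implicit.
Unset Printing Implicit Defensive.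

Import GRing.Theory.
Local Open Scope ring_scope.

(** * Ideals, divisibility and substitutions *)

Section Divisibility.
Variable D : idomainType.
Implicit Types (f g p q : D).

Definition divides f p := exists c, p = c * f.

Lemma dividesM f p q : divides f q -> divides f (p * q).
Proof. by move=> [c ->]; exists (p * c); rewrite mulrA. Qed.

Definition prime_elt f :=
  f != 0 /\ forall a b, divides f (a * b) -> divides f a \/ divides f b.

Lemma prod_divides (s : seq D) p : (forall f, f \in s -> prime_elt f) ->
    (forall i j, (i < j < size s)%N -> ~ divides s`_j s`_i) ->
    (forall f, f \in s -> divides f p) ->
  divides (\prod_(f <- s) f) p.
Proof.
elim: s p => [|f s IH] p pr nd dp; first by exists p; rewrite big_nil mulr1.
have [c pE] := dp f (mem_head _ _).
have [|||d cE] := IH c.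
- by move=> g gs; apply: pr; rewrite inE gs orbT.
- by move=> i j ij; apply: (nd i.+1 j.+1).
- move=> g gs; have := dp g; rewrite inE gs orbT pE => /(_ isT).
  have [_ prg] := pr g (mem_behead (gs : g \in behead (f :: s))).
  case/prg => // gf; have ig : (index g s < size s)%N by rewrite index_mem.
  by case: (nd 0%N (index g s).+1 ig); rewrite /= nth_index.
- by exists d; rewrite big_cons pE cE -mulrA [_ * f]mulrC.
Qed.

Lemma prod_coprime_divides (s : seq D) q a : (forall f, f \in s -> prime_elt f) ->
    (forall f, f \in s -> ~ divides f q) ->
  divides (\prod_(f <- s) f) (q * a) -> divides (\prod_(f <- s) f) a.
Proof.
elim: s a => [|f s IH] a pr nd [c cE]; first by exists a; rewrite big_nil mulr1.
have [f0 prf] := pr f (mem_head _ _).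
have [|fq|[b aE]] := prf q a.
- by exists (c * \prod_(g <- s) g); rewrite cE big_cons mulrCA mulrC.
- by case: (nd f (mem_head _ _) fq).
have [|||d bE] := IH b.
- by move=> g gs; apply: pr; rewrite inE gs orbT.
- by move=> g gs; apply: nd; rewrite inE gs orbT.
- exists c; apply: (mulIf f0); rewrite -mulrA -aE cE big_cons.
  by rewrite -mulrA [f * _]mulrC.
- by exists d; rewrite big_cons aE bE -mulrA [_ * f]mulrC.
Qed.

End Divisibility.

(* The notions of Defs.v are restated over an arbitrary field; over [CC R] they
   are convertible to the originals. *)
Section Ideals.
Variable F : fieldType.
Local Notation S := {mpoly F[4]}.
Implicit Types (gs : seq S) (p q f : S) (I : S -> Prop).

Definition ideal_set I : Prop :=
  I 0 /\ (forall a b, I a -> I b -> I (a + b)) /\ (forall r a, I a -> I (r * a)).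

Definition gen_ideal gs p : Prop :=
  exists cs : seq S, size cs = size gs /\ p = \sum_(k < size gs) cs`_k * gs`_k.

Definition cap_ideal (I J : S -> Prop) p : Prop := I p /\ J p.

Lemma ideal_setB I a b : ideal_set I -> I a -> I b -> I (a - b).
Proof.
by move=> [_ [ID IM]] Ia Ib; apply: ID => //; rewrite -mulN1r; apply: IM.
Qed.

Lemma ideal_set_sum I (T : Type) (r : seq T) (P : pred T) (E : T -> S) :
  ideal_set I -> (forall x, P x -> I (E x)) -> I (\sum_(x <- r | P x) E x).
Proof. by move=> [I0 [ID _]] IF; elim/big_ind: _. Qed.

Lemma ideal_setZ I (c : F) a : ideal_set I -> I a -> I (c *: a).
Proof. by move=> [_ [_ IM]] Ia; rewrite -mul_mpolyC; apply: IM. Qed.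

Lemma is_cap_ideal I J : ideal_set I -> ideal_set J -> ideal_set (cap_ideal I J).
Proof.
move=> [I0 [ID IM]] [J0 [JD JM]]; do ![split] => //.
- by apply: ID; [case: H | case: H0].
- by apply: JD; [case: H | case: H0].
- by apply: IM; case: H.
- by apply: JM; case: H.
Qed.

Lemma gen_ideal_ideal_set gs : ideal_set (gen_ideal gs).
Proof.
split; [|split].
- exists (nseq (size gs) 0); rewrite size_nseq; split=> //.
  by rewrite big1 // => k _; rewrite nth_nseq if_same mul0r.
- move=> a b [cs [scs ->]] [ds [sds ->]].
  exists (mkseq (fun k => cs`_k + ds`_k) (size gs)); rewrite size_mkseq.
  split=> //; rewrite -big_split /=; apply: eq_bigr => k _.
  by rewrite nth_mkseq // mulrDl.
- move=> r a [cs [scs ->]].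
  exists (mkseq (fun k => r * cs`_k) (size gs)); rewrite size_mkseq.
  split=> //; rewrite mulr_sumr; apply: eq_bigr => k _.
  by rewrite nth_mkseq // mulrA.
Qed.

Lemma gen_ideal_min I gs :
  ideal_set I -> (forall g, g \in gs -> I g) -> forall p, gen_ideal gs p -> I p.
Proof.
move=> idI Igs p [cs [_ ->]]; apply: ideal_set_sum => // k _.
by case: idI => _ [_ IM]; apply: IM; apply: Igs; rewrite mem_nth.
Qed.

Lemma mem_gen_ideal gs g : g \in gs -> gen_ideal gs g.
Proof.
move=> gin; exists (mkseq (fun k => (k == index g gs)%:R) (size gs)).
rewrite size_mkseq; split=> //.
have ig : (index g gs < size gs)%N by rewrite index_mem.
rewrite (bigD1 (Ordinal ig)) //= nth_mkseq // eqxx mul1r nth_index //.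
rewrite big1 ?addr0 // => k kne; rewrite nth_mkseq //.
by rewrite (_ : (_ == _) = false) ?mul0r //; apply: negbTE.
Qed.

Lemma gen_ideal_sub gs gs' : {subset gs <= gs'} ->
  forall p, gen_ideal gs p -> gen_ideal gs' p.
Proof.
move=> sub; apply: gen_ideal_min; first exact: gen_ideal_ideal_set.
by move=> g /sub; apply: mem_gen_ideal.
Qed.

Lemma gen_idealM gs a p : gen_ideal gs p -> gen_ideal gs (a * p).
Proof. by case: (gen_ideal_ideal_set gs) => _ [_]; apply. Qed.

Lemma gen_ideal_cat s1 s2 p : gen_ideal (s1 ++ s2) p <->
  exists a b, [/\ gen_ideal s1 a, gen_ideal s2 b & p = a + b].
Proof.
split=> [|[a [b [sa sb ->]]]]; last first.
  have [_ [GD _]] := gen_ideal_ideal_set (s1 ++ s2).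
  by apply: GD; [move: sa | move: sb]; apply: gen_ideal_sub => g gs;
    rewrite mem_cat gs ?orbT.
have [z1 [D1 M1]] := gen_ideal_ideal_set s1.
have [z2 [D2 M2]] := gen_ideal_ideal_set s2.
move: p; apply: gen_ideal_min.
  split; [by exists 0, 0; rewrite addr0|split].
  - move=> _ _ [a [b [sa sb ->]]] [a' [b' [sa' sb' ->]]].
    by exists (a + a'), (b + b'); rewrite addrACA; split; auto.
  - move=> r _ [a [b [sa sb ->]]].
    by exists (r * a), (r * b); rewrite mulrDr; split; auto.
move=> g; rewrite mem_cat => /orP[] gin.
- by exists g, 0; rewrite addr0; split=> //; apply: mem_gen_ideal.
- by exists 0, g; rewrite add0r; split=> //; apply: mem_gen_ideal.
Qed.

Lemma gen_ideal_coef (T : eqType) (g : T -> S) (l : seq T) p : uniq l ->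
  gen_ideal [seq g x | x <- l] p ->
  exists c : T -> S, p = \sum_(x <- l) c x * g x.
Proof.
case: l => [_ [cs [_ ->]]|x0 l ul [cs [_ ->]]].
  by exists (fun=> 0); rewrite big_nil big_ord0.
exists (fun x => cs`_(index x (x0 :: l))); rewrite (big_nth x0) big_mkord size_map.
by apply: eq_bigr => k _; rewrite index_uniq // (nth_map x0).
Qed.

Lemma gen_ideal1P f p : gen_ideal [:: f] p <-> divides f p.
Proof.
split=> [[cs [_ ->]]|[c ->]]; first by exists cs`_0; rewrite big_ord1.
by exists [:: c]; rewrite /= big_ord1.
Qed.

Lemma gen_ideal2P f g p : gen_ideal [:: f; g] p <-> exists a b, p = a * f + b * g.
Proof.
rewrite -[[:: f; g]]/([:: f] ++ [:: g]) gen_ideal_cat; split.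
  by move=> [_ [_ [/gen_ideal1P[a ->] /gen_ideal1P[b ->] ->]]]; exists a, b.
by move=> [a [b ->]]; exists (a * f), (b * g); split=> //;
  apply/gen_ideal1P; [exists a | exists b].
Qed.

End Ideals.

Section Substitution.
Variable F : fieldType.
Local Notation S := {mpoly F[4]}.
Implicit Types (p q : S) (A B : F * F).

Definition prep A : bool := (A.1 != 0) || (A.2 != 0).
Definition peq A B : bool := A.1 * B.2 == A.2 * B.1.

Definition xform A : S := A.2 *: 'X_v0 - A.1 *: 'X_v1.
Definition yform B : S := B.2 *: 'X_v2 - B.1 *: 'X_v3.

Definition prime_ideal_set (I : S -> Prop) : Prop :=
  ideal_set I /\ ~ I 1 /\ (forall a b, I (a * b) -> I a \/ I b).

Local Notation point := ((F * F) * (F * F))%type.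
Definition pt_ideal (P : point) : S -> Prop := gen_ideal [:: xform P.1; yform P.2].

Lemma ord4_ind (P : 'I_4 -> Prop) : P v0 -> P v1 -> P v2 -> P v3 -> forall i, P i.
Proof.
move=> p0 p1 p2 p3 i.
have [->|->|->|-> //] : [\/ i = v0, i = v1, i = v2 | i = v3]; rewrite //.
case: i => -[|[|[|[|//]]]] ?;
 [constructor 1|constructor 2|constructor 3|constructor 4]; exact: val_inj.
Qed.

Lemma comp_mpolyM (t : 4.-tuple S) p q : (p * q) \mPo t = (p \mPo t) * (q \mPo t).
Proof. by rewrite rmorphM. Qed.

Lemma comp_mpoly_congr (I : S -> Prop) (t : 4.-tuple S) : ideal_set I ->
  (forall i, I ('X_i - tnth t i)) -> forall p, I (p - (p \mPo t)).
Proof.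
move=> idI It p; have [I0 [ID IM]] := idI.
have congrM a b c d : I (a - b) -> I (c - d) -> I (a * c - b * d).
  move=> ab cd; rewrite (_ : _ - _ = c * (a - b) + b * (c - d)); first by auto.
  by rewrite !mulrBr addrA [c * b]mulrC subrK mulrC.
elim/mpolyind: p => [|c m p _ _ IH]; first by rewrite comp_mpoly0 subrr.
rewrite comp_mpolyD comp_mpolyZ opprD addrACA -scalerBr.
apply: ID; last exact: IH.
apply: (ideal_setZ _ idI); rewrite comp_mpolyX mpolyXE_id.
apply: (big_ind2 (fun a b => I (a - b))) => [|a b c' d|i _].
- by rewrite subrr.
- exact: congrM.
elim: (m i) => [|n IHn]; first by rewrite !expr0 subrr.
by rewrite !exprS; apply: congrM.
Qed.

Lemma prime_ker (t : 4.-tuple S) : prime_ideal_set (fun p : S => (p \mPo t) = 0).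
Proof.
split; [split; [|split]|split].
- by rewrite comp_mpoly0.
- by move=> a b /= a0 b0; rewrite comp_mpolyD a0 b0 addr0.
- by move=> r a /= a0; rewrite rmorphM /= a0 mulr0.
- by move=> /= /eqP; rewrite comp_mpoly1 oner_eq0.
- by move=> a b /= /eqP; rewrite rmorphM /= mulf_eq0 => /orP[]/eqP h; [left|right].
Qed.

Lemma mpolyXU_neq0 i : 'X_i != 0 :> S.
Proof. by rewrite -msize_poly_eq0 msizeX. Qed.

(* Substitution along the point [A] in the pair of variables i, j: it kills
   [A.2 *: 'X_i - A.1 *: 'X_j] and is the identity modulo this form. *)
Definition sub_l A (i j : 'I_4) : S := if A.1 != 0 then 'X_i else 0.
Definition sub_r A (i j : 'I_4) : S :=
  if A.1 != 0 then (A.2 / A.1) *: 'X_i else 'X_j.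

Definition redH A : 4.-tuple S :=
  [tuple sub_l A v0 v1; sub_r A v0 v1; 'X_v2; 'X_v3].
Definition redV B : 4.-tuple S :=
  [tuple 'X_v0; 'X_v1; sub_l B v2 v3; sub_r B v2 v3].
Definition redP (P : point) : 4.-tuple S :=
  [tuple sub_l P.1 v0 v1; sub_r P.1 v0 v1; sub_l P.2 v2 v3; sub_r P.2 v2 v3].

Lemma comp_xform t A :
  xform A \mPo t = A.2 *: tnth t v0 - A.1 *: tnth t v1 :> S.
Proof.
by rewrite /xform comp_mpolyB !comp_mpolyZ !comp_mpolyXU !(tnth_nth 0).
Qed.

Lemma comp_yform t A :
  yform A \mPo t = A.2 *: tnth t v2 - A.1 *: tnth t v3 :> S.
Proof.
by rewrite /yform comp_mpolyB !comp_mpolyZ !comp_mpolyXU !(tnth_nth 0).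
Qed.

Lemma sub_lr0 A i j : prep A -> A.2 *: sub_l A i j - A.1 *: sub_r A i j = 0.
Proof.
rewrite /sub_l /sub_r; case: eqP => [->|/eqP a0] _ /=.
  by rewrite scaler0 scale0r subrr.
by rewrite scalerA mulrCA divff // mulr1 subrr.
Qed.

Lemma sub_lr_congr (I : S -> Prop) A i j : ideal_set I -> prep A ->
    I (A.2 *: 'X_i - A.1 *: 'X_j) ->
  I ('X_i - sub_l A i j) /\ I ('X_j - sub_r A i j).
Proof.
move=> idI; rewrite /prep /sub_l /sub_r; case: eqP => [->|/eqP a0] /= a2 Ih.
  have [I0 _] := idI; rewrite subr0 subrr; split; last exact: I0.
  by have := ideal_setZ A.2^-1 idI Ih; rewrite scale0r subr0 scalerA mulVf // scale1r.
have [I0 _] := idI; rewrite subrr; split; first exact: I0.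
have := ideal_setZ (- A.1^-1) idI Ih.
rewrite scalerBr !scalerA !mulNr (mulVf a0) scaleN1r opprK (mulrC _ A.2) scaleNr.
by rewrite addrC.
Qed.

Lemma sub_lr_neq0 A B i j : prep A -> ~~ peq A B ->
  B.2 *: sub_l A i j - B.1 *: sub_r A i j != 0.
Proof.
rewrite /prep /peq /sub_l /sub_r; case: eqP => [->|/eqP a0] /= a2.
  rewrite mul0r eq_sym mulf_eq0 negb_or => /andP[_ b1].
  by rewrite scaler0 sub0r oppr_eq0 scaler_eq0 negb_or b1 mpolyXU_neq0.
move=> ne; rewrite scalerA -scalerBl scaler_eq0 negb_or mpolyXU_neq0.
rewrite andbT subr_eq0; apply: contra ne => /eqP->.
by rewrite mulrC mulrA divfK // mulrC.
Qed.

Local Opaque sub_l sub_r.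

Lemma redP_kerP P p : prep P.1 -> prep P.2 ->
  pt_ideal P p <-> (p \mPo redP P) = 0.
Proof.
move=> r1 r2; rewrite /pt_ideal; split=> [/gen_ideal2P[a [b ->]]|p0].
  rewrite comp_mpolyD (comp_mpolyM _ a) (comp_mpolyM _ b) comp_xform comp_yform.
  rewrite !(tnth_nth 0) /= (sub_lr0 _ _ r1) (sub_lr0 _ _ r2).
  by rewrite !mulr0 addr0.
set I := gen_ideal _; have idI : ideal_set I by apply: gen_ideal_ideal_set.
have IH : I (xform P.1) by apply: mem_gen_ideal; rewrite mem_head.
have IV : I (yform P.2) by apply: mem_gen_ideal; rewrite !inE eqxx orbT.
rewrite -[p]subr0 -p0; apply: comp_mpoly_congr => //.
have [h0 h1] := sub_lr_congr idI r1 IH; have [h2 h3] := sub_lr_congr idI r2 IV.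
apply: ord4_ind; rewrite (tnth_nth 0) /=;
 [exact: h0|exact: h1|exact: h2|exact: h3].
Qed.

Lemma redH_kerP A p : prep A -> divides (xform A) p <-> (p \mPo redH A) = 0.
Proof.
move=> rA; split=> [[c ->]|p0].
  by rewrite comp_mpolyM comp_xform !(tnth_nth 0) /= (sub_lr0 _ _ rA) mulr0.
apply/gen_ideal1P.
set I := gen_ideal _; have idI : ideal_set I by apply: gen_ideal_ideal_set.
have IH : I (xform A) by apply: mem_gen_ideal; rewrite mem_head.
rewrite -[p]subr0 -p0; apply: comp_mpoly_congr => //.
have [h0 h1] := sub_lr_congr idI rA IH; have [I0 _] := idI.
apply: ord4_ind; rewrite (tnth_nth 0) /=;
 [exact: h0|exact: h1|by rewrite subrr|by rewrite subrr].
Qed.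

Lemma redV_kerP A p : prep A -> divides (yform A) p <-> (p \mPo redV A) = 0.
Proof.
move=> rA; split=> [[c ->]|p0].
  by rewrite comp_mpolyM comp_yform !(tnth_nth 0) /= (sub_lr0 _ _ rA) mulr0.
apply/gen_ideal1P.
set I := gen_ideal _; have idI : ideal_set I by apply: gen_ideal_ideal_set.
have IH : I (yform A) by apply: mem_gen_ideal; rewrite mem_head.
rewrite -[p]subr0 -p0; apply: comp_mpoly_congr => //.
have [h0 h1] := sub_lr_congr idI rA IH; have [I0 _] := idI.
apply: ord4_ind; rewrite (tnth_nth 0) /=;
 [by rewrite subrr|by rewrite subrr|exact: h0|exact: h1].
Qed.

Lemma lin_form_neq0 A (i j : 'I_4) : i != j -> prep A ->
  A.2 *: 'X_i - A.1 *: 'X_j != 0 :> S.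
Proof.
move=> ij rA; apply/eqP => e.
have := congr1 (mcoeff U_(i)%MM) e; have := congr1 (mcoeff U_(j)%MM) e.
rewrite !mcoeffB !mcoeffZ !mcoeffXU !eqxx [j == i]eq_sym (negbTE ij).
rewrite !mcoeff0 !mulr0 !mulr1 subr0 sub0r => /eqP; rewrite oppr_eq0 => a1 /eqP a2.
by move: rA; rewrite /prep a1 a2.
Qed.

Lemma xform_neq0 A : prep A -> xform A != 0.
Proof. exact: lin_form_neq0. Qed.
Lemma yform_neq0 A : prep A -> yform A != 0.
Proof. exact: lin_form_neq0. Qed.

Lemma xform_prime A : prep A -> prime_elt (xform A).
Proof.
move=> rA; split=> [|a b]; first exact: xform_neq0.
rewrite !(redH_kerP _ rA); have [_ [_]] := prime_ker (redH A); exact.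
Qed.

Lemma yform_prime A : prep A -> prime_elt (yform A).
Proof.
move=> rA; split=> [|a b]; first exact: yform_neq0.
rewrite !(redV_kerP _ rA); have [_ [_]] := prime_ker (redV A); exact.
Qed.

Lemma xform_ndvd A B : prep A -> ~~ peq A B -> ~ divides (xform A) (xform B).
Proof.
move=> rA ne /(redH_kerP _ rA)/eqP; rewrite comp_xform !(tnth_nth 0) /=.
by apply/negP; apply: sub_lr_neq0.
Qed.

Lemma yform_ndvd A B : prep A -> ~~ peq A B -> ~ divides (yform A) (yform B).
Proof.
move=> rA ne /(redV_kerP _ rA)/eqP; rewrite comp_yform !(tnth_nth 0) /=.
by apply/negP; apply: sub_lr_neq0.
Qed.

Lemma xform_ndvdV A B : prep A -> prep B -> ~ divides (xform A) (yform B).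
Proof.
move=> rA rB /(redH_kerP _ rA)/eqP; rewrite comp_yform !(tnth_nth 0) /=.
by apply/negP; apply: lin_form_neq0.
Qed.

Lemma pt_ideal_prime P : prep P.1 -> prep P.2 -> prime_ideal_set (pt_ideal P).
Proof.
move=> r1 r2; have [[k0 [kD kM]] [k1 kp]] := prime_ker (redP P).
split; [split; [|split]|split].
- exact/redP_kerP.
- by move=> a b /redP_kerP a0 /redP_kerP b0; apply/redP_kerP => //; apply: kD; auto.
- by move=> r a /redP_kerP a0; apply/redP_kerP => //; apply: kM; auto.
- by move=> /redP_kerP h; apply: k1; auto.
- move=> a b /redP_kerP ab; case: (kp a b); auto => h; [left|right]; exact/redP_kerP.
Qed.

Lemma peq_scale A B : prep A -> prep B -> peq A B ->
  exists2 c : F, c != 0 & B = (c * A.1, c * A.2).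
Proof.
case: A B => [a1 a2] [b1 b2]; rewrite /prep /peq /= => rA rB /eqP e.
have [a0|a0] := eqVneq a1 0.
  move: rA rB e; rewrite a0 eqxx /= mul0r => a20 rB /esym/eqP.
  rewrite mulf_eq0 (negbTE a20) /= => /eqP b0; rewrite b0 eqxx /= in rB *.
  by exists (b2 / a2); rewrite ?mulf_neq0 ?invr_eq0 // mulr0 divfK.
have b10 : b1 != 0.
  apply: contraTneq rB => b0; move: e; rewrite b0 mulr0 eqxx => /eqP.
  by rewrite mulf_eq0 (negbTE a0) /= => ->.
exists (b1 / a1); rewrite ?mulf_neq0 ?invr_eq0 // divfK //; congr pair.
by apply: (mulfI a0); rewrite e mulrCA mulrA divfK // mulrC.
Qed.

Lemma xform_scale c A : xform (c * A.1, c * A.2) = c *: xform A.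
Proof. by rewrite /xform /= scalerBr !scalerA. Qed.

Lemma yform_scale c A : yform (c * A.1, c * A.2) = c *: yform A.
Proof. by rewrite /yform /= scalerBr !scalerA. Qed.

Lemma peq_sym A B : peq A B = peq B A.
Proof. by rewrite /peq eq_sym mulrC [X in _ == X]mulrC. Qed.

Lemma peq_refl A : peq A A.
Proof. by rewrite /peq mulrC. Qed.

Lemma peq_trans B A D : prep B -> peq A B -> peq B D -> peq A D.
Proof.
case: A B D => [a1 a2] [b1 b2] [d1 d2]; rewrite /prep /peq /= => rB /eqP ab /eqP bd.
case/orP: rB => b0; apply/eqP; apply: (mulfI b0).
  by rewrite mulrCA bd mulrA ab -mulrA mulrCA.
by rewrite mulrA [b2 * a1]mulrC ab -mulrA bd mulrCA.
Qed.

Lemma pt_ideal_sub P Q : prep P.1 -> prep P.2 -> prep Q.1 -> prep Q.2 ->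
  peq P.1 Q.1 -> peq P.2 Q.2 -> forall p, pt_ideal P p -> pt_ideal Q p.
Proof.
move=> r1 r2 s1 s2 e1 e2; rewrite peq_sym in e1; rewrite peq_sym in e2.
have [c _ E1] := peq_scale s1 r1 e1; have [d _ E2] := peq_scale s2 r2 e2.
apply: gen_ideal_min; first exact: gen_ideal_ideal_set.
have idQ : ideal_set (pt_ideal Q) by apply: gen_ideal_ideal_set.
move=> g; rewrite !inE => /orP[]/eqP->.
  rewrite E1 xform_scale; apply: ideal_setZ => //; apply: mem_gen_ideal.
  by rewrite mem_head.
rewrite E2 yform_scale; apply: ideal_setZ => //; apply: mem_gen_ideal.
by rewrite !inE eqxx orbT.
Qed.

Lemma xform_pt_ideal A P : prep P.1 -> prep P.2 -> prep A ->
  pt_ideal P (xform A) <-> peq P.1 A.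
Proof.
move=> r1 r2 rA; split=> [/(redP_kerP _ r1 r2)|e].
  rewrite comp_xform !(tnth_nth 0) /= => h.
  by apply/negPn/negP => /(sub_lr_neq0 v0 v1 r1)/eqP.
have [c _ ->] := peq_scale r1 rA e; rewrite xform_scale.
apply: ideal_setZ; first exact: gen_ideal_ideal_set.
by apply: mem_gen_ideal; rewrite mem_head.
Qed.

Lemma yform_pt_ideal B P : prep P.1 -> prep P.2 -> prep B ->
  pt_ideal P (yform B) <-> peq P.2 B.
Proof.
move=> r1 r2 rA; split=> [/(redP_kerP _ r1 r2)|e].
  rewrite comp_yform !(tnth_nth 0) /= => h.
  by apply/negPn/negP => /(sub_lr_neq0 v2 v3 r2)/eqP.
have [c _ ->] := peq_scale r2 rA e; rewrite yform_scale.
apply: ideal_setZ; first exact: gen_ideal_ideal_set.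
by apply: mem_gen_ideal; rewrite !inE eqxx orbT.
Qed.

End Substitution.

(** * Dimensions of subspaces of a finite-dimensional space *)

Section Dimension.
Variables (F : fieldType) (V : lmodType F).
Implicit Types (s : seq V) (P Q : V -> Prop).

Definition indep s : Prop :=
  forall c : seq F, size c = size s ->
    \sum_(k < size s) c`_k *: s`_k = 0 -> forall k, (k < size s)%N -> c`_k = 0.

Definition of_dim P (n : nat) : Prop :=
  (exists s : seq V, size s = n /\ (forall k, (k < n)%N -> P s`_k) /\ indep s) /\
  ~ (exists s : seq V, size s = n.+1 /\ (forall k, (k < n.+1)%N -> P s`_k) /\ indep s).

Definition pdim P : nat := epsilon (inhabits 0%N) (of_dim P).

Definition subspace P : Prop :=
  P 0 /\ forall a u v, P u -> P v -> P (a *: u + v).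

Lemma eq_dim P Q : (forall v, P v <-> Q v) -> pdim P = pdim Q.
Proof.
move=> PQ; congr pdim; apply: functional_extensionality => v.
exact: propositional_extensionality.
Qed.

Variables (W : vectType F) (phi : {linear W -> V}).
Hypothesis phi_inj : injective phi.

Lemma indep_map (s : seq W) : indep [seq phi w | w <- s] <-> free s.
Proof.
have sumE (c : seq F) : \sum_(k < size [seq phi w | w <- s])
    c`_k *: [seq phi w | w <- s]`_k = phi (\sum_(k < size s) c`_k *: s`_k).
  rewrite size_map linear_sum; apply: eq_bigr => k _.
  by rewrite linearZZ (nth_map 0).
split=> [ind|/(@freeP _ _ _ (in_tuple s)) fr].
  apply/(@freeP _ _ _ (in_tuple s)) => k k0 i.
  pose c := mkseq (fun n => if insub n is Some j then k j else 0) (size s).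
  have cE (j : 'I_(size s)) : c`_j = k j by rewrite nth_mkseq // valK.
  rewrite -cE; apply: ind; [by rewrite size_mkseq size_map| |by rewrite size_map].
  rewrite sumE -[RHS](raddf0 phi); congr (phi _); rewrite -[RHS]k0.
  by apply: eq_bigr => j _; rewrite cE.
move=> c; rewrite size_map => sc; have := sumE c; rewrite size_map => ->.
rewrite -[RHS](raddf0 phi) => /phi_inj c0 k ks.
exact: (fr (fun i => c`_i) c0 (Ordinal ks)).
Qed.

Lemma dim_vspace P (U : {vspace W}) : (forall w, w \in U <-> P (phi w)) ->
  (forall v, P v -> exists w, v = phi w) -> pdim P = \dim U.
Proof.
move=> UP Pphi.
have ltn_dim n : (n <= \dim U)%N -> exists s : seq V,
    size s = n /\ (forall k, (k < n)%N -> P s`_k) /\ indep s.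
  move=> nU; have sz : size (take n (vbasis U)) = n.
    by rewrite size_takel // size_tuple.
  exists [seq phi w | w <- take n (vbasis U)]; rewrite size_map sz; split=> //.
  split=> [k kn|]; last first.
    apply/indep_map; have := basis_free (vbasisP U).
    by rewrite -{1}[tval (vbasis U)](cat_take_drop n) => /catl_free.
  rewrite (nth_map 0) ?sz //; apply/UP; apply: vbasis_mem.
  by apply: (mem_take (n0 := n)); rewrite mem_nth ?sz.
have dim_le n : (exists s : seq V,
    size s = n /\ (forall k, (k < n)%N -> P s`_k) /\ indep s) -> (n <= \dim U)%N.
  move=> [s [sn [sP si]]].
  have [t [st tU]] : exists t : seq W, s = [seq phi w | w <- t] /\ {subset t <= U}.
    have {si sn} {}sP : forall v, v \in s -> P v.
      by move=> v vs; rewrite -(nth_index 0 vs); apply: sP; rewrite -sn index_mem.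
    elim: s sP => [|v s IH] sP; first by exists [::].
    have [t [-> tU]] := IH (fun v vs => sP v (mem_behead (vs : v \in behead (_ :: s)))).
    have [w vw] := Pphi v (sP v (mem_head _ _)).
    exists (w :: t); rewrite vw; split=> // x; rewrite inE => /orP[/eqP->|/tU//].
    by apply/UP; rewrite -vw; apply: sP; rewrite mem_head.
  move: si; rewrite st => /indep_map; rewrite /free -sn st size_map => /eqP <-.
  by apply/dimvS/span_subvP.
have : of_dim P (pdim P).
  apply: epsilon_spec; exists (\dim U); split; first exact: ltn_dim.
  by move=> /dim_le; rewrite ltnn.
move=> [/dim_le le1 nle]; apply/eqP; rewrite eqn_leq le1 leqNgt /=.
by apply/negP => /ltn_dim.
Qed.

Lemma vspace_of (Q : W -> Prop) : Q 0 ->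
  (forall a u v, Q u -> Q v -> Q (a *: u + v)) ->
  exists U : {vspace W}, forall w, w \in U <-> Q w.
Proof.
move=> Q0 QD.
have grow n (U : {vspace W}) : (forall w, w \in U -> Q w) ->
    (\dim {:W} - \dim U <= n)%N -> exists U : {vspace W}, forall w, w \in U <-> Q w.
  elim: n U => [|n IH] U UQ dU;
    have [[w [Qw wU]]|full] := classic (exists w, Q w /\ w \notin U).
  - case/negP: wU; suff -> : U = fullv by rewrite memvf.
    by apply/eqP; rewrite eqEdim subvf -subn_eq0 -leqn0.
  - exists U => w; split=> [/UQ//|Qw]; apply: NNPP => wU.
    by apply: full; exists w; split=> //; apply/negP.
  - apply: (IH (U + <[w]>)%VS).
      move=> x /memv_addP[u uU [y /vlineP[k ->] ->]].
      by rewrite addrC; apply: QD => //; apply: UQ.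
    have : (\dim U < \dim (U + <[w]>)%VS)%N.
      rewrite ltnNge; apply/negP => le; case/negP: wU.
      have /eqP-> : U == (U + <[w]>)%VS by rewrite eqEdim addvSl.
      by apply: (subvP (addvSr U <[w]>%VS)); apply: memv_line.
    have := dimvS (subvf (U + <[w]>)%VS); lia.
  - exists U => w; split=> [/UQ//|Qw]; apply: NNPP => wU.
    by apply: full; exists w; split=> //; apply/negP.
by apply: (grow _ 0%VS _ (leqnn _)) => w; rewrite memv0 => /eqP->.
Qed.

Lemma subspace_vspace P : subspace P -> exists U : {vspace W},
  forall w, w \in U <-> P (phi w).
Proof.
move=> [P0 PD]; apply: (vspace_of (Q := fun w => P (phi w))).
  by rewrite raddf0.
by move=> a u v Pu Pv; rewrite linearP; apply: PD.
Qed.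

Definition within P := forall v, P v -> exists w, v = phi w.

Lemma dim_le P Q : subspace P -> subspace Q -> within Q ->
  (forall v, P v -> Q v) -> (pdim P <= pdim Q)%N.
Proof.
move=> sP sQ wQ PQ; have [U UP] := subspace_vspace sP.
have [U' UQ] := subspace_vspace sQ.
rewrite (dim_vspace UP) ?(dim_vspace UQ) //; last by move=> v /PQ /wQ.
by apply/dimvS/subvP => w /UP /PQ /UQ.
Qed.

Lemma dim_eq_sub P Q : subspace P -> subspace Q -> within Q ->
  (forall v, P v -> Q v) -> (pdim Q <= pdim P)%N -> forall v, Q v -> P v.
Proof.
move=> sP sQ wQ PQ; have [U UP] := subspace_vspace sP.
have [U' UQ] := subspace_vspace sQ.
rewrite (dim_vspace UP) ?(dim_vspace UQ) //; last by move=> v /PQ /wQ.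
move=> le v Qv; have [w vw] := wQ v Qv; rewrite vw; apply/UP.
have /eqP-> : U == U' by rewrite eqEdim le andbT; apply/subvP => x /UP /PQ /UQ.
by apply/UQ; rewrite -vw.
Qed.

Lemma dim_add_cap P Q : subspace P -> subspace Q -> within P -> within Q ->
  (pdim P + pdim Q =
   pdim (fun v => exists a b, [/\ P a, Q b & v = (a + b)%R]) +
   pdim (fun v => P v /\ Q v))%N.
Proof.
move=> sP sQ wP wQ; have [U UP] := subspace_vspace sP.
have [U' UQ] := subspace_vspace sQ.
rewrite (dim_vspace UP) // (dim_vspace UQ) // -dimv_sum_cap.
congr addn; apply/esym/dim_vspace.
- move=> w; split=> [/memv_addP[u uU [u' uU' ->]]|[a [b [Pa Qb wE]]]].
    by exists (phi u), (phi u'); rewrite raddfD; split=> //; [apply/UP|apply/UQ].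
  have [u aE] := wP a Pa; have [u' bE] := wQ b Qb.
  move: wE; rewrite aE bE -raddfD => /phi_inj->; apply: memv_add.
    by apply/UP; rewrite -aE.
  by apply/UQ; rewrite -bE.
- move=> v [a [b [/wP[u ->] /wQ[u' ->] ->]]].
  by exists (u + u'); rewrite raddfD.
- by move=> w; rewrite memv_cap; split=> [/andP[/UP ? /UQ ?]|[/UP-> /UQ->]].
- by move=> v [/wP].
Qed.

Lemma dim_rank (f : {linear V -> V}) (psi : {linear V -> W}) P :
    cancel phi psi -> subspace P -> within P ->
    within (fun v => exists2 u, P u & v = f u) ->
  (pdim P = pdim (fun v => P v /\ f v = 0%R) +
           pdim (fun v => exists2 u, P u & v = f u))%N.
Proof.
move=> phiK sP wP wfP; have [U UP] := subspace_vspace sP.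
pose g := linfun (psi \o (f \o phi)).
have gE w : w \in U -> phi (g w) = f (phi w).
  move=> /UP Pw; have [|w' fw] := wfP (f (phi w)); first by exists (phi w).
  by rewrite lfunE /= fw phiK.
rewrite (dim_vspace UP) // -(limg_ker_dim g U); congr addn; apply/esym.
  apply: dim_vspace => [w|v [/wP//]]; rewrite memv_cap memv_ker; split.
    by move=> /andP[wU /eqP g0]; rewrite -gE // g0 raddf0; split=> //; apply/UP.
  by move=> [/UP wU fw]; rewrite wU lfunE /= fw raddf0 /=.
apply: dim_vspace => // w; split=> [/memv_imgP[u uU ->]|[v Pv wE]].
  by exists (phi u); [apply/UP | apply: gE].
have [u vE] := wP v Pv; have uU : u \in U by apply/UP; rewrite -vE.
by move: wE; rewrite vE -gE // => /phi_inj->; apply: memv_img.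
Qed.

End Dimension.

(** * The Koszul complex *)

Section WeightMap.
Variable F : fieldType.
Local Notation S := {mpoly F[4]}.
Implicit Types (p q : S) (w : 'X_{1..4} -> F).

Definition wmap w p : S := \sum_(m <- msupp p) (w m * p@_m) *: 'X_[m].

Lemma mcoeff_wmap w p m : (wmap w p)@_m = w m * p@_m.
Proof.
rewrite /wmap linear_sum /=.
have [mp|mp] := boolP (m \in msupp p).
  rewrite (bigD1_seq m) ?msupp_uniq //= mcoeffZ mcoeffX eqxx mulr1 big1 ?addr0 //.
  by move=> k km; rewrite mcoeffZ mcoeffX (negbTE km) mulr0.
rewrite (memN_msupp_eq0 mp) mulr0 big_seq big1 // => k kp.
rewrite mcoeffZ mcoeffX (_ : k == m = false) ?mulr0 //.
by apply: contraNF mp => /eqP<-.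
Qed.

Lemma wmap_is_linear w : linear (wmap w).
Proof.
move=> a p q; apply/mpolyP => m.
by rewrite mcoeff_wmap mcoeffD mcoeffZ mcoeffD mcoeffZ !mcoeff_wmap mulrDr mulrCA.
Qed.

HB.instance Definition _ w :=
  GRing.isLinear.Build F S S *:%R (wmap w) (wmap_is_linear w).

Lemma wmapZ w a p : wmap w (a *: p) = a *: wmap w p.
Proof. exact: linearZZ. Qed.

Lemma wmapX w m : wmap w 'X_[m] = w m *: 'X_[m].
Proof.
apply/mpolyP => k; rewrite mcoeff_wmap mcoeffZ mcoeffX.
by case: eqP => [->//|_]; rewrite !mulr0.
Qed.

Lemma wmap_mulX w w' k p : (forall m, w m = w' (U_(k) + m)%MM) ->
  'X_k * wmap w p = wmap w' ('X_k * p).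
Proof.
move=> ww'; rewrite (mpolyE p) (linear_sum (wmap w)) !mulr_sumr (linear_sum (wmap w')).
apply: eq_bigr => m _ /=.
by rewrite wmapZ wmapX -!scalerAr -!mpolyXD wmapZ wmapX -ww'.
Qed.

Lemma wmap_comp w w' p : (forall m, w m * w' m = 1) -> wmap w (wmap w' p) = p.
Proof. by move=> h; apply/mpolyP => m; rewrite !mcoeff_wmap mulrA h mul1r. Qed.

Lemma mul_mderivX k m : 'X_k * ('X_[m])^`M(k) = (m k)%:R *: 'X_[m] :> S.
Proof.
rewrite mderivX -scalerAr -mpolyXD; have [->|mk] := eqVneq (m k) 0%N.
  by rewrite !scale0r.
by congr (_ *: 'X_[_]); rewrite addmC submK // lep1mP.
Qed.

Lemma euler p : \sum_k 'X_k * p^`M(k) = wmap (fun m => (mdeg m)%:R) p.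
Proof.
rewrite [in LHS](mpolyE p) /wmap; under eq_bigr => k _ do rewrite (linear_sum (mderiv k)) mulr_sumr.
rewrite exchange_big; apply: eq_bigr => m _ /=.
under eq_bigr => k _ do rewrite mderivZ -scalerAr mul_mderivX scalerA mulrC.
by rewrite -scaler_suml -mulr_suml -natr_sum -mdegE.
Qed.

End WeightMap.

Section Koszul.
Variable F : fieldType.
Hypothesis char0 : forall n, n.+1%:R != 0 :> F.
Local Notation S := {mpoly F[4]}.
Implicit Types (T : {set 'I_4}) (p : S) (M I J K : S -> Prop).

Definition kchains := {ffun {set 'I_4} -> S}.
Implicit Types (c : kchains).

Definition ksign (k : 'I_4) T : S := (-1) ^+ #|[set j in T | (j < k)%N]|.

Definition koszul c : kchains :=
  [ffun T : {set 'I_4} => \sum_(k : 'I_4 | k \notin T)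
      ((-1) ^+ #|[set j in T | (j < k)%N]| * 'X_k * c (k |: T))].

Lemma koszulE c T :
  koszul c T = \sum_(k | k \notin T) ksign k T * ('X_k * c (k |: T)).
Proof. by rewrite ffunE; apply: eq_bigr => k _; rewrite mulrA. Qed.

Lemma koszul_is_linear : linear koszul.
Proof.
move=> a c c'; apply/ffunP => T; rewrite !ffunE scaler_sumr -big_split /=.
by apply: eq_bigr => k _; rewrite !ffunE mulrDr -scalerAr.
Qed.

HB.instance Definition _ :=
  GRing.isLinear.Build F kchains kchains *:%R koszul koszul_is_linear.

Lemma ksignU k l T : k \notin T -> ksign l (k |: T) = (-1) ^+ (k < l)%N * ksign l T.
Proof.
move=> kT; rewrite /ksign -exprD; congr (_ ^+ _).
have [kl|kl] := boolP (k < l)%N.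
  rewrite (_ : [set j in k |: T | _] = k |: [set j in T | (j < l)%N]).
    by rewrite cardsU1 inE (negbTE kT).
  apply/setP => j; rewrite !inE andb_orl; congr orb.
  by case: eqP => // ->; rewrite kl.
rewrite add0n; apply: eq_card => j; rewrite !inE andb_orl.
by case: eqP => // ->; rewrite (negbTE kl) andbF.
Qed.

Lemma ksignUU k T : k \notin T -> ksign k (k |: T) = ksign k T.
Proof. by move=> kT; rewrite ksignU // ltnn expr0 mul1r. Qed.

Lemma ksign_sq k T : ksign k T * ksign k T = 1.
Proof. by rewrite /ksign -expr2 sqrr_sign. Qed.

Lemma ksign_swap k l T : k \notin T -> l \notin T -> k != l ->
  ksign k T * ksign l (k |: T) = - (ksign l T * ksign k (l |: T)).
Proof.
move=> kT lT kl; rewrite !ksignU // mulrCA [ksign l T * _]mulrCA [ksign k T * _]mulrC.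
rewrite -mulNr; congr (_ * _).
have [lt|lt|e] := ltngtP k l; last by move: kl; rewrite (val_inj e) eqxx.
  by rewrite expr1 expr0.
by rewrite expr1 expr0 opprK.
Qed.

Lemma two_neq0 : 2%:R != 0 :> F. Proof. exact: char0. Qed.

Lemma koszul_koszul c : koszul (koszul c) = 0.
Proof.
apply/ffunP => T; rewrite koszulE ffunE.
pose G k l : S := ksign k T * ksign l (k |: T) * ('X_k * 'X_l * c (l |: (k |: T))).
have GE : \sum_(k | k \notin T) ksign k T * ('X_k * koszul c (k |: T)) =
    \sum_(k | k \notin T) \sum_(l | l \notin k |: T) G k l.
  apply: eq_bigr => k kT; rewrite koszulE !mulr_sumr; apply: eq_bigr => l lT.
  by rewrite /G -!mulrA; congr (_ * _); rewrite mulrCA; congr (_ * _).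
rewrite GE; set X := (X in X = _).
have : X = - X.
  rewrite {1}/X (exchange_big_dep (fun l => l \notin T)) /=; last first.
    by move=> k l _; rewrite !inE negb_or => /andP[].
  rewrite /X -sumrN; apply: eq_bigr => l lT; rewrite -sumrN.
  apply: eq_big => [k|k]; first by rewrite !inE !negb_or lT andbT andbC eq_sym.
  rewrite !inE negb_or => /andP[kT /andP[lk _]].
  rewrite /G ksign_swap // 1?eq_sym // mulNr; congr (- (_ * _)).
  by rewrite ['X_k * _]mulrC setUCA.
move/eqP; rewrite -subr_eq0 opprK -mulr2n -scaler_nat scaler_eq0.
by rewrite (negbTE two_neq0) => /eqP.
Qed.

Lemma mderiv_ksign l k T p : (ksign k T * p)^`M(l) = ksign k T * p^`M(l).
Proof.
rewrite /ksign; elim: #|_| => [|n IH]; first by rewrite !expr0 !mul1r.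
by rewrite !exprS !mulN1r !mulNr mderivN IH.
Qed.

Lemma mderiv_sum l (P : pred 'I_4) (E : 'I_4 -> S) :
  (\sum_(k | P k) E k)^`M(l) = \sum_(k | P k) (E k)^`M(l).
Proof. exact: linear_sum. Qed.

Definition homotopy c : kchains :=
  [ffun T : {set 'I_4} => \sum_(l in T) ksign l T * (c (T :\ l))^`M(l)].

Lemma mderiv_mulX l k p :
  ('X_k * p)^`M(l) = (if l == k then p else 0) + 'X_k * p^`M(l).
Proof.
rewrite mderivM mderivX mnm1E; congr (_ + _); rewrite [l == k]eq_sym.
case: eqP => [->|_]; last by rewrite scale0r mul0r.
by rewrite scale1r -[(_ - _)%MM](_ : 0%MM = _) ?mpolyX0 ?mul1r //; apply/mnmP => i;
  rewrite mnmBE subnn mnm0E.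
Qed.

(* The de Rham differential is a contracting homotopy, up to the total degree
   (Euler's formula and Cartan's magic formula). *)
Lemma koszul_homotopy c T : (koszul (homotopy c) + homotopy (koszul c)) T =
  wmap (fun m => (mdeg m + #|T|)%:R) (c T).
Proof.
rewrite ffunE koszulE [homotopy _ T]ffunE.
have -> : \sum_(k | k \notin T) ksign k T * ('X_k * homotopy c (k |: T)) =
    \sum_(k | k \notin T) 'X_k * (c T)^`M(k) +
    \sum_(k | k \notin T) \sum_(l in T) ksign k T * ksign l (k |: T) *
      ('X_k * (c (k |: (T :\ l)))^`M(l)).
  rewrite -big_split /=; apply: eq_bigr => k kT.
  rewrite ffunE big_setU1 //= setU1K //  mulrDr mulrDr; congr (_ + _).
    by rewrite ksignUU // mulrCA (mulrA (ksign k T)) ksign_sq mul1r.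
  rewrite !mulr_sumr; apply: eq_bigr => l lT.
  rewrite -mulrA; congr (_ * _); rewrite mulrCA; congr (_ * (_ * (c _)^`M(l))).
  apply/setP => j; rewrite !inE; case: (eqVneq j k) => // ->.
  by rewrite andbT; apply: contraNneq kT => ->.
have -> : \sum_(l in T) ksign l T * (koszul c (T :\ l))^`M(l) =
    \sum_(l in T) (c T + 'X_l * (c T)^`M(l)) +
    \sum_(l in T) \sum_(k | k \notin T) ksign l T * ksign k (T :\ l) *
      ('X_k * (c (k |: (T :\ l)))^`M(l)).
  rewrite -big_split /=; apply: eq_bigr => l lT.
  rewrite koszulE (bigD1 l) ?in_setD1 ?eqxx //= mderivD mulrDr.
  have lTl : l \notin T :\ l by rewrite !inE eqxx.
  have sl : ksign l T = ksign l (T :\ l).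
    by rewrite -{1}(setD1K lT) ksignUU.
  congr (_ + _).
    by rewrite mderiv_ksign mulrA sl ksign_sq mul1r mderiv_mulX eqxx setD1K.
  rewrite mderiv_sum mulr_sumr; apply: eq_big => [k|k].
    rewrite !inE negb_and negbK; case: (eqVneq k l) => [->|_] /=; last by rewrite andbT.
    by rewrite lT.
  move=> /andP[_ kl]; rewrite mderiv_ksign mderiv_mulX eq_sym (negbTE kl) add0r.
  by rewrite mulrA.
rewrite addrACA exchange_big /=.
rewrite [X in _ + X](_ : _ = 0) ?addr0; last first.
  rewrite -big_split big1 //= => l lT; rewrite -big_split big1 //= => k kT.
  rewrite -mulrDl; set t := _ + _; suff -> : t = 0 by rewrite mul0r.
  have kl : k != l by apply: contraNneq kT => ->.
  have lTl : l \notin T :\ l by rewrite !inE eqxx.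
  have kTl : k \notin T :\ l by rewrite !inE negb_and kT orbT.
  rewrite /t; have -> : ksign k T = (-1) ^+ (l < k)%N * ksign k (T :\ l).
    by rewrite -{1}(setD1K lT) ksignU.
  rewrite ksignU // mulrACA [ksign k _ * _]mulrC -[X in _ + X]mul1r -mulrDl.
  case: ltngtP kl => // [lt|lt|e] kl; last by rewrite (val_inj e) eqxx in kl.
    by rewrite expr0 expr1 mulr1 addNr mul0r.
  by rewrite expr0 expr1 mul1r addNr mul0r.
rewrite big_split /= addrCA sumr_const addrC [X in X + _]addrC.
rewrite -(bigID (mem T) xpredT (fun k => 'X_k * (c T)^`M(k))) /= euler.
apply/mpolyP => m; rewrite mcoeffD mcoeffMn !mcoeff_wmap natrD mulrDl.
by rewrite !mulr_natl.
Qed.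

Definition supported (i : nat) c : Prop := forall T, #|T| != i -> c T = 0.

Lemma koszul_supported i c : supported i.+1 c -> supported i (koszul c).
Proof.
move=> ci T Ti; rewrite koszulE big1 // => k kT.
by rewrite ci ?mulr0 // cardsU1 kT.
Qed.

Lemma homotopy_supported i c : supported i c -> supported i.+1 (homotopy c).
Proof.
move=> ci T Ti; rewrite ffunE big1 // => l lT.
rewrite ci ?mderiv0 ?mulr0 //; apply: contra Ti => /eqP <-.
by rewrite [X in X == _](cardsD1 l T) lT.
Qed.

Lemma koszul_exact i c : (0 < i)%N -> supported i c -> koszul c = 0 ->
  exists2 c', supported i.+1 c' & c = koszul c'.
Proof.
case: i => // i _ ci dc.
pose w j (m : 'X_{1..4}) : F := ((mdeg m + j)%:R)^-1.
pose c1 : kchains := [ffun T : {set 'I_4} => wmap (w i.+1) (c T)].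
have c1i : supported i.+1 c1 by move=> T Ti; rewrite ffunE ci // linear0.
have dc1 : koszul c1 = 0.
  apply/ffunP => T; transitivity (wmap (w i) (koszul c T)); last first.
    by rewrite dc !ffunE linear0.
  rewrite !koszulE linear_sum.
  apply: eq_bigr => k _; rewrite ffunE (wmap_mulX (w' := w i)).
    rewrite /ksign; elim: #|_| => [|n IH]; first by rewrite !expr0 !mul1r.
    by rewrite !exprS !mulN1r !mulNr linearN /= -IH.
  by move=> m; rewrite /w mdegD mdeg1 addnS.
exists (homotopy c1); first exact: homotopy_supported.
apply/ffunP => T; have := koszul_homotopy c1 T.
rewrite dc1 ffunE [homotopy 0 T]ffunE [X in _ + X]big1; last first.
  by move=> l _; rewrite ffunE mderiv0 mulr0.
rewrite addr0 => ->; have [Ti|Ti] := eqVneq #|T| i.+1; last first.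
  by rewrite c1i // linear0 ci.
rewrite ffunE wmap_comp // => m; rewrite Ti /w divff // addnS; exact: char0.
Qed.

End Koszul.

(** * Bigraded Koszul homology *)

Section Bigraded.
Variable F : numFieldType.
Local Notation S := {mpoly F[4]}.
Local Notation kchains := (kchains F).
Implicit Types (T : {set 'I_4}) (p q f : S) (M I J K : S -> Prop) (c : kchains).
Implicit Types (d e : nat * nat).

Lemma natr_char0 n : n.+1%:R != 0 :> F.
Proof. by rewrite Num.Theory.pnatr_eq0. Qed.

Definition padd d e : nat * nat := (d.1 + e.1, d.2 + e.2)%N.

Definition bihom d p : Prop := forall m, m \in msupp p -> mbideg m = d.

Definition bihom_shift d e p : Prop :=
  if (e.1 <= d.1)%N && (e.2 <= d.2)%N then bihom ((d.1 - e.1)%N, (d.2 - e.2)%N) p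
  else p = 0.

Definition kchain I (i : nat) d c : Prop :=
  forall T, if #|T| == i then I (c T) /\ bihom_shift d (sdeg T) (c T) else c T = 0.

Definition kcycle I i d c : Prop := kchain I i d c /\ koszul c = 0.

Definition kboundary I i d c : Prop := exists b, kchain I i.+1 d b /\ c = koszul b.

Definition gbetti I i d : nat := (pdim (kcycle I i d) - pdim (kboundary I i d))%N.

Lemma mbidegD m m' : mbideg (m + m')%MM = padd (mbideg m) (mbideg m').
Proof. by rewrite /mbideg /padd !mnmDE /=; congr pair; lia. Qed.

(* [prs e d p] is the component of [p] of bidegree d - e, and 0 if e is not
   below d. *)
Definition prs e d : S -> S := wmap (fun m => (padd (mbideg m) e == d)%:R).

HB.instance Definition _ e d := GRing.Linear.on (prs e d).

Lemma prs0 e d : prs e d 0 = 0. Proof. exact: linear0. Qed.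
Lemma prsD e d p q : prs e d (p + q) = prs e d p + prs e d q.
Proof. exact: linearD. Qed.
Lemma prsZ e d a p : prs e d (a *: p) = a *: prs e d p.
Proof. exact: linearZZ. Qed.

Lemma prs_sum e d (T : Type) (r : seq T) (P : pred T) (E : T -> S) :
  prs e d (\sum_(x <- r | P x) E x) = \sum_(x <- r | P x) prs e d (E x).
Proof. exact: linear_sum. Qed.

Lemma mcoeff_prs e d p m :
  (prs e d p)@_m = if padd (mbideg m) e == d then p@_m else 0.
Proof. by rewrite mcoeff_wmap; case: eqP; rewrite ?mul1r ?mul0r. Qed.

Lemma prs_id e d p :
  prs e d p = p <-> (forall m, m \in msupp p -> padd (mbideg m) e = d).
Proof.
split=> [h m|h].
  by rewrite mcoeff_msupp -h mcoeff_prs; case: ifP => [/eqP//|_]; rewrite eqxx.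
apply/mpolyP => m; rewrite mcoeff_prs; case: eqP => // ne.
by rewrite memN_msupp_eq0 //; apply/negP => /h.
Qed.

Lemma bihom_shiftP d e p : bihom_shift d e p <-> prs e d p = p.
Proof.
rewrite prs_id /bihom_shift /bihom /padd; case: d e => [d1 d2] [e1 e2] /=.
case: ifP => [/andP[l1 l2]|l]; split=> h.
- by move=> m /h[-> ->]; rewrite !subnK.
- by move=> m /h[<- <-]; rewrite !addnK.
- by rewrite h msupp0.
- apply/mpolyP => k; rewrite mcoeff0; apply: memN_msupp_eq0; apply/negP => /h[E1 E2].
  by move: l; rewrite -E1 -E2 !leq_addl.
Qed.

Lemma prs_idem e d p : prs e d (prs e d p) = prs e d p.
Proof. by apply/mpolyP => m; rewrite !mcoeff_prs; case: (_ == d). Qed.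

Lemma prs_mulX e d m p :
  'X_[m] * prs (padd e (mbideg m)) d p = prs e d ('X_[m] * p).
Proof.
rewrite (mpolyE p) [in RHS]mulr_sumr [prs _ _ (\sum_(i <- _) _)]linear_sum mulr_sumr.
rewrite [RHS]linear_sum; apply: eq_bigr => k _ /=.
rewrite -scalerAr /prs !wmapZ -mpolyXD !wmapX -!scalerAr -mpolyXD mbidegD.
congr (_ *: (_%:R *: _)); congr (nat_of_bool (_ == _)).
by rewrite /padd /=; congr pair; lia.
Qed.

Definition homogeneous M : Prop := forall e d p, M p -> M (prs e d p).

Lemma bihom_prs a f e d : bihom a f -> prs e d f = if padd a e == d then f else 0.
Proof.
move=> fa; apply/mpolyP => m; rewrite mcoeff_prs.
have [mf|mf] := boolP (m \in msupp f); first by rewrite (fa m mf); case: ifP; rewrite ?mcoeff0.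
by rewrite (memN_msupp_eq0 mf); case: ifP => //; case: ifP; rewrite ?mcoeff0 ?(memN_msupp_eq0 mf).
Qed.

Lemma prs_mul_bihom e d f a p : bihom a f -> prs e d (p * f) = prs (padd e a) d p * f.
Proof.
move=> fa; elim/mpolyind: p => [|k m p _ _ IH].
  by rewrite mul0r !prs0 mul0r.
rewrite mulrDl !prsD mulrDl IH; congr (_ + _).
rewrite -scalerAl !prsZ -scalerAl; congr (_ *: _).
rewrite -prs_mulX (bihom_prs _ _ fa) /prs wmapX.
have -> : (padd a (padd e (mbideg m)) == d) = (padd (mbideg m) (padd e a) == d).
  by congr (_ == _); rewrite /padd /=; congr pair; lia.
by case: eqP; rewrite ?scale1r ?scale0r ?mulr0 ?mul0r.
Qed.

Lemma gen_ideal_homogeneous (gs : seq S) :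
  (forall g, g \in gs -> exists a, bihom a g) -> homogeneous (gen_ideal gs).
Proof.
move=> gsh e d p; have [G0 [GD GM]] := gen_ideal_ideal_set gs.
move=> gp; move: p gp e d; apply: gen_ideal_min.
  split; [|split].
  - by move=> e d; rewrite prs0.
  - by move=> a b ha hb e d; rewrite prsD; apply: GD.
  - move=> r a ha e d; elim/mpolyind: r => [|k m p _ _ IH].
      by rewrite mul0r prs0.
    rewrite mulrDl prsD; apply: GD => //.
    rewrite -scalerAl prsZ -prs_mulX; apply: ideal_setZ; last exact: GM.
    exact: gen_ideal_ideal_set.
move=> g gin e d; have [a ga] := gsh g gin.
rewrite (bihom_prs _ _ ga); case: ifP => _; first exact: mem_gen_ideal.
exact: G0.
Qed.

Lemma cap_homogeneous J K : homogeneous J -> homogeneous K -> homogeneous (cap_ideal J K).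
Proof. by move=> hJ hK e d p [/(hJ e d) ? /(hK e d) ?]. Qed.

Lemma sdegU k T : k \notin T -> sdeg (k |: T) = padd (sdeg T) (mbideg U_(k)).
Proof.
move=> kT; rewrite /sdeg /padd /=.
have cU (D : {set 'I_4}) : #|(k |: T) :&: D| = (#|T :&: D| + (k \in D))%N.
  have [kD|kD] := boolP (k \in D); last first.
    rewrite addn0; apply: eq_card => j; rewrite !inE.
    by case: eqVneq => // ->; rewrite (negbTE kD) !andbF.
  have -> : (k |: T) :&: D = k |: (T :&: D).
    by apply/setP => j; rewrite !inE; case: eqVneq => // ->.
  by rewrite cardsU1 inE (negbTE kT) addnC.
rewrite !cU; congr pair; congr addn; move: k {kT cU};
  by apply: ord4_ind; rewrite !mnm1E !inE.
Qed.

Definition kproj d c : kchains := [ffun T => prs (sdeg T) d (c T)].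

Lemma koszul_kproj d c : koszul (kproj d c) = kproj d (koszul c).
Proof.
apply/ffunP => T; rewrite [RHS]ffunE !koszulE linear_sum; apply: eq_bigr => k kT.
rewrite ffunE sdegU // prs_mulX /ksign.
elim: #|_| => [|n IH]; first by rewrite !expr0 !mul1r.
by rewrite !exprS !mulN1r !mulNr linearN /= -IH.
Qed.

Definition uchain I i c : Prop :=
  forall T, if #|T| == i then I (c T) else c T = 0.

Lemma kchainP I i d c : kchain I i d c <-> uchain I i c /\ kproj d c = c.
Proof.
split=> [h|[h hp] T].
  split=> [T|]; first by have := h T; case: eqP => // _ [].
  apply/ffunP => T; rewrite ffunE; have := h T; case: eqP => _; last by move->; rewrite prs0.
  by move=> [_ /bihom_shiftP].
have := h T; case: eqP => // _ IT; split=> //.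
by apply/bihom_shiftP; rewrite -{2}hp ffunE.
Qed.

Lemma uchain_kproj I i d c : homogeneous I -> uchain I i c -> uchain I i (kproj d c).
Proof.
move=> hI h T; have := h T; rewrite ffunE; case: eqP => _; first exact: hI.
by move->; rewrite prs0.
Qed.

Lemma kproj_idem d c : kproj d (kproj d c) = kproj d c.
Proof. by apply/ffunP => T; rewrite !ffunE prs_idem. Qed.

Lemma uchain_linear I i a c c' : ideal_set I -> uchain I i c -> uchain I i c' ->
  uchain I i (a *: c + c').
Proof.
move=> idI h h' T; have := h T; have := h' T; rewrite !ffunE; case: eqP => _ hc hc'.
  by case: (idI) => _ [ID _]; apply: ID => //; apply: ideal_setZ.
by rewrite hc hc' scaler0 addr0.
Qed.

Lemma koszul_uchain I i c : ideal_set I -> uchain I i.+1 c -> uchain I i (koszul c).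
Proof.
move=> idI h T; case: eqP => [Ti|/eqP Ti].
  rewrite koszulE; apply: ideal_set_sum => // k kT.
  have [_ [_ IM]] := idI; rewrite mulrA; apply: IM.
  by have := h (k |: T); rewrite cardsU1 kT Ti eqxx.
have := @koszul_supported F i c; apply => // U Ui.
by have := h U; rewrite (negbTE Ui).
Qed.

Lemma koszulD c c' : koszul (c + c') = koszul c + koszul c'.
Proof. exact: linearD. Qed.
Lemma koszulB c c' : koszul (c - c') = koszul c - koszul c'.
Proof. exact: linearB. Qed.

Definition exact_at I i : Prop := forall c, uchain I i c -> koszul c = 0 ->
  exists2 b, uchain I i.+1 b & c = koszul b.

Lemma exact_at_cycle I i d : homogeneous I -> exact_at I i ->
  forall c, kcycle I i d c -> kboundary I i d c.
Proof.
move=> hI ex c [/kchainP[cI cd] c0]; have [b bI bE] := ex c cI c0.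
exists (kproj d b); rewrite koszul_kproj -bE cd; split=> //.
by apply/kchainP; split; [exact: uchain_kproj|exact: kproj_idem].
Qed.

Lemma exact_principal f I i : f != 0 -> (forall p, I p <-> divides f p) ->
  (0 < i)%N -> exact_at I i.
Proof.
move=> f0 If i0 c cI dc.
have [c1 c1E] : exists c1 : kchains, forall T, c T = c1 T * f /\ (#|T| != i -> c1 T = 0).
  have [T|g gE] := @fin_all_exists _ _ (fun T p => c T = p * f /\ (#|T| != i -> p = 0)).
    have := cI T; case: eqP => [_ /If[q ->]|_ ->]; first by exists q.
    by exists 0; rewrite mul0r.
  by exists [ffun T => g T] => T; rewrite !ffunE.
have kE (c2 : kchains) : koszul [ffun T => c2 T * f] = [ffun T => koszul c2 T * f].
  apply/ffunP => T; rewrite [RHS]ffunE !koszulE mulr_suml; apply: eq_bigr => k _.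
  by rewrite ffunE !mulrA.
have cE : c = [ffun T => c1 T * f] by apply/ffunP => T; rewrite ffunE; case: (c1E T).
have c10 : koszul c1 = 0.
  apply/ffunP => T; have := congr1 (fun h : kchains => h T) dc.
  by rewrite cE kE !ffunE => /eqP; rewrite mulf_eq0 (negbTE f0) orbF => /eqP.
have c1s : supported i c1 by move=> T Ti; case: (c1E T) => _; apply.
have [b bs bE] := koszul_exact natr_char0 i0 c1s c10.
exists [ffun T => b T * f]; last by rewrite kE -bE.
move=> T; rewrite ffunE; case: eqP => [_|/eqP Ti]; first by apply/If; exists (b T).
by rewrite bs // mul0r.
Qed.

Lemma uchain_split I J K i c : ideal_set J ->
  (forall p, I p -> exists a b, [/\ J a, K b & p = a + b]) ->
  uchain I i c -> exists a b, [/\ uchain J i a, uchain K i b & c = a + b].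
Proof.
move=> idJ IJK h.
have [T|g gE] := @fin_all_exists _ _ (fun T (ab : S * S) => c T = ab.1 + ab.2 /\
   if #|T| == i then J ab.1 /\ K ab.2 else ab = 0).
  have := h T; case: eqP => _; last by move->; exists 0; rewrite addr0.
  by move=> /IJK[a [b [Ja Kb ->]]]; exists (a, b).
exists [ffun T => (g T).1], [ffun T => (g T).2]; split.
- by move=> T; rewrite ffunE; case: (gE T) => _; case: eqP => [_ []|_ ->].
- by move=> T; rewrite ffunE; case: (gE T) => _; case: eqP => [_ []|_ ->].
- by apply/ffunP => T; rewrite !ffunE; case: (gE T).
Qed.

Lemma uchain_sub I J i c : (forall p, I p -> J p) -> uchain I i c -> uchain J i c.
Proof. by move=> IJ h T; have := h T; case: eqP => // _ /IJ. Qed.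

Lemma uchainB I i c c' : ideal_set I -> uchain I i c -> uchain I i c' ->
  uchain I i (c - c').
Proof.
by move=> idI h h'; rewrite -scaleN1r addrC; apply: uchain_linear.
Qed.

Lemma exact_add I J K i : ideal_set I -> ideal_set J -> ideal_set K ->
  (forall p, J p -> I p) -> (forall p, K p -> I p) ->
  (forall p, I p -> exists a b, [/\ J a, K b & p = a + b]) ->
  exact_at J i.+1 -> exact_at K i.+1 -> exact_at (cap_ideal J K) i ->
  exact_at I i.+1.
Proof.
move=> idI idJ idK JI KI IJK exJ exK exL c cI dc.
have [a [b [aJ bK cE]]] := uchain_split idJ IJK cI.
have ab : koszul a = - koszul b.
  by apply/eqP; rewrite -addr_eq0 -koszulD -cE dc.
have [||l lL lE] := exL (koszul a).
- move=> T; have := koszul_uchain idJ aJ T; have := koszul_uchain idK bK T.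
  case: eqP => // _ hb ha; split=> //; rewrite ab ffunE -scaleN1r.
  exact: ideal_setZ.
- exact: (koszul_koszul natr_char0).
have lJ : uchain J i.+1 l by apply: uchain_sub lL => p [].
have lK : uchain K i.+1 l by apply: uchain_sub lL => p [].
have [||a1 a1J a1E] := exJ (a - l).
- exact: uchainB.
- by rewrite koszulB lE subrr.
have [||b1 b1K b1E] := exK (b + l).
- by rewrite -[l]scale1r addrC; apply: uchain_linear.
- by rewrite koszulD -lE ab addrN.
exists (a1 + b1); last by rewrite koszulD -a1E -b1E addrACA addNr addr0.
rewrite -[a1]scale1r; apply: uchain_linear => //.
  exact: (uchain_sub JI a1J).
exact: (uchain_sub KI b1K).
Qed.

End Bigraded.

(** * Betti numbers of a sum of ideals *)

Section FiniteDimension.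
Variable F : numFieldType.
Local Notation S := {mpoly F[4]}.
Local Notation kchains := (kchains F).
Implicit Types (T : {set 'I_4}) (p q f : S) (M I J K : S -> Prop) (c : kchains).
Implicit Types (d e : nat * nat).

Section Coordinates.
Variable N : nat.

Definition kcoords := {ffun {set 'I_4} * 'X_{1..4 < N} -> F^o}.

Definition of_coords (w : kcoords) : kchains :=
  [ffun T => \sum_(m : 'X_{1..4 < N}) w (T, m) *: 'X_[m]].

Definition to_coords c : kcoords := 
  [ffun x : {set 'I_4} * 'X_{1..4 < N} => (c x.1)@_x.2].

Lemma of_coords_is_linear : linear of_coords.
Proof.
move=> a w w'; apply/ffunP => T; rewrite !ffunE scaler_sumr -big_split /=.
by apply: eq_bigr => m _; rewrite !ffunE scalerDl scalerA.
Qed.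

HB.instance Definition _ :=
  GRing.isLinear.Build F kcoords kchains *:%R of_coords of_coords_is_linear.

Lemma to_coords_is_linear : linear to_coords.
Proof. by move=> a c c'; apply/ffunP => x; rewrite !ffunE mcoeffD mcoeffZ. Qed.

HB.instance Definition _ :=
  GRing.isLinear.Build F kchains kcoords *:%R to_coords to_coords_is_linear.

Lemma of_coordsK : cancel of_coords to_coords.
Proof.
move=> w; apply/ffunP => -[T m]; rewrite !ffunE /= linear_sum (bigD1 m) //=.
rewrite mcoeffZ mcoeffX eqxx mulr1 big1 ?addr0 // => k km.
by rewrite mcoeffZ mcoeffX (_ : _ == _ = false) ?mulr0 //; apply: negbTE.
Qed.

Lemma of_coords_inj : injective of_coords.
Proof. exact: can_inj of_coordsK. Qed.

Lemma to_coordsK c : (forall T, (msize (c T) <= N)%N) -> of_coords (to_coords c) = c.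
Proof.
move=> cN; apply/ffunP => T; rewrite ffunE [RHS](mpolywE (cN T)).
by apply: eq_bigr => m _; rewrite ffunE.
Qed.

End Coordinates.

Definition kdegree d := (d.1 + d.2).+1.

Lemma mdeg_mbideg (m : 'X_{1..4}) : mdeg m = ((mbideg m).1 + (mbideg m).2)%N.
Proof.
rewrite mdegE !big_ord_recl big_ord0 /mbideg /= addn0 !addnA.
by congr (_ + _ + _ + _)%N; congr (fun_of_multinom m _); apply: val_inj.
Qed.

Lemma kchain_within M i d : within (@of_coords (kdegree d)) (kchain M i d).
Proof.
move=> c /kchainP[_ cd]; exists (to_coords (kdegree d) c).
apply/esym/to_coordsK => T.
rewrite -cd ffunE msizeE; apply/bigmax_leqP_seq => m + _.
rewrite mcoeff_msupp mcoeff_prs mdeg_mbideg /kdegree ltnS.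
case: ifP => [/eqP <- _|]; last by rewrite eqxx.
by rewrite /padd /=; lia.
Qed.

Section Subspaces.
Variables (M : S -> Prop) (i : nat) (d : nat * nat).
Hypothesis idM : ideal_set M.

Lemma kprojP a c c' : kproj d (a *: c + c') = a *: kproj d c + kproj d c'.
Proof. by apply/ffunP => T; rewrite !ffunE prsD prsZ. Qed.

Lemma kchain_subspace : subspace (kchain M i d).
Proof.
split=> [|a c c' /kchainP[cM cd] /kchainP[cM' cd']].
  apply/kchainP; split; last by apply/ffunP => T; rewrite !ffunE prs0.
  by move=> T; rewrite ffunE; case: eqP => // _; case: idM.
by apply/kchainP; split; [exact: uchain_linear | rewrite kprojP cd cd'].
Qed.

Lemma kcycle_subspace : subspace (kcycle M i d).
Proof.
have [M0 ML] := kchain_subspace.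
split=> [|a c c' [cM dc] [cM' dc']]; first by split; rewrite ?linear0.
by split; [exact: ML | rewrite koszul_is_linear dc dc' scaler0 addr0].
Qed.

End Subspaces.

Lemma kboundary_subspace M i d : ideal_set M -> subspace (kboundary M i d).
Proof.
move=> idM; have [M0 ML] := kchain_subspace i.+1 d idM.
split=> [|a _ _ [b [bM ->]] [b' [bM' ->]]]; first by exists 0; rewrite linear0.
by exists (a *: b + b'); rewrite koszul_is_linear; split=> //; apply: ML.
Qed.

Lemma kboundary_kcycle M i d : ideal_set M ->
  forall c, kboundary M i d c -> kcycle M i d c.
Proof.
move=> idM _ [b [/kchainP[bM bd] ->]]; split; last exact: koszul_koszul (@natr_char0 F) b.
by apply/kchainP; rewrite -koszul_kproj bd; split=> //; apply: koszul_uchain.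
Qed.

Lemma kcycle_within M i d : within (@of_coords (kdegree d)) (kcycle M i d).
Proof. by move=> c [/kchain_within]. Qed.

Lemma kboundary_within M i d : ideal_set M ->
  within (@of_coords (kdegree d)) (kboundary M i d).
Proof. by move=> idM c /(kboundary_kcycle idM)/kcycle_within. Qed.

Lemma kboundary_le M i d : ideal_set M ->
  (pdim (kboundary M i d) <= pdim (kcycle M i d))%N.
Proof.
move=> idM; apply: (dim_le (@of_coords_inj (kdegree d))).
- exact: kboundary_subspace.
- exact: kcycle_subspace.
- exact: kcycle_within.
- exact: kboundary_kcycle.
Qed.

Lemma kchain_rank M i d : ideal_set M ->
  pdim (kchain M i.+1 d) = (pdim (kcycle M i.+1 d) + pdim (kboundary M i d))%N.
Proof.
move=> idM; have bE c : kboundary M i d c <-> exists2 b, kchain M i.+1 d b & c = koszul b.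
  by split=> [[b [? ?]]|[b ? ?]]; exists b.
rewrite (eq_dim bE).
apply: (@dim_rank F kchains _ _ (@of_coords_inj (kdegree d)) (@koszul F)
  (to_coords (kdegree d)) (kchain M i.+1 d) (@of_coordsK (kdegree d))).
- exact: kchain_subspace.
- exact: kchain_within.
- by move=> v /bE; apply: kboundary_within.
Qed.

Lemma kcycle0 M d c : kcycle M 0 d c <-> kchain M 0 d c.
Proof.
split=> [[]//|h]; split=> //; apply/ffunP => T; rewrite koszulE ffunE big1 // => k kT.
have := h (k |: T); rewrite cardsU1 kT.
by case: eqP => // _ ->; rewrite !mulr0.
Qed.

Lemma gbetti0_exact M i d : ideal_set M ->
  (forall c, kcycle M i d c -> kboundary M i d c) -> gbetti M i d = 0%N.
Proof.
move=> idM ex; rewrite /gbetti (eq_dim (Q := kboundary M i d)) ?subnn // => c.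
by split; [exact: ex|exact: kboundary_kcycle].
Qed.

Lemma gbetti_eq0 M i d : ideal_set M -> gbetti M i d = 0%N ->
  forall c, kcycle M i d c -> kboundary M i d c.
Proof.
move=> idM /eqP b0; apply: (dim_eq_sub (@of_coords_inj (kdegree d))).
- exact: kboundary_subspace.
- exact: kcycle_subspace.
- exact: kcycle_within.
- exact: kboundary_kcycle.
- by rewrite -subn_eq0.
Qed.

Lemma one_chain M (q : 'I_4 -> S) : ideal_set M -> (forall k, M (q k)) ->
  exists b, [/\ uchain M 1 b, forall k, b [set k] = q k,
    koszul b set0 = \sum_k 'X_k * q k & forall T, T != set0 -> koszul b T = 0].
Proof.
move=> idM qM.
pose b : kchains := [ffun T => if [pick k | T == [set k]] is Some k then q k else 0].
have b1 k : b [set k] = q k.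
  rewrite ffunE; case: pickP => [l /eqP/set1_inj-> //|/(_ k)].
  by rewrite eqxx.
have bM : uchain M 1 b.
  move=> T; case: eqP => [/eqP/cards1P[k ->]|T1]; first by rewrite b1.
  by rewrite ffunE; case: pickP => // k /eqP TE; case: T1; rewrite TE cards1.
exists b; split=> // [|T T0]; last first.
  by have := koszul_uchain idM bM T; rewrite cards_eq0 (negbTE T0).
rewrite koszulE; apply: eq_big => [k|k _]; first by rewrite inE.
rewrite setU0 b1 /ksign (_ : [set _ in _ | _] = set0) ?cards0 ?expr0 ?mul1r //.
by apply/setP => j; rewrite !inE.
Qed.

Section Splitting.
Variables I J K : S -> Prop.
Hypotheses (idI : ideal_set I) (idJ : ideal_set J) (idK : ideal_set K).
Hypotheses (hJ : homogeneous J) (hK : homogeneous K).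
Hypothesis IJK : forall p, I p <-> exists a b, [/\ J a, K b & p = a + b].

Local Notation L := (cap_ideal J K).

Let idL : ideal_set L. Proof. exact: is_cap_ideal. Qed.

Let JI p : J p -> I p.
Proof. by move=> Jp; apply/IJK; exists p, 0; rewrite addr0; split=> //; case: idK. Qed.

Let KI p : K p -> I p.
Proof. by move=> Jp; apply/IJK; exists 0, p; rewrite add0r; split=> //; case: idJ. Qed.

Lemma kchain_split i d c :
  kchain I i d c <-> exists a b, [/\ kchain J i d a, kchain K i d b & c = a + b].
Proof.
split=> [/kchainP[cI cd]|[a [b [/kchainP[aJ ad] /kchainP[bK bd] ->]]]].
  have [a [b [aJ bK cE]]] := uchain_split idJ (fun p => iffLR (IJK p)) cI.
  exists (kproj d a), (kproj d b); split.
  - by apply/kchainP; split; [exact: uchain_kproj|exact: kproj_idem].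
  - by apply/kchainP; split; [exact: uchain_kproj|exact: kproj_idem].
  - by rewrite -[LHS]cd cE -[a]scale1r kprojP !scale1r.
apply/kchainP; rewrite -[a]scale1r kprojP ad bd; split=> //.
by apply: uchain_linear => //; [exact: uchain_sub aJ|exact: uchain_sub bK].
Qed.

Lemma kchain_cap i d c : kchain L i d c <-> kchain J i d c /\ kchain K i d c.
Proof.
split=> [/kchainP[cL cd]|[/kchainP[cJ cd] /kchainP[cK _]]].
  by split; apply/kchainP; split=> //; apply: uchain_sub cL => p [].
apply/kchainP; split=> // T; have := cJ T; have := cK T.
by case: eqP.
Qed.

Lemma pdim_kchain i d : (pdim (kchain J i d) + pdim (kchain K i d) =
  pdim (kchain I i d) + pdim (kchain L i d))%N.
Proof.
rewrite (dim_add_cap (@of_coords_inj (kdegree d))).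
- congr addn; first by apply: eq_dim => c; split=> /kchain_split.
  by apply: eq_dim => c; split=> /kchain_cap.
- exact: kchain_subspace.
- exact: kchain_subspace.
- exact: kchain_within.
- exact: kchain_within.
Qed.

Lemma kboundary_split i d c : kboundary I i d c <->
  exists a b, [/\ kboundary J i d a, kboundary K i d b & c = a + b].
Proof.
split=> [[b [/kchain_split[x [y [xJ yK ->]]] ->]]|[_ [_ [[x [xJ ->]] [y [yK ->]] ->]]]].
  exists (koszul x), (koszul y); rewrite koszulD.
  by split=> //; [exists x|exists y].
by exists (x + y); rewrite koszulD; split=> //; apply/kchain_split; exists x, y.
Qed.

Lemma pdim_kboundary i d (P : kchains -> Prop) :
  (forall c, kboundary J i d c /\ kboundary K i d c <-> P c) ->
  (pdim (kboundary J i d) + pdim (kboundary K i d) =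
   pdim (kboundary I i d) + pdim P)%N.
Proof.
move=> PE; rewrite (dim_add_cap (@of_coords_inj (kdegree d))).
- congr addn; last exact: eq_dim.
  by apply: eq_dim => c; split=> /kboundary_split.
- exact: kboundary_subspace.
- exact: kboundary_subspace.
- exact: kboundary_within.
- exact: kboundary_within.
Qed.

Definition in_irrelevant_mul M p : Prop :=
  exists q : 'I_4 -> S, (forall k, M (q k)) /\ p = \sum_k 'X_k * q k.

Lemma kboundary0 M d c : homogeneous M -> kchain L 0 d c ->
  ideal_set M -> in_irrelevant_mul M (c set0) -> kboundary M 0 d c.
Proof.
move=> hM /kchainP[cL cd] idM [q [qM cE]].
have [b [bM _ b0 bT]] := one_chain idM qM.
exists (kproj d b); split.
  by apply/kchainP; split; [exact: uchain_kproj|exact: kproj_idem].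
rewrite koszul_kproj -{1}cd; congr kproj; apply/ffunP => T.
have [->|T0] := eqVneq T set0; first by rewrite b0.
by rewrite bT //; have := cL T; rewrite cards_eq0 (negbTE T0).
Qed.

Lemma gbetti_splitting : (forall i, (0 < i)%N -> exact_at L i) ->
  (forall p, L p -> in_irrelevant_mul J p) ->
  (forall p, L p -> in_irrelevant_mul K p) ->
  forall i d, gbetti I i d = (gbetti J i d + gbetti K i d +
                   (if i is i'.+1 then gbetti L i' d else 0))%N.
Proof.
move=> exL LJ LK i d; have hL := cap_homogeneous hJ hK.
have b0 : (pdim (kboundary J 0 d) + pdim (kboundary K 0 d) =
    pdim (kboundary I 0 d) + pdim (kchain L 0 d))%N.
  apply: pdim_kboundary => c; split=> [[]|cL].
    move=> /(kboundary_kcycle idJ)[cJ _] /(kboundary_kcycle idK)[cK _].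
    by apply/kchain_cap.
  have Lc : L (c set0) by have := cL set0; rewrite cards0 eqxx => -[].
  by split; apply: kboundary0 => //; auto.
have bS j : (pdim (kboundary J j.+1 d) + pdim (kboundary K j.+1 d) =
    pdim (kboundary I j.+1 d) + pdim (kboundary L j.+1 d))%N.
  apply: pdim_kboundary => c; split=> [[]|[b [/kchain_cap[bJ bK] ->]]].
    move=> /(kboundary_kcycle idJ)[cJ dc] /(kboundary_kcycle idK)[cK _].
    by apply: exact_at_cycle (exL _ _) _ _ => //; split=> //; apply/kchain_cap.
  by split; exists b.
have zL j : pdim (kcycle L j.+1 d) = pdim (kboundary L j.+1 d).
  apply: eq_dim => c; split; last exact: kboundary_kcycle.
  exact: (exact_at_cycle hL (exL _ (ltn0Sn j))).
have z0 M : pdim (kcycle M 0 d) = pdim (kchain M 0 d) by apply: eq_dim => c; apply: kcycle0.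
have le M j idM := @kboundary_le M j d idM.
have rk M j idM := @kchain_rank M j d idM.
rewrite /gbetti; case: i => [|[|i]].
- have := pdim_kchain 0 d; have := le I 0%N idI; have := le J 0%N idJ.
  have := le K 0%N idK; rewrite !z0; lia.
- have := pdim_kchain 1 d; have := le I 1%N idI; have := le J 1%N idJ.
  have := le K 1%N idK; have := le L 0%N idL; have := bS 0%N; have := zL 0%N.
  by have := rk I 0%N idI; have := rk J 0%N idJ; have := rk K 0%N idK;
    have := rk L 0%N idL; rewrite !z0; lia.
- have := pdim_kchain i.+2 d; have := le I i.+2 idI; have := le J i.+2 idJ.
  have := le K i.+2 idK; have := bS i; have := bS i.+1; have := zL i; have := zL i.+1.
  by have := rk I i.+1 idI; have := rk J i.+1 idJ; have := rk K i.+1 idK;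
    have := rk L i.+1 idL; lia.
Qed.

End Splitting.
End FiniteDimension.

(** * Products of linear forms *)

Section SeqSwitch.
Variables (T : eqType) (P : pred T).

Lemma seq_switch (l : seq T) : has P l -> has (predC P) l ->
  (exists b l1 x y l2, [/\ l = l1 ++ x :: y :: l2,
     all (fun z => P z == b) (rcons l1 x) & all (fun z => P z == ~~ b) (y :: l2)]) \/
  (exists b l1 x m mid y l2, [/\ l = l1 ++ x :: (m :: mid) ++ y :: l2,
     P x = b, P y = b & all (fun z => P z == ~~ b) (m :: mid)]).
Proof.
elim: l => // x l IH /= hP hN.
have [allx|] := boolP (all (fun z => P z == P x) l).
  case Px: (P x) hP hN allx => /= hP hN /allP allx.
    by case/hasP: hN => z zl /=; rewrite (eqP (allx z zl)).
  by case/hasP: hP => z zl /=; rewrite (eqP (allx z zl)).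
move=> nall; have {}IH : (has P l -> has (predC P) l -> _) := IH.
have [allNx|nallN] := boolP (all (fun z => P z == ~~ P x) l).
  case: l allNx nall {IH hP hN} => // y l2 aN _.
  by left; exists (P x), [::], x, y, l2; rewrite /= eqxx.
have [hl1 hl2] : has P l /\ has (predC P) l.
  move: nall nallN; rewrite -!has_predC => /hasP[z1 z1l /= h1] /hasP[z2 z2l /= h2].
  by split; apply/hasP; move: h1 h2; case: (P x) => /=; rewrite ?eqbF_neg ?eqb_id ?negbK => h1 h2;
    [exists z2|exists z1|exists z1|exists z2].
have [[b [l1 [z [y [l2 [-> a1 a2]]]]]]|[b [l1 [z [m [mid [y [l2 [-> zb yb am]]]]]]]]] :=
    IH hl1 hl2; last first.
  by right; exists b, (x :: l1), z, m, mid, y, l2.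
have [xb|xb] := eqVneq (P x) b.
  by left; exists b, (x :: l1), z, y, l2; rewrite /= xb eqxx.
right; exists (~~ b); case: l1 a1 {IH} => [|m l1] a1.
  exists [::], x, z, [::], y, l2; split=> //.
  - by move: xb; case: (P x); case: (b).
  - by case/andP: a2 => /eqP.
  - by rewrite negbK; move: a1.
exists [::], x, m, (rcons l1 z), y, l2; split=> //.
- by rewrite /= -cats1 -catA.
- by move: xb; case: (P x); case: (b).
- by case/andP: a2 => /eqP.
- by rewrite negbK.
Qed.

End SeqSwitch.

Section Chain.
Variable F : numFieldType.
Local Notation S := {mpoly F[4]}.
Local Notation bihom := (@bihom F).
Implicit Types (p q : S) (A B : F * F) (s : seq (F * F)).

Definition xprod s : S := \prod_(A <- s) xform A.
Definition yprod s : S := \prod_(B <- s) yform B.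

Lemma bihomM a b p q : bihom a p -> bihom b q -> bihom (padd a b) (p * q).
Proof.
move=> pa qb m /msuppM_le /allpairsP[[m1 m2] /= [/pa e1 /qb e2 ->]].
by rewrite mbidegD e1 e2.
Qed.

Lemma bihom_sum a p q : bihom a p -> bihom a q -> bihom a (p + q).
Proof. by move=> pa qa m /msuppD_le; rewrite mem_cat => /orP[/pa|/qa]. Qed.

Lemma bihomZ a k p : bihom a p -> bihom a (k *: p).
Proof. by move=> pa m /msuppZ_le /pa. Qed.

Lemma bihomX k : bihom (mbideg U_(k)) 'X_k.
Proof. by move=> m; rewrite msuppX inE => /eqP->. Qed.

Lemma bihom_xform A : bihom (1, 0)%N (xform A).
Proof.
have h k : mbideg U_(k) = (1, 0)%N -> forall a : F, bihom (1, 0)%N (a *: 'X_k).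
  by move=> <- a; apply: bihomZ; apply: bihomX.
rewrite /xform -scaleNr; apply: bihom_sum; apply: h; rewrite /mbideg !mnm1E //.
Qed.

Lemma bihom_yform A : bihom (0, 1)%N (yform A).
Proof.
have h k : mbideg U_(k) = (0, 1)%N -> forall a : F, bihom (0, 1)%N (a *: 'X_k).
  by move=> <- a; apply: bihomZ; apply: bihomX.
rewrite /yform -scaleNr; apply: bihom_sum; apply: h; rewrite /mbideg !mnm1E //.
Qed.

Lemma bihom1 : bihom (0, 0)%N 1.
Proof. by move=> m; rewrite msupp1 inE => /eqP->; rewrite /mbideg !mnm0E. Qed.

Lemma bihom_xprod s : bihom (size s, 0)%N (xprod s).
Proof.
elim: s => [|A s IH]; rewrite /xprod ?big_nil; first exact: bihom1.
by rewrite big_cons; apply: (@bihomM (1, 0)%N (size s, 0)%N) => //; apply: bihom_xform.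
Qed.

Lemma bihom_yprod s : bihom (0, size s)%N (yprod s).
Proof.
elim: s => [|A s IH]; rewrite /yprod ?big_nil; first exact: bihom1.
by rewrite big_cons; apply: (@bihomM (0, 1)%N (0, size s)%N) => //; apply: bihom_yform.
Qed.

Lemma xprod_cat s1 s2 : xprod (s1 ++ s2) = xprod s1 * xprod s2.
Proof. by rewrite /xprod big_cat. Qed.

Lemma yprod_cat s1 s2 : yprod (s1 ++ s2) = yprod s1 * yprod s2.
Proof. by rewrite /yprod big_cat. Qed.

Lemma xprod_neq0 s : all (@prep F) s -> xprod s != 0.
Proof.
rewrite /xprod; elim: s => [|A s IH] /=; first by rewrite big_nil oner_eq0.
by move=> /andP[/xform_neq0 A0 /IH s0]; rewrite big_cons mulf_neq0.
Qed.

Lemma yprod_neq0 s : all (@prep F) s -> yprod s != 0.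
Proof.
rewrite /yprod; elim: s => [|A s IH] /=; first by rewrite big_nil oner_eq0.
by move=> /andP[/yform_neq0 A0 /IH s0]; rewrite big_cons mulf_neq0.
Qed.

Lemma xprod_map s : xprod s = \prod_(f <- map (@xform F) s) f.
Proof. by rewrite big_map. Qed.
Lemma yprod_map s : yprod s = \prod_(f <- map (@yform F) s) f.
Proof. by rewrite big_map. Qed.

Lemma prime_ndvd_prod (D : idomainType) (f : D) (s : seq D) : prime_elt f ->
  ~ divides f 1 -> (forall g, g \in s -> ~ divides f g) -> ~ divides f (\prod_(g <- s) g).
Proof.
move=> [_ fP] f1; elim: s => [|g s IH] ns; first by rewrite big_nil.
rewrite big_cons => /fP[]; first by apply: ns; rewrite mem_head.
by apply: IH => h hs; apply: ns; rewrite inE hs orbT.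
Qed.

Lemma xform_ndvd1 A : prep A -> ~ divides (xform A) 1.
Proof. by move=> rA /(redH_kerP _ rA)/eqP; rewrite comp_mpoly1 oner_eq0. Qed.

Lemma xform_ndvd_yprod A s : prep A -> all (@prep F) s -> ~ divides (xform A) (yprod s).
Proof.
move=> rA /allP rs; rewrite yprod_map; apply: prime_ndvd_prod.
- exact: xform_prime.
- exact: xform_ndvd1.
- by move=> _ /mapP[B /rs rB ->]; apply: xform_ndvdV.
Qed.

Lemma xprod_coprime_yprod s1 s2 a : all (@prep F) s1 -> all (@prep F) s2 ->
  divides (xprod s1) (yprod s2 * a) -> divides (xprod s1) a.
Proof.
move=> /allP r1 r2; rewrite xprod_map; apply: prod_coprime_divides.
  by move=> _ /mapP[A /r1 rA ->]; apply: xform_prime.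
by move=> _ /mapP[A /r1 rA ->]; apply: xform_ndvd_yprod.
Qed.

Lemma coef0_irrelevant p : p@_0%MM = 0 -> exists q : 'I_4 -> S, p = \sum_k 'X_k * q k.
Proof.
suff [q pE] : exists q : 'I_4 -> S, p = (p@_0%MM)%:MP + \sum_k 'X_k * q k.
  by move=> p0; exists q; rewrite {1}pE p0 mpolyC0 add0r.
elim/mpolyind: p => [|k m p mp _ [q pE]].
  exists (fun=> 0); rewrite mcoeff0 mpolyC0 add0r big1 // => k _.
  by rewrite mulr0.
have [m0|m0] := eqVneq m 0%MM.
  exists q; rewrite {1}pE m0 mcoeffD mcoeffZ mcoeffX eqxx mulr1 mpolyCD -addrA.
  by rewrite mpolyX0 -[k%:MP]alg_mpolyC.
have [i mi] : exists i, m i != 0%N.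
  apply/existsP; apply: contraNT m0 => /existsPn h; apply/eqP/mnmP => i.
  by rewrite mnm0E; apply/eqP; have := h i; rewrite negbK.
exists (fun j => q j + if j == i then k *: 'X_[m - U_(i)] else 0).
rewrite {1}pE mcoeffD mcoeffZ mcoeffX (negbTE m0) mulr0 add0r.
under [in RHS]eq_bigr => j _ do rewrite mulrDr.
rewrite big_split /= addrCA; congr (_ + _); rewrite addrC; congr (_ + _).
rewrite (bigD1 i) //= eqxx big1 => [|j ji]; last by rewrite (negbTE ji) mulr0.
by rewrite addr0 -scalerAr -mpolyXD addmC submK // lep1mP.
Qed.

End Chain.

(** * Splittings of staircases *)

Lemma pairwise_mid (T : eqType) (r : rel T) (l l1 l2 : seq T) z :
  pairwise r l -> l = l1 ++ z :: l2 ->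
  (forall t, t \in l1 -> r t z) /\ (forall t, t \in l2 -> r z t).
Proof.
move=> + lE; rewrite lE pairwise_cat => /and3P[/allrelP h _ /andP[/allP h2 _]].
by split=> t ts; [apply: h => //; rewrite mem_head|exact: h2].
Qed.

Lemma sum4 (V : nmodType) (E : 'I_4 -> V) :
  \sum_k E k = E v0 + (E v1 + (E v2 + E v3)).
Proof.
rewrite !big_ord_recl big_ord0 addr0.
by congr (E _ + (E _ + (E _ + E _))); apply: val_inj.
Qed.

Section ChainSplitting.
Variable F : numFieldType.
Local Notation S := {mpoly F[4]}.
Local Notation bihom := (@bihom F).
Variables hs vs As Bs : seq (F * F).
Hypotheses (rhs : all (@prep F) hs) (rvs : all (@prep F) vs).
Hypotheses (rAs : all (@prep F) As) (rBs : all (@prep F) Bs).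
Implicit Types (p q : S) (x y z : nat * nat) (l : seq (nat * nat)).

(* The pair (i, j) encodes the generator
   Lambda * H_(A_1) ... H_(A_i) * V_(B_1) ... V_(B_j). *)
Definition stepU (i : nat) : S := xprod (hs ++ take i As).
Definition stepW (j : nat) : S := yprod (vs ++ take j Bs).
Definition step x : S := stepU x.1 * stepW x.2.

Definition inbox x := (x.1 <= size As)%N && (x.2 <= size Bs)%N.
Definition stairs x y := (x.1 < y.1)%N && (y.2 < x.2)%N.
Definition stepdeg x : nat * nat := (size hs + x.1, size vs + x.2)%N.

Lemma all_prep_take (s1 s2 : seq (F * F)) n :
  all (@prep F) s1 -> all (@prep F) s2 -> all (@prep F) (s1 ++ take n s2).
Proof.
by move=> a1 /allP a2; rewrite all_cat a1; apply/allP => A /mem_take /a2.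
Qed.

Lemma stepU_neq0 i : stepU i != 0.
Proof. exact/xprod_neq0/all_prep_take. Qed.

Lemma stepW_neq0 j : stepW j != 0.
Proof. exact/yprod_neq0/all_prep_take. Qed.

Lemma bihom_UW i j : inbox (i, j) -> bihom (stepdeg (i, j)) (stepU i * stepW j).
Proof.
move=> /andP[/= i1 j1].
rewrite (_ : stepdeg _ = padd (size hs + i, 0)%N (0, size vs + j)%N); last first.
  by rewrite /stepdeg /padd /= addn0.
apply: bihomM.
  by rewrite /stepU -{1}(size_takel i1) -size_cat; apply: bihom_xprod.
by rewrite /stepW -{1}(size_takel j1) -size_cat; apply: bihom_yprod.
Qed.

Lemma stepU_le i i' : (i <= i')%N ->
  stepU i' = xprod (drop i (take i' As)) * stepU i.
Proof.
move=> ii; rewrite /stepU !xprod_cat -{1}(cat_take_drop i (take i' As)) xprod_cat.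
by rewrite take_takel // mulrA mulrC.
Qed.

Lemma stepW_le j j' : (j <= j')%N ->
  stepW j' = yprod (drop j (take j' Bs)) * stepW j.
Proof.
move=> ii; rewrite /stepW !yprod_cat -{1}(cat_take_drop j (take j' Bs)) yprod_cat.
by rewrite take_takel // mulrA mulrC.
Qed.

Lemma chain_cap l1 l2 y z : y \in l1 -> z \in l2 -> (y.1 <= z.1)%N -> (z.2 <= y.2)%N ->
    (forall x, x \in l1 -> (y.2 <= x.2)%N) -> (forall x, x \in l2 -> (z.1 <= x.1)%N) ->
  forall p, cap_ideal (gen_ideal (map step l1)) (gen_ideal (map step l2)) p <->
    divides (stepU z.1 * stepW y.2) p.
Proof.
move=> yl zl yz1 yz2 hl1 hl2 p; split=> [[p1 p2]|[q ->]].
  have [a pW] : divides (stepW y.2) p.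
    apply/gen_ideal1P; move: p p1 {p2}; apply: gen_ideal_min.
      exact: gen_ideal_ideal_set.
    move=> _ /mapP[x xl ->]; apply/gen_ideal1P; rewrite /step (stepW_le (hl1 x xl)) mulrA.
    by eexists.
  have : divides (stepU z.1) p.
    apply/gen_ideal1P; move: p p2 {p1 pW}; apply: gen_ideal_min.
      exact: gen_ideal_ideal_set.
    move=> _ /mapP[x xl ->]; apply/gen_ideal1P; rewrite /step (stepU_le (hl2 x xl)).
    by rewrite mulrAC; eexists.
  rewrite pW mulrC => /xprod_coprime_yprod[||c ->]; try exact: all_prep_take.
  by exists c; rewrite mulrCA; congr (_ * _); apply: mulrC.
split; apply: gen_idealM.
  rewrite (stepU_le yz1) -mulrA; apply: gen_idealM; apply: mem_gen_ideal.
  exact: map_f.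
rewrite (stepW_le yz2) mulrCA; apply: gen_idealM; apply: mem_gen_ideal.
exact: map_f.
Qed.

Lemma chain_exact l : (0 < size l)%N ->
  pairwise (fun x y => (x.1 <= y.1)%N && (y.2 <= x.2)%N) l ->
  exact_at (gen_ideal (map step l)) 2.
Proof.
elim/last_ind: l => // l z IH _; case: (lastP l) IH => [_ _|{}l y IH].
  apply: (@exact_principal F (step z)) => //; last by move=> p; apply: gen_ideal1P.
  by rewrite mulf_neq0 ?stepU_neq0 ?stepW_neq0.
rewrite pairwise_rcons => /andP[/allP hz pl].
have [id1 id2 idI] : [/\ ideal_set (gen_ideal (map step (rcons l y))),
    ideal_set (gen_ideal (map step [:: z])) &
    ideal_set (gen_ideal (map step (rcons (rcons l y) z)))].
  by split; apply: gen_ideal_ideal_set.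
have mcat : map step (rcons (rcons l y) z) = map step (rcons l y) ++ map step [:: z].
  by rewrite -cats1 map_cat.
apply: (exact_add idI id1 id2).
- by apply: gen_ideal_sub => g; rewrite mcat mem_cat => ->.
- by apply: gen_ideal_sub => g; rewrite mcat mem_cat orbC => ->.
- by move=> p; rewrite mcat => /gen_ideal_cat[a [b [? ? ->]]]; exists a, b.
- by apply: IH => //; rewrite size_rcons.
- apply: (@exact_principal F (step z)) => //; last by move=> p; apply: gen_ideal1P.
  by rewrite mulf_neq0 ?stepU_neq0 ?stepW_neq0.
- have yl : y \in rcons l y by rewrite mem_rcons mem_head.
  apply: (@exact_principal F (stepU z.1 * stepW y.2)) => //.
    by rewrite mulf_neq0 ?stepU_neq0 ?stepW_neq0.
  have /andP[yz1 yz2] := hz y yl.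
  apply: chain_cap => //; first by rewrite mem_head.
  + move=> x; rewrite mem_rcons inE => /orP[/eqP->//|xl].
    by move: pl; rewrite pairwise_rcons => /andP[/allP/(_ x xl)/andP[]].
  + by move=> x; rewrite inE => /eqP->.
Qed.

Variables (l : seq (nat * nat)) (P : pred (nat * nat)).
Hypotheses (lb : all inbox l) (lchain : pairwise stairs l).
Hypotheses (hasP' : has P l) (hasN : has (predC P) l).

Let part (b : bool) : S -> Prop := gen_ideal [seq step x | x <- l & P x == b].
Let J := part true.
Let K := part false.
Let I := gen_ideal (map step l).

Let l_uniq : uniq l.
Proof. by apply: pairwise_uniq lchain => x; rewrite /stairs ltnn. Qed.

Let part_id b : ideal_set (part b).
Proof. exact: gen_ideal_ideal_set. Qed.

Let step_bihom x : x \in l -> bihom (stepdeg x) (step x).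
Proof. by move=> xl; apply: bihom_UW; rewrite -surjective_pairing; apply: (allP lb). Qed.

Let part_homogeneous b : homogeneous (part b).
Proof.
apply: gen_ideal_homogeneous => g /mapP[x]; rewrite mem_filter => /andP[_ xl] ->.
by exists (stepdeg x); apply: step_bihom.
Qed.

Let incomparable x y : x \in l -> y \in l -> x != y ->
  (x.1 < y.1)%N && (y.2 < x.2)%N || (y.1 < x.1)%N && (x.2 < y.2)%N.
Proof.
move=> xl yl xy; have pw := lchain.
have := pairwiseP (0, 0)%N pw => {}pw.
have ix : (index x l < size l)%N by rewrite index_mem.
have iy : (index y l < size l)%N by rewrite index_mem.
case: (ltngtP (index x l) (index y l)) => [lt|lt|e].
- by have := pw _ _ ix iy lt; rewrite !nth_index // /stairs => ->.
- by have := pw _ _ iy ix lt; rewrite !nth_index // /stairs => ->; rewrite orbT.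
- by move: xy; rewrite -(nth_index x xl) e nth_index // eqxx.
Qed.

Let syzygy_coef (e : nat * nat -> S) : \sum_(x <- l) e x * step x = 0 ->
  forall x, x \in l -> (e x)@_0%MM = 0.
Proof.
move=> e0 x xl; have := congr1 (prs (0, 0)%N (stepdeg x)) e0.
rewrite prs0 prs_sum (bigD1_seq x) //= (prs_mul_bihom _ _ _ (step_bihom xl)).
rewrite big_seq_cond big1 ?addr0 => [|y /andP[yl yx]]; last first.
  rewrite (prs_mul_bihom _ _ _ (step_bihom yl)).
  suff -> : prs (padd (0, 0)%N (stepdeg y)) (stepdeg x) (e y) = 0 by rewrite mul0r.
  apply/mpolyP => m; rewrite mcoeff_prs mcoeff0; case: eqP => // -[E1 E2]; exfalso.
  move: E1 E2 (incomparable xl yl); rewrite eq_sym => E1 E2 /(_ yx).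
  by move: E1 E2; clear; lia.
move/eqP; rewrite mulf_eq0 mulf_eq0 (negbTE (stepU_neq0 _)) (negbTE (stepW_neq0 _)) !orbF.
move=> /eqP/(congr1 (mcoeff 0%MM)); rewrite mcoeff_prs mcoeff0.
by rewrite (_ : _ == _ = true) //; apply/eqP; rewrite /padd /mbideg !mnm0E.
Qed.

Let part_sub b p : part b p -> I p.
Proof.
by apply: gen_ideal_sub => g /mapP[x]; rewrite mem_filter => /andP[_ xl] ->; apply: map_f.
Qed.

Let sum_parts p : I p <-> exists a b, [/\ J a, K b & p = a + b].
Proof.
have [I0 [ID IM]] : ideal_set I by apply: gen_ideal_ideal_set.
split=> [Ip|[a [b [/part_sub Ia /part_sub Ib ->]]]]; last exact: ID.
apply/gen_ideal_cat; move: Ip; apply: gen_ideal_sub => _ /mapP[x xl ->].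
rewrite mem_cat; apply/orP; case Px: (P x); [left|right]; apply: map_f;
  by rewrite mem_filter Px.
Qed.

Lemma in_irrelevant_mul_ideal M : ideal_set M -> ideal_set (@in_irrelevant_mul F M).
Proof.
move=> [M0 [MD MM]]; split; [|split].
- by exists (fun=> 0); split=> //; rewrite big1 // => k _; rewrite mulr0.
- move=> _ _ [q [qM ->]] [q' [qM' ->]]; exists (fun k => q k + q' k).
  split=> [k|]; first exact: MD.
  by rewrite -big_split; apply: eq_bigr => k _; rewrite mulrDr.
- move=> r _ [q [qM ->]]; exists (fun k => r * q k); split=> [k|]; first exact: MM.
  by rewrite mulr_sumr; apply: eq_bigr => k _; rewrite mulrCA.
Qed.

Let cap_irrelevant b p : part b p -> part (~~ b) p -> in_irrelevant_mul (part b) p.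
Proof.
move=> pb pnb; have [c pE] := gen_ideal_coef (filter_uniq _ l_uniq) pb.
have [d pE'] := gen_ideal_coef (filter_uniq _ l_uniq) pnb.
have e0 : \sum_(x <- l) (if P x == b then c x else - d x) * step x = 0.
  rewrite (bigID (fun x => P x == b)) /= -!(big_filter l).
  rewrite [X in X + _](_ : _ = p); last first.
    rewrite pE big_seq [RHS]big_seq; apply: eq_bigr => x.
    by rewrite mem_filter => /andP[-> _].
  rewrite (_ : [seq x <- l | P x != b] = [seq x <- l | P x == ~~ b]); last first.
    by apply: eq_filter => x; case: (P x) (b) => -[].
  rewrite [X in _ + X](_ : _ = - p) ?subrr // pE' -sumrN big_seq [RHS]big_seq.
  apply: eq_bigr => x; rewrite mem_filter => /andP[/eqP-> _].
  by rewrite (_ : (~~ b == b) = false) ?mulNr //; case: (b).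
have [_ [_ IM]] := in_irrelevant_mul_ideal (part_id b).
rewrite pE big_seq; apply: ideal_set_sum.
  exact: in_irrelevant_mul_ideal.
move=> x; rewrite mem_filter => /andP[Px xl].
have := syzygy_coef e0 xl; rewrite Px => /coef0_irrelevant[q ->].
exists (fun k => q k * step x); split=> [k|].
  by apply: gen_idealM; apply: mem_gen_ideal; apply: map_f; rewrite mem_filter Px.
by rewrite mulr_suml; apply: eq_bigr => k _; rewrite mulrA.
Qed.

Definition gsplitting (I J K : S -> Prop) : Prop := forall i d,
  gbetti I i d = (gbetti J i d + gbetti K i d +
    (if i is i'.+1 then gbetti (cap_ideal J K) i' d else 0))%N.

Lemma principal_splitting f : f != 0 -> (forall p, cap_ideal J K p <-> divides f p) ->
  gsplitting I J K.
Proof.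
move=> f0 Lf; apply: gbetti_splitting.
- exact: gen_ideal_ideal_set.
- exact: part_id.
- exact: part_id.
- exact: part_homogeneous.
- exact: part_homogeneous.
- exact: sum_parts.
- by move=> i; apply: exact_principal f0 Lf.
- by move=> p [? ?]; apply: cap_irrelevant.
- by move=> p [? ?]; apply: cap_irrelevant.
Qed.

Let two_switch_cycle b l1 x m mid y l2 :
  l = l1 ++ x :: (m :: mid) ++ y :: l2 -> P x = b -> P y = b -> P m = ~~ b ->
  all (fun z => P z == ~~ b) mid ->
  exists2 c, kcycle (cap_ideal J K) 1 (stepdeg (y.1, x.2)) c &
    ~ kboundary (cap_ideal J K) 1 (stepdeg (y.1, x.2)) c.
Proof.
move=> lE xb yb mb midb; set D := stepdeg _; set L := cap_ideal J K.
have [xl ml yl] : [/\ x \in l, m \in l & y \in l].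
  by rewrite lE !(mem_cat, inE) !eqxx !orbT.
have part_mem z : z \in l -> forall b', P z = b' -> part b' (step z).
  by move=> zl b' <-; apply: mem_gen_ideal; apply: map_f; rewrite mem_filter eqxx.
have Lb p : part b p -> part (~~ b) p -> L p.
  by rewrite /L /J /K; case: (b) => /=; split.
have Lpart p : L p -> part b p by rewrite /L /J /K; case: (b) => -[].
have idL : ideal_set L by apply: is_cap_ideal; apply: part_id.
have hL : homogeneous L by apply: cap_homogeneous; apply: part_homogeneous.
have [l1x xr] := pairwise_mid (l1 := l1) (z := x) (l2 := (m :: mid) ++ y :: l2) lchain lE.
have [ml2 yr] : (forall t, t \in l1 ++ x :: m :: mid -> stairs t y) /\
    (forall t, t \in l2 -> stairs y t).
  by apply: pairwise_mid lchain _; rewrite lE -catA.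
have xm : stairs x m by apply: xr; rewrite mem_head.
have my : stairs m y by apply: ml2; rewrite mem_cat !inE eqxx !orbT.
have far z : z \in l -> P z = b -> (x.2 <= z.2)%N || (y.1 <= z.1)%N.
  rewrite lE mem_cat inE mem_cat [_ \in y :: _]inE => /or4P[zl|/eqP->|zm|zl] zb.
  - by have /andP[_ /ltnW->] := l1x z zl.
  - by rewrite leqnn.
  - move: zb; rewrite inE in zm; case/orP: zm => [/eqP->|/(allP midb)/eqP->].
      by rewrite mb; case: (b).
    by case: (b).
  - case/orP: zl => [/eqP->|zl]; first by rewrite leqnn orbT.
    by have /andP[/ltnW-> _] := yr z zl; rewrite orbT.
have box : inbox (y.1, x.2).
  by move: (allP lb _ xl) (allP lb _ yl); rewrite /inbox /= => /andP[_ ->] /andP[->].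
(* No element of the part of colour b has a component that lies below D in both
   coordinates, so a boundary in degree D only involves e_0 e_1 and e_2 e_3. *)
have prsL p : L p -> prs (1, 1)%N D p = 0.
  move=> /Lpart/(gen_ideal_coef (filter_uniq _ l_uniq))[c ->].
  rewrite prs_sum big_seq big1 // => z; rewrite mem_filter => /andP[/eqP zb zl].
  rewrite (prs_mul_bihom _ _ _ (step_bihom zl)).
  suff -> : prs (padd (1, 1)%N (stepdeg z)) D (c z) = 0 by rewrite mul0r.
  apply/mpolyP => k; rewrite mcoeff_prs mcoeff0; case: eqP => // -[E1 E2]; exfalso.
  by move: E1 E2 (far z zl zb); clear; rewrite /=; lia.
pose L1 := stepU m.1 * stepW x.2; pose L2 := stepU y.1 * stepW m.2.
have /andP[xm1 xm2] := xm; have /andP[my1 my2] := my.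
have L1L : L L1.
  apply: Lb; rewrite /L1.
    rewrite (stepU_le (ltnW xm1)) -mulrA; apply: gen_idealM; exact: part_mem.
  rewrite (stepW_le (ltnW xm2)) mulrCA; apply: gen_idealM; exact: part_mem.
have L2L : L L2.
  apply: Lb; rewrite /L2.
    rewrite (stepW_le (ltnW my2)) mulrCA; apply: gen_idealM; exact: part_mem.
  rewrite (stepU_le (ltnW my1)) -mulrA; apply: gen_idealM; exact: part_mem.
have [P0 [P1 PE]] : exists P0 P1, stepU y.1 = ('X_v0 * P0 + 'X_v1 * P1) * stepU m.1.
  rewrite (stepU_le (ltnW my1)).
  have : (0 < size (drop m.1 (take y.1 As)))%N.
    rewrite size_drop size_takel ?subn_gt0 //.
    by have := allP lb _ yl => /andP[].
  case: (drop _ _) => // A s _; rewrite /xprod big_cons /xform.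
  exists (A.2 *: \prod_(A <- s) xform A), (- A.1 *: \prod_(A <- s) xform A).
  by congr (_ * _); rewrite mulrBl -!scalerAr -!scalerAl scaleNr.
have [Q0 [Q1 QE]] : exists Q0 Q1, stepW x.2 = ('X_v2 * Q0 + 'X_v3 * Q1) * stepW m.2.
  rewrite (stepW_le (ltnW xm2)).
  have : (0 < size (drop m.2 (take x.2 Bs)))%N.
    rewrite size_drop size_takel ?subn_gt0 //.
    by have := allP lb _ xl => /andP[].
  case: (drop _ _) => // A s _; rewrite /yprod big_cons /yform.
  exists (A.2 *: \prod_(A <- s) yform A), (- A.1 *: \prod_(A <- s) yform A).
  by congr (_ * _); rewrite mulrBl -!scalerAr -!scalerAl scaleNr.
pose top := stepU y.1 * stepW x.2.
have top0 : top != 0 by rewrite mulf_neq0 ?stepU_neq0 ?stepW_neq0.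
have topP : 'X_v0 * (P0 * L1) + 'X_v1 * (P1 * L1) = top.
  by rewrite /top PE /L1 !mulrDl !mulrA.
have topQ : 'X_v2 * (Q0 * L2) + 'X_v3 * (Q1 * L2) = top.
  by rewrite /top QE /L2 [in RHS]mulrCA !mulrDl !mulrA.
pose q (k : 'I_4) := [:: P0 * L1; P1 * L1; - (Q0 * L2); - (Q1 * L2)]`_k.
have qL k : L (q k).
  have [_ [_ LM]] := idL.
  by move: k; apply: ord4_ind; rewrite /q /= -?mulNr; apply: LM.
have [c [cL cq c0 cT]] := one_chain idL qL.
have dc : koszul c = 0.
  apply/ffunP => T; rewrite [RHS]ffunE; have [->|/cT//] := eqVneq T set0.
  by rewrite c0 sum4 /q /= addrA topP !mulrN -opprD topQ subrr.
exists (kproj D c).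
  split; first by apply/kchainP; split; [exact: uchain_kproj|exact: kproj_idem].
  by rewrite koszul_kproj dc; apply/ffunP => T; rewrite !ffunE prs0.
move=> [u [/kchainP[uL uD] cE]].
have u0 T : sdeg T = (1, 1)%N -> #|T| = 2 -> u T = 0.
  move=> T1 T2; rewrite -uD ffunE T1; apply: prsL.
  by have := uL T; rewrite T2 eqxx.
have sdeg2 k k' : k != k' -> sdeg (k |: [set k']) = padd (mbideg U_(k')) (mbideg U_(k)).
  by move=> kk; rewrite sdegU ?inE // -[[set k']]setU0 sdegU ?inE // /sdeg !set0I !cards0.
have c2 (k k' : 'I_4) : k != k' -> #|k |: [set k']| = 2 by move=> kk; rewrite cards2 kk.
have usum k k' : k != k' ->
    (forall k2, k2 != k' -> k2 != k -> padd (mbideg U_(k')) (mbideg U_(k2)) = (1, 1)%N) ->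
    koszul u [set k'] = ksign F k [set k'] * ('X_k * u (k |: [set k'])).
  move=> kk h; rewrite koszulE (bigD1 k) ?inE //= big1 ?addr0 // => k2.
  rewrite inE => /andP[k2k' k2k]; rewrite u0 ?mulr0 ?c2 // sdeg2 //.
  exact: h.
have top_E : top = 'X_v0 * kproj D c [set v0] + 'X_v1 * kproj D c [set v1].
  have sd k : sdeg [set k] = mbideg U_(k).
    by rewrite -[[set k]]setU0 sdegU ?inE // /sdeg !set0I !cards0.
  rewrite [kproj D c [set v0]]ffunE [kproj D c [set v1]]ffunE !cq !sd /q /=.
  have pz a : padd (0, 0)%N a = a by case: a.
  rewrite -[mbideg U_(v0)]pz -[mbideg U_(v1)]pz.
  rewrite !prs_mulX -prsD topP (bihom_prs _ _ (bihom_UW box)).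
  by rewrite (_ : padd _ _ == _ = true) //; apply/eqP; rewrite /padd /= !addn0.
move: top_E; rewrite cE (@usum v1 v0) //; last first.
  by apply: ord4_ind => //; rewrite /padd /mbideg /= !mnm1E.
rewrite (@usum v0 v1) //; last first.
  by apply: ord4_ind => //; rewrite /padd /mbideg /= !mnm1E.
rewrite [v1 |: _]setUC /ksign.
have -> : [set j in [set v0] | (j < v1)%N] = [set v0].
  by apply/setP; apply: ord4_ind; rewrite !inE.
have -> : [set j in [set v1] | (j < v0)%N] = set0.
  by apply/setP; apply: ord4_ind; rewrite !inE.
rewrite cards1 cards0 expr0 expr1 mulN1r mul1r mulrN [X in - X]mulrCA addNr.
by move/eqP; rewrite (negbTE top0).
Qed.

Lemma splitting_principal : gsplitting I J K ->
  exists2 f, f != 0 & forall p, cap_ideal J K p <-> divides f p.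
Proof.
move=> split.
have [[b [l1 [x [y [l2 [lE a1 a2]]]]]]|[b [l1 [x [m [mid [y [l2 [lE xb yb am]]]]]]]]] :=
  seq_switch hasP' hasN.
  exists (stepU y.1 * stepW x.2); first by rewrite mulf_neq0 ?stepU_neq0 ?stepW_neq0.
  have fb : [seq z <- l | P z == b] = rcons l1 x.
    rewrite lE -cat_rcons filter_cat (all_filterP a1) (_ : filter _ (y :: l2) = [::]) ?cats0 //.
    apply/eqP; rewrite -[_ == _]negbK -has_filter -all_predC.
    by apply: sub_all a2 => z /eqP /= ->; case: (b).
  have fnb : [seq z <- l | P z == ~~ b] = y :: l2.
    rewrite lE -cat_rcons filter_cat (all_filterP a2) (_ : filter _ (rcons l1 x) = [::]) //.
    apply/eqP; rewrite -[_ == _]negbK -has_filter -all_predC.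
    by apply: sub_all a1 => z /eqP /= ->; case: (b).
  have [l1x xr] := pairwise_mid (l1 := l1) (z := x) (l2 := y :: l2) lchain lE.
  have [l1y yr] : (forall t, t \in rcons l1 x -> stairs t y) /\
      (forall t, t \in l2 -> stairs y t).
    by apply: pairwise_mid lchain _; rewrite lE cat_rcons.
  have /andP[xy1 xy2] := xr y (mem_head _ _).
  have capE p : cap_ideal J K p <-> cap_ideal (part b) (part (~~ b)) p.
    by rewrite /J /K; case: (b) => //=; split=> -[].
  move=> p; rewrite capE /part fb fnb; apply: chain_cap => //.
  - by rewrite mem_rcons mem_head.
  - by rewrite mem_head.
  - exact: ltnW.
  - exact: ltnW.
  - move=> t; rewrite mem_rcons inE => /orP[/eqP->//|/l1x/andP[_]]; exact: ltnW.
  - move=> t; rewrite inE => /orP[/eqP->//|/yr/andP[+ _]]; exact: ltnW.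
have /andP[/eqP mb midb] := am.
have [c cz cb] := two_switch_cycle lE xb yb mb midb.
case: cb; apply: gbetti_eq0 cz; first by apply: is_cap_ideal; apply: part_id.
have := split 2 (stepdeg (y.1, x.2)); rewrite gbetti0_exact.
- by move=> /esym/eqP; rewrite addn_eq0 => /andP[_ /eqP].
- exact: gen_ideal_ideal_set.
- apply: exact_at_cycle; first by apply: gen_ideal_homogeneous => g /mapP[z zl ->];
    exists (stepdeg z); apply: step_bihom.
  apply: chain_exact; first by case: (l) hasP'.
  by apply: sub_pairwise lchain => z t /andP[/ltnW-> /ltnW->].
Qed.

End ChainSplitting.

(** * Depth at least two makes the rows comparable *)

Lemma size_filter_lt (T : eqType) (P Q : pred T) (s : seq T) x :
  x \in s -> Q x -> ~~ P x -> (forall y, P y -> Q y) ->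
  (size (filter P s) < size (filter Q s))%N.
Proof.
move=> xs Qx Px PQ; rewrite !size_filter; elim: s xs => //= y s IH.
rewrite inE => /orP[/eqP<-|/IH lt].
  by rewrite Qx (negbTE Px) add0n add1n ltnS; apply: sub_count.
by rewrite -addnS leq_add //; case Py: (P y); rewrite //= PQ.
Qed.

Section RowsComparable.
Variable F : numFieldType.
Local Notation S := {mpoly F[4]}.
Implicit Types (p q f g : S) (A B : F * F) (L : seq (F * F)).

Definition peq_free L : Prop :=
  uniq L /\ forall A B, A \in L -> B \in L -> A != B -> ~~ peq A B.

Lemma prime_prod_notin (I : S -> Prop) (T : eqType) (E : T -> S) (s : seq T) :
  prime_ideal_set I -> (forall x, x \in s -> ~ I (E x)) -> ~ I (\prod_(x <- s) E x).
Proof.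
move=> [_ [I1 Ip]]; elim: s => [|x s IH] ns; first by rewrite big_nil.
rewrite big_cons => /Ip[]; first by apply: ns; rewrite mem_head.
by apply: IH => y ys; apply: ns; rewrite inE ys orbT.
Qed.

Lemma xform_in_pt A B : pt_ideal (A, B) (xform A).
Proof. by apply: mem_gen_ideal; rewrite mem_head. Qed.

Lemma yform_in_pt A B : pt_ideal (A, B) (yform B).
Proof. by apply: mem_gen_ideal; rewrite !inE eqxx orbT. Qed.

Lemma xform_notin_pt A A' B : prep A -> prep A' -> prep B -> ~~ peq A A' ->
  ~ pt_ideal (A, B) (xform A').
Proof. by move=> rA rA' rB ne /(xform_pt_ideal (P := (A, B)) rA rB rA') /=; apply/negP. Qed.

Lemma yform_notin_pt A B B' : prep A -> prep B -> prep B' -> ~~ peq B B' ->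
  ~ pt_ideal (A, B) (yform B').
Proof. by move=> rA rA' rB ne /(yform_pt_ideal (P := (A, B)) rA rA' rB) /=; apply/negP. Qed.

Lemma xprod_in_pt A B L : A \in L -> pt_ideal (A, B) (xprod L).
Proof.
move=> AL; rewrite /xprod (big_rem A AL) /= mulrC.
by apply: gen_idealM; apply: xform_in_pt.
Qed.

Lemma yprod_in_pt A B L : B \in L -> pt_ideal (A, B) (yprod L).
Proof.
move=> AL; rewrite /yprod (big_rem B AL) /= mulrC.
by apply: gen_idealM; apply: yform_in_pt.
Qed.

Lemma row_ideal A L p : prep A -> all (@prep F) L -> peq_free L ->
  (forall B, B \in L -> pt_ideal (A, B) p) ->
  exists a b, p = a * xform A + b * yprod L.
Proof.
move=> rA; elim: L => [|B L IH] rL [uL dL] pL.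
  by exists 0, p; rewrite /yprod big_nil mul0r add0r mulr1.
case/andP: rL => rB rL; case/andP: (uL) => BL uL'.
have [||a [b pE]] := IH rL.
- by split=> // x y xL yL; apply: dL; rewrite inE ?xL ?yL orbT.
- by move=> x xL; apply: pL; rewrite inE xL orbT.
have pr := @pt_ideal_prime F (A, B) rA rB.
have [_ [_ Ip]] := pr.
have : pt_ideal (A, B) (b * yprod L).
  have -> : b * yprod L = p - a * xform A by rewrite pE addrC addKr.
  apply: ideal_setB; first exact: gen_ideal_ideal_set.
    by apply: pL; rewrite mem_head.
  by apply: gen_idealM; apply: xform_in_pt.
case/Ip => [/gen_ideal2P[a' [b' /= bE]]|]; last first.
  move=> h; exfalso; move: h; apply: prime_prod_notin => // x xL.
  apply: yform_notin_pt => //; first exact: (allP rL).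
  by apply: dL; rewrite ?mem_head ?inE ?xL ?orbT //; apply: contraNneq BL => ->.
exists (a + a' * yprod L), b'.
have -> : yprod (B :: L) = yform B * yprod L by rewrite /yprod big_cons.
rewrite pE bE (mulrDl _ _ (yprod L)) (mulrDl a) addrA.
by congr (_ + _ + _); [exact: mulrAC | rewrite mulrA].
Qed.

Lemma xprod_divides L p : all (@prep F) L -> peq_free L ->
  (forall A, A \in L -> divides (xform A) p) -> divides (xprod L) p.
Proof.
move=> /allP rL [uL dL] dvd; rewrite xprod_map; apply: prod_divides.
- by move=> _ /mapP[A /rL rA ->]; apply: xform_prime.
- move=> i j; rewrite size_map => /andP[ij jL]; have iL := ltn_trans ij jL.
  rewrite !(nth_map (0, 0)) //; apply: xform_ndvd; first by apply: rL; rewrite mem_nth.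
  by apply: dL; rewrite ?mem_nth // nth_uniq // neq_ltn ij orbT.
- by move=> _ /mapP[A /dvd dA ->].
Qed.

Lemma yprod_divides L p : all (@prep F) L -> peq_free L ->
  (forall A, A \in L -> divides (yform A) p) -> divides (yprod L) p.
Proof.
move=> /allP rL [uL dL] dvd; rewrite yprod_map; apply: prod_divides.
- by move=> _ /mapP[A /rL rA ->]; apply: yform_prime.
- move=> i j; rewrite size_map => /andP[ij jL]; have iL := ltn_trans ij jL.
  rewrite !(nth_map (0, 0)) //; apply: yform_ndvd; first by apply: rL; rewrite mem_nth.
  by apply: dL; rewrite ?mem_nth // nth_uniq // neq_ltn ij orbT.
- by move=> _ /mapP[A /dvd dA ->].
Qed.

Lemma lin_form_span (V : lmodType F) (u v : V) A A' : ~~ peq A A' ->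
  exists a b c d : F,
    u = a *: (A.2 *: u - A.1 *: v) + b *: (A'.2 *: u - A'.1 *: v) /\
    v = c *: (A.2 *: u - A.1 *: v) + d *: (A'.2 *: u - A'.1 *: v).
Proof.
rewrite /peq -subr_eq0; set D := _ - _ => D0.
have uE : D *: u = A.1 *: (A'.2 *: u - A'.1 *: v) - A'.1 *: (A.2 *: u - A.1 *: v).
  rewrite !scalerBr !scalerA [A'.1 * A.1]mulrC opprB addrA subrK -scalerBl.
  by rewrite [A'.1 * _]mulrC.
have vE : D *: v = A.2 *: (A'.2 *: u - A'.1 *: v) - A'.2 *: (A.2 *: u - A.1 *: v).
  rewrite !scalerBr !scalerA [A'.2 * A.2]mulrC opprB addrC addrA subrK.
  by rewrite -scalerBl [A'.2 * _]mulrC.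
exists (- (D^-1 * A'.1)), (D^-1 * A.1), (- (D^-1 * A'.2)), (D^-1 * A.2).
by split; rewrite scaleNr addrC -!scalerA -scalerBr -?uE -?vE scalerA mulVf // scale1r.
Qed.

End RowsComparable.

Section RegularSequence.
Variable F : numFieldType.
Local Notation S := {mpoly F[4]}.
Implicit Types (p q : S) (A B : F * F) (L : seq (F * F)).
Implicit Types s t : F * F -> F * F -> S.
Variables (As Bs : seq (F * F)) (E : F * F -> F * F -> bool).
Hypotheses (rAs : forall A, A \in As -> prep A) (rBs : forall B, B \in Bs -> prep B).
Hypotheses (dAs : peq_free As) (dBs : peq_free Bs).

Definition pts_ideal p : Prop :=
  forall A B, A \in As -> B \in Bs -> E A B -> pt_ideal (A, B) p.

Lemma pt_separator A B : A \in As -> B \in Bs -> exists q, ~ pt_ideal (A, B) q /\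
  forall A' B', A' \in As -> B' \in Bs -> (A', B') != (A, B) -> pt_ideal (A', B') q.
Proof.
move=> Ai Bi; have pr := @pt_ideal_prime F (A, B) (rAs Ai) (rBs Bi).
exists (xprod (rem A As) * yprod (rem B Bs)); split.
  have [uA dA] := dAs; have [uB dB] := dBs.
  have [_ [_ Ip]] := pr; case/Ip; apply: prime_prod_notin => // x;
    rewrite mem_rem_uniq // => /andP[/= xA xAs].
    by apply: xform_notin_pt; auto; apply: dA => //; rewrite eq_sym.
  by apply: yform_notin_pt; auto; apply: dB => //; rewrite eq_sym.
move=> A' B' Ai' Bi'; rewrite xpair_eqE negb_and => /orP[ne|ne].
  rewrite mulrC; apply: gen_idealM; apply: xprod_in_pt.
  by rewrite mem_rem_uniq ?inE ?ne //; case: dAs.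
by apply: gen_idealM; apply: yprod_in_pt; rewrite mem_rem_uniq ?inE ?ne //; case: dBs.
Qed.

(* [s] prescribes a function on each of the planes V(I_P) separately. *)
Definition liftable s : Prop := exists p, forall A B, A \in As -> B \in Bs -> E A B ->
  pt_ideal (A, B) (p - s A B).

Lemma liftable0 s : (forall A B, A \in As -> B \in Bs -> E A B -> pt_ideal (A, B) (s A B)) ->
  liftable s.
Proof.
move=> h; exists 0 => A B Ai Bi EAB; rewrite sub0r -mulN1r.
by apply: gen_idealM; apply: h.
Qed.

Lemma liftableD s t : liftable s -> liftable t -> liftable (fun A B => s A B + t A B).
Proof.
move=> [p hp] [q hq]; exists (p + q) => A B Ai Bi EAB; rewrite opprD addrACA.
have [_ [ID _]] := gen_ideal_ideal_set [:: @xform F A; yform B].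
by apply: ID; [apply: hp|apply: hq].
Qed.

Lemma liftableM r s : liftable s -> liftable (fun A B => r * s A B).
Proof.
move=> [p hp]; exists (r * p) => A B Ai Bi EAB; rewrite -mulrBr.
by apply: gen_idealM; apply: hp.
Qed.

Lemma eq_liftable s t : (forall A B, s A B = t A B) -> liftable s -> liftable t.
Proof. by move=> st [p hp]; exists p => A B; rewrite -st; apply: hp. Qed.

Variables f g : S.
Hypotheses (fm : gen_ideal [:: 'X_v0; 'X_v1; 'X_v2; 'X_v3] f).
Hypotheses (gm : gen_ideal [:: 'X_v0; 'X_v1; 'X_v2; 'X_v3] g).
Hypothesis f_reg : forall p, pts_ideal (f * p) -> pts_ideal p.
Hypothesis g_reg : forall p, (exists a c, pts_ideal a /\ g * p = a + c * f) ->
  exists a c, pts_ideal a /\ p = a + c * f.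

Lemma f_notin A B : A \in As -> B \in Bs -> E A B -> ~ pt_ideal (A, B) f.
Proof.
move=> Ai Bi EAB fP; have [q [qP qO]] := pt_separator Ai Bi.
apply: qP; apply: f_reg => // A' B' Ai' Bi' _.
have [[-> ->]|ne] := eqVneq (A', B') (A, B); first by rewrite mulrC; apply: gen_idealM.
by apply: gen_idealM; apply: qO.
Qed.

Lemma liftable_irrelevant s r : gen_ideal [:: 'X_v0; 'X_v1; 'X_v2; 'X_v3] r ->
  (forall k, liftable (fun A B => 'X_k * s A B)) -> liftable (fun A B => r * s A B).
Proof.
move=> + h; move: r; apply: gen_ideal_min.
  split; [|split].
  - apply: liftable0 => A B _ _ _; rewrite mul0r.
    by case: (gen_ideal_ideal_set [:: @xform F A; yform B]).
  - move=> a b ha hb; apply: eq_liftable (liftableD ha hb) => A B.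
    by rewrite mulrDl.
  - by move=> r a ha; apply: eq_liftable (liftableM r ha) => A B; rewrite mulrA.
by move=> r; rewrite !inE => /or4P[]/eqP->; apply: h.
Qed.

(* Sections over the punctured spectrum extend when the depth is at least 2. *)
Lemma liftable_extend s :
  (forall k, liftable (fun A B => 'X_k * s A B)) -> liftable s.
Proof.
move=> h; have [pf hf] := liftable_irrelevant fm h.
have [pg hg] := liftable_irrelevant gm h.
have [|a [c [aI pfE]]] := g_reg (p := pf).
  exists (g * pf - f * pg), pg; split; last by rewrite [pg * f]mulrC subrK.
  move=> A B Ai Bi EAB.
  have -> : g * pf - f * pg = g * (pf - f * s A B) - f * (pg - g * s A B).
    by rewrite !mulrBr opprB addrA [f * (g * _)]mulrCA subrK.
  apply: ideal_setB; first exact: gen_ideal_ideal_set.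
    by apply: gen_idealM; apply: hf.
  by apply: gen_idealM; apply: hg.
exists c => A B Ai Bi EAB.
have [_ [_ Ip]] := @pt_ideal_prime F (A, B) (rAs Ai) (rBs Bi).
suff /Ip[/(f_notin Ai Bi EAB)//|//] : pt_ideal (A, B) (f * (c - s A B)).
have -> : f * (c - s A B) = (pf - f * s A B) - a.
  by rewrite pfE mulrBr [c * f]mulrC addrAC [a + _]addrC addrK.
apply: ideal_setB; first exact: gen_ideal_ideal_set.
  exact: hf.
exact: aI.
Qed.

Lemma liftable_remove L L' t : (forall B B', B \in L -> B' \in L' -> ~~ peq B B') ->
  liftable (fun A B => yprod L * t A B) -> liftable (fun A B => yprod L' * t A B) ->
  liftable (fun A B => 'X_v0 * t A B) -> liftable (fun A B => 'X_v1 * t A B) ->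
  liftable t.
Proof.
have [n] := ubnP (size L + size L'); elim: n L L' t => // n IH.
case=> [|B L] L' t sz ne hL hL' h0 h1.
  by apply: eq_liftable hL => A D; rewrite /yprod big_nil mul1r.
case: L' sz ne hL' => [|B' L'] sz ne hL'.
  by apply: eq_liftable hL' => A D; rewrite /yprod big_nil mul1r.
have yM r A D : 'X_v0 * (r * t A D) = r * ('X_v0 * t A D) by rewrite mulrCA.
have yM1 r A D : 'X_v1 * (r * t A D) = r * ('X_v1 * t A D) by rewrite mulrCA.
have hB : liftable (fun A D => yform B * t A D).
  apply: (IH L (B' :: L')).
  - by move: sz; rewrite /=; lia.
  - by move=> x y xL yL; apply: ne; rewrite // inE xL orbT.
  - by apply: eq_liftable hL => A D; rewrite /yprod big_cons -mulrA mulrCA.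
  - by apply: eq_liftable (liftableM (yform B) hL') => A D; rewrite mulrCA.
  - by apply: eq_liftable (liftableM (yform B) h0) => A D; rewrite mulrCA.
  - by apply: eq_liftable (liftableM (yform B) h1) => A D; rewrite mulrCA.
have hB' : liftable (fun A D => yform B' * t A D).
  apply: (IH (B :: L) L').
  - by move: sz; rewrite /=; lia.
  - by move=> x y xL yL; apply: ne; rewrite // inE yL orbT.
  - by apply: eq_liftable (liftableM (yform B') hL) => A D; rewrite mulrCA.
  - by apply: eq_liftable hL' => A D; rewrite /yprod big_cons -mulrA mulrCA.
  - by apply: eq_liftable (liftableM (yform B') h0) => A D; rewrite mulrCA.
  - by apply: eq_liftable (liftableM (yform B') h1) => A D; rewrite mulrCA.
have [|a [b [c [d [e2 e3]]]]] := @lin_form_span F S 'X_v2 'X_v3 B B'.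
  by apply: ne; rewrite mem_head.
apply: liftable_extend; apply: ord4_ind => //.
- apply: eq_liftable (liftableD (liftableM a%:MP hB) (liftableM b%:MP hB')) => A D.
  by rewrite !mulrA !mul_mpolyC -mulrDl; congr (_ * _); exact: esym e2.
- apply: eq_liftable (liftableD (liftableM c%:MP hB) (liftableM d%:MP hB')) => A D.
  by rewrite !mulrA !mul_mpolyC -mulrDl; congr (_ * _); exact: esym e3.
Qed.

Let row A := [seq B <- Bs | E A B].

Let row_free A : peq_free (row A).
Proof.
case: dBs => uB dB; split=> [|x y]; first exact: filter_uniq.
by rewrite !mem_filter => /andP[_ xB] /andP[_ yB]; apply: dB.
Qed.

Let row_prep A : all (@prep F) (row A).
Proof. by apply/allP => B; rewrite mem_filter => /andP[_ /rBs]. Qed.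

Let row_divides A d p : A \in As -> (d.2 < size (row A))%N ->
    (forall B, B \in row A -> pt_ideal (A, B) p) ->
  divides (xform A) (prs (0, 0)%N d p).
Proof.
move=> Ai dA pA; have [a [b ->]] := row_ideal (rAs Ai) (row_prep A) (row_free A) pA.
rewrite prsD (prs_mul_bihom _ _ _ (@bihom_xform F A)) (prs_mul_bihom _ _ _ (@bihom_yprod F _)).
suff -> : prs (padd (0, 0)%N (0, size (row A))%N) d b = 0.
  by rewrite mul0r addr0; eexists.
apply/mpolyP => m; rewrite mcoeff_prs mcoeff0; case: eqP => // e.
by exfalso; move: dA; rewrite -e /=; clear; lia.
Qed.

Lemma rows_comparable A A' : A \in As -> A' \in As ->
  (forall B, B \in Bs -> E A B -> E A' B) \/ (forall B, B \in Bs -> E A' B -> E A B).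
Proof.
have [n] := ubnP (size [seq B <- Bs | E A B && E A' B]).
elim: n A A' => // n IH A A'; set c := size _ => cn Ai Ai'.
have [/allP h|/allPn[B1 B1r B1n]] := boolP (all (E A') (row A)).
  by left=> B Bi EB; apply: h; rewrite mem_filter EB.
have [/allP h|/allPn[B2 B2r B2n]] := boolP (all (E A) (row A')).
  by right=> B Bi EB; apply: h; rewrite mem_filter EB.
exfalso.
have [uA dA] := dAs; have [uB dB] := dBs.
have AA' : A != A' by apply: contraNneq B1n => <-; move: B1r; rewrite mem_filter => /andP[].
pose meet := [seq B <- Bs | E A B && E A' B].
move: B1r B2r; rewrite !mem_filter => /andP[E1 B1s] /andP[E2 B2s].
have cA : (c < size (row A))%N.
  by apply: (size_filter_lt B1s E1); rewrite ?(negbTE B1n) ?andbF // => y /andP[].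
have cA' : (c < size (row A'))%N.
  by apply: (size_filter_lt B2s E2); rewrite ?(negbTE B2n) ?andbF // => y /andP[].
pose T := [seq D <- As | [&& D != A, D != A' & ~~ all (fun B => E A B && E A' B) (row D)]].
have cT D : D \in T -> (c < size (row D))%N.
  rewrite mem_filter => /andP[/and3P[DA DA' /allPn[B BD Bm]] Di].
  rewrite ltnNge; apply/negP => Dc.
  (* A row meeting [row Z] in fewer points is comparable with it; being smaller,
     it is contained in it. *)
  have sub Z : Z \in As -> (c < size (row Z))%N -> {subset row D <= row Z}.
    move=> Zi cZ; apply/allP; have [//|/allPn[B0 B0D B0Z]] := boolP (all _ _).
    move: (B0D); rewrite mem_filter => /andP[ED B0s].
    have B0N : ~~ E Z B0 by move: B0Z; rewrite mem_filter B0s andbT.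
    have [|h|h] := IH D Z _ Di Zi.
    - apply: (leq_trans _ (leq_trans Dc cn)).
      by apply: (size_filter_lt B0s ED); rewrite ?(negbTE B0N) ?andbF // => y /andP[].
    - by move: B0N; rewrite h.
    - have : (size (row Z) <= size (row D))%N.
        apply: uniq_leq_size; first exact: filter_uniq.
        by move=> x; rewrite !mem_filter => /andP[Zx xs]; rewrite xs h.
      by move=> /(leq_trans cZ)/leq_trans/(_ Dc); rewrite ltnn.
  have := sub A Ai cA B BD; have := sub A' Ai' cA' B BD.
  by rewrite !mem_filter => /andP[h1 _] /andP[h2 _]; rewrite h1 h2 in Bm.
have pA : ~~ peq A A' by apply: dA.
pose Ff := xprod T; pose G := yprod meet.
pose s D (B : F * F) : S := if D == A then Ff * G else 0.
have I0 P : pt_ideal P (0 : S) by case: (gen_ideal_ideal_set [:: xform P.1; yform P.2]).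
have FG_in D B : D \in As -> B \in row D -> D != A -> D != A' -> pt_ideal (D, B) (Ff * G).
  move=> Di BD DA DA'; have [/allP/(_ B BD) EE|nD] := boolP (all (fun B => E A B && E A' B) (row D)).
    apply: gen_idealM; apply: yprod_in_pt; rewrite mem_filter EE.
    by move: BD; rewrite mem_filter => /andP[].
  by rewrite mulrC; apply: gen_idealM; apply: xprod_in_pt; rewrite mem_filter DA DA' nD.
have hA : liftable (fun D B => xform A * s D B).
  apply: liftable0 => D B Di Bi EDB; rewrite /s; case: eqP => [->|_]; last by rewrite mulr0.
  by rewrite mulrC; apply: gen_idealM; apply: xform_in_pt.
have hA' : liftable (fun D B => xform A' * s D B).
  exists (xform A' * (Ff * G)) => D B Di Bi EDB; rewrite /s.
  have [_|DA] := eqVneq D A; first by rewrite subrr.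
  rewrite mulr0 subr0; have [->|DA'] := eqVneq D A'.
    by rewrite mulrC; apply: gen_idealM; apply: xform_in_pt.
  by apply: gen_idealM; apply: FG_in => //; rewrite mem_filter EDB.
have [a [b [c0 [d0 [e0 e1]]]]] := @lin_form_span F S 'X_v0 'X_v1 A A' pA.
have [p hp] : liftable s.
  apply: (@liftable_remove [seq B <- Bs | E A B && ~~ E A' B] [seq B <- Bs | E A' B && ~~ E A B]).
  - move=> B B'; rewrite !mem_filter => /andP[/andP[_ nE] Bi] /andP[/andP[E' _] Bi'].
    by apply: dB => //; apply: contraNneq nE => ->.
  - apply: liftable0 => D B Di Bi EDB; rewrite /s; case: eqP => [DA|_]; last by rewrite mulr0.
    rewrite DA in EDB *; case EA': (E A' B).
      by rewrite mulrA; apply: gen_idealM; apply: yprod_in_pt; rewrite mem_filter EDB EA'.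
    by rewrite mulrC; apply: gen_idealM; apply: yprod_in_pt; rewrite mem_filter EDB EA'.
  - exists (yprod [seq B <- Bs | E A' B && ~~ E A B] * (Ff * G)) => D B Di Bi EDB; rewrite /s.
    have [_|DA] := eqVneq D A; first by rewrite subrr.
    rewrite mulr0 subr0; have [DA'|DA'] := eqVneq D A'; last first.
      by apply: gen_idealM; apply: FG_in => //; rewrite mem_filter EDB.
    rewrite DA' in EDB *; case EA: (E A B).
      by rewrite mulrA; apply: gen_idealM; apply: yprod_in_pt; rewrite mem_filter EDB EA.
    by rewrite mulrC; apply: gen_idealM; apply: yprod_in_pt; rewrite mem_filter EDB EA.
  - apply: eq_liftable (liftableD (liftableM a%:MP hA) (liftableM b%:MP hA')) => D B.
    by rewrite !mulrA !mul_mpolyC -mulrDl; congr (_ * _); exact: esym e0.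
  - apply: eq_liftable (liftableD (liftableM c0%:MP hA) (liftableM d0%:MP hA')) => D B.
    by rewrite !mulrA !mul_mpolyC -mulrDl; congr (_ * _); exact: esym e1.
pose d := (size T, c); pose p1 := prs (0, 0)%N d p.
have FGd : prs (0, 0)%N d (Ff * G) = Ff * G.
  have h : bihom d (Ff * G).
    have := @bihomM F (size T, 0)%N (0, c)%N Ff G (@bihom_xprod F T) (@bihom_yprod F meet).
    by rewrite /padd /= addn0.
  by rewrite (bihom_prs _ _ h) /padd !addn0 eqxx.
have p1A : divides (xform A) (p1 - Ff * G).
  rewrite -FGd -[- prs _ _ _]scaleN1r -prsZ -prsD scaleN1r.
  apply: row_divides => // B; rewrite mem_filter => /andP[EB Bi].
  by have := hp A B Ai Bi EB; rewrite /s eqxx.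
have p1D D : D \in As -> D != A -> (c < size (row D))%N -> divides (xform D) p1.
  move=> Di DA cD; apply: row_divides => // B; rewrite mem_filter => /andP[EB Bi].
  by have := hp D B Di Bi EB; rewrite /s (negbTE DA) subr0.
have TA D : D \in T -> [/\ D \in As, D != A & D != A'].
  by rewrite mem_filter => /andP[/and3P[? ? _] ?].
have rT : all (@prep F) (A' :: T).
  by apply/allP => D; rewrite inE => /orP[/eqP->|/TA[? _ _]]; apply: rAs.
have [r p1E] : divides (xprod (A' :: T)) p1.
  apply: xprod_divides => // [|D].
    split=> [|D D']; first by rewrite /= filter_uniq // andbT; apply/negP => /TA[_ _]; rewrite eqxx.
    rewrite !inE => /orP[/eqP->|/TA[? _ _]] /orP[/eqP->|/TA[? _ _]]; exact: dA.
  by rewrite inE => /orP[/eqP->|DT]; [apply: p1D; rewrite // eq_sym|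
    have [? ? _] := TA D DT; apply: p1D => //; apply: cT].
have p10 : p1 = 0.
  rewrite -[p1]prs_idem -/p1 p1E (prs_mul_bihom _ _ _ (@bihom_xprod F _)).
  suff -> : prs (padd (0, 0)%N (size (A' :: T), 0)%N) d r = 0 by rewrite mul0r.
  apply/mpolyP => m; rewrite mcoeff_prs mcoeff0; case: eqP => // /(congr1 fst) /=.
  by rewrite /= => e; exfalso; move: e; clear; lia.
move: p1A; rewrite p10 sub0r -mulN1r => -[k kE].
have [_ Ap] := xform_prime (rAs Ai).
have /Ap[] : divides (xform A) (Ff * G) by exists (- k); rewrite mulNr -kE mulN1r opprK.
  rewrite /Ff xprod_map; apply: prime_ndvd_prod.
  - exact: xform_prime (rAs Ai).
  - exact: xform_ndvd1 (rAs Ai).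
  - move=> _ /mapP[D /TA[Di DA _] ->]; apply: xform_ndvd; first exact: rAs.
    by apply: dA => //; rewrite eq_sym.
apply: xform_ndvd_yprod; first exact: rAs.
by apply/allP => B; rewrite mem_filter => /andP[_ /rBs].
Qed.

End RegularSequence.

(** * The ideal of a staircase with lines *)

Section Staircase.
Variable T : eqType.
Variables (a0 : T) (As Bs : seq T) (E : T -> T -> bool).
Let rsize i := size [seq B <- Bs | E (nth a0 As i) B].
Let csize j := size [seq A <- As | E A (nth a0 Bs j)].
Hypothesis comparable_rows : forall A A', A \in As -> A' \in As ->
  (forall B, B \in Bs -> E A B -> E A' B) \/ (forall B, B \in Bs -> E A' B -> E A B).
Hypotheses (uBs : uniq Bs).
Hypothesis rsize_mono : forall k, (k.+1 < size As)%N -> (rsize k.+1 <= rsize k)%N.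
Hypothesis csize_mono : forall k, (k.+1 < size Bs)%N -> (csize k.+1 <= csize k)%N.

Lemma prefix_count (P : pred T) (s : seq T) :
  (forall i j, (i <= j)%N -> (j < size s)%N -> P (nth a0 s j) -> P (nth a0 s i)) ->
  forall i, (i < size s)%N -> P (nth a0 s i) = (i < count P s)%N.
Proof.
elim: s => // x s IH down i si /=.
have [Px|nPx] := boolP (P x); last first.
  have nP j : (j < size s)%N -> ~~ P (nth a0 s j).
    by move=> js; apply: contra nPx => Pj; apply: (down 0%N j.+1).
  have -> : count P s = 0%N.
    apply/eqP; rewrite -leqn0 leqNgt -has_count; apply/hasPn => y /(nthP a0)[j js <-]; exact: nP.
  by case: i si => [|i] si; [exact: negbTE|exact/negbTE/nP].
case: i si => [|i] si; first by rewrite Px.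
rewrite add1n ltnS -IH // => j k jk ks; exact: (down j.+1 k.+1).
Qed.

Lemma mono_le (f : nat -> nat) n : (forall k, (k.+1 < n)%N -> (f k.+1 <= f k)%N) ->
  forall i j, (i <= j)%N -> (j < n)%N -> (f j <= f i)%N.
Proof.
move=> fS i j; elim: j => [|j IH]; first by rewrite leqn0 => /eqP->.
rewrite leq_eqVlt => /orP[/eqP-> //|ij] jn.
by apply: leq_trans (fS _ jn) (IH ij (ltnW jn)).
Qed.

Lemma staircase i j : (i < size As)%N -> (j < size Bs)%N ->
  E (nth a0 As i) (nth a0 Bs j) = (j < rsize i)%N.
Proof.
move=> iA jB; rewrite /rsize size_filter; move: j jB.
apply: (prefix_count (P := E (nth a0 As i))) => j j' jj j'B.
have col k : (k < size Bs)%N -> E (nth a0 As i) (nth a0 Bs k) = (i < csize k)%N.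
  move=> kB; rewrite /csize size_filter.
  apply: (prefix_count (P := fun A => E A (nth a0 Bs k))) iA => l l' ll l'A El'.
  have lA := leq_ltn_trans ll l'A.
  have [h|h] := comparable_rows (mem_nth a0 lA) (mem_nth a0 l'A); last first.
    by apply: h => //; apply: mem_nth.
  have le : (rsize l' <= rsize l)%N by apply: mono_le ll l'A.
  have [_ eqE] := uniq_min_size (filter_uniq (E (nth a0 As l)) uBs)
    (s2 := [seq B <- Bs | E (nth a0 As l') B])
    (fun B => ltac:(by rewrite !mem_filter => /andP[EB BB]; rewrite BB h)) le.
  have := eqE (nth a0 Bs k); rewrite !mem_filter mem_nth // !andbT => ->.
  by [].
rewrite col // => lt; rewrite col; last exact: leq_ltn_trans jj j'B.
by apply: leq_trans lt _; apply: mono_le jj j'B.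
Qed.

End Staircase.

Section StaircaseIdeal.
Variable F : numFieldType.
Local Notation S := {mpoly F[4]}.
Implicit Types (p q : S) (A B : F * F) (As L : seq (F * F)).
Variable Bs : seq (F * F).
Hypotheses (rBs : all (@prep F) Bs) (dBs : peq_free Bs).

Lemma peq_free_sub L L' : uniq L -> {subset L <= L'} -> peq_free L' -> peq_free L.
Proof. by move=> uL sub [_ d]; split=> // x y /sub xL /sub yL; apply: d. Qed.

Lemma staircase_gens As (alpha : nat -> nat) p : all (@prep F) As -> peq_free As ->
  (forall i j, (i <= j)%N -> (j < size As)%N -> (alpha j <= alpha i)%N) ->
  (forall i, (i < size As)%N -> (alpha i <= size Bs)%N) ->
  (forall i j, (i < size As)%N -> (j < alpha i)%N ->
     pt_ideal (nth (0, 0) As i, nth (0, 0) Bs j) p) ->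
  gen_ideal [seq xprod (take i As) *
                 yprod (take (if (i < size As)%N then alpha i else 0%N) Bs)
            | i <- iota 0 (size As).+1] p.
Proof.
elim: As alpha p => [|A As IH] alpha p /=.
  by move=> _ _ _ _ _; apply/gen_ideal1P; exists p; rewrite take0 /xprod /yprod !big_nil !mulr1.
case/andP=> rA rAs dAs mono ab pI.
have [||B|a [b pE]] := row_ideal (L := take (alpha 0%N) Bs) (p := p) rA.
- by apply/allP => B /mem_take; apply: (allP rBs).
- apply: (peq_free_sub _ _ dBs); first by rewrite take_uniq //; case: dBs.
  by move=> B /mem_take.
- have a0 := ab 0%N (ltn0Sn _).
  move=> /(nthP (0, 0))[j]; rewrite size_takel // => ja <-; rewrite nth_take //.
  exact: (pI 0%N j).
have dAs' : peq_free As.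
  case: (dAs) => /andP[_ uAs] _.
  by apply: (peq_free_sub uAs _ dAs) => x xA; rewrite inE xA orbT.
have IHa := IH (fun i => alpha i.+1) a rAs dAs' (fun i j => mono i.+1 j.+1) (fun i => ab i.+1).
have aI i j : (i < size As)%N -> (j < alpha i.+1)%N ->
    pt_ideal (nth (0, 0) As i, nth (0, 0) Bs j) a.
  move=> iA ja.
  have rAi : prep (nth (0, 0) As i) by apply: (allP rAs); rewrite mem_nth.
  have le := mono 0%N i.+1 (leq0n _) (iA : (i.+1 < size (A :: As))%N).
  have jB : (j < size Bs)%N := leq_trans ja (ab i.+1 iA).
  have rBj : prep (nth (0, 0) Bs j) by apply: (allP rBs); rewrite mem_nth.
  have [_ [_ Ip]] := @pt_ideal_prime F (nth (0, 0) As i, nth (0, 0) Bs j) rAi rBj.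
  have /Ip[//|] : pt_ideal (nth (0, 0) As i, nth (0, 0) Bs j) (a * xform A).
    have -> : a * xform A = p - b * yprod (take (alpha 0%N) Bs) by rewrite pE addrK.
    apply: ideal_setB; first exact: gen_ideal_ideal_set.
      exact: (pI i.+1 j).
    apply: gen_idealM; apply: yprod_in_pt; rewrite -(nth_take (0, 0) (leq_trans ja le)).
    by rewrite mem_nth // size_takel ?(ab 0%N) // (leq_trans ja).
  move=> h; exfalso; move: h; apply: xform_notin_pt => //.
  case: dAs => /andP[AN _] dA; apply: dA; rewrite ?mem_head ?inE ?mem_nth ?orbT //.
  by apply: contraNneq AN => <-; rewrite mem_nth.
have {}IHa := IHa aI; rewrite pE; have [_ [GD _]] := gen_ideal_ideal_set [seq xprod (take i (A :: As)) *
  yprod (take (if (i < (size As).+1)%N then alpha i else 0%N) Bs) | i <- iota 0 (size As).+2].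
apply: GD; last first.
  apply: gen_idealM; apply: mem_gen_ideal; apply/mapP; exists 0%N => //.
  by rewrite take0 /xprod big_nil mul1r.
move: a IHa {aI pE}; set I := gen_ideal (map _ (iota 0 (size As).+2)) => a.
have idI : ideal_set I by apply: gen_ideal_ideal_set.
move: a; apply: (gen_ideal_min (I := fun a => I (a * xform A))).
  split; [|split].
  - by rewrite mul0r; case: idI.
  - by move=> x y hx hy; rewrite mulrDl; case: idI => _ [ID _]; apply: ID.
  - by move=> x y hx; rewrite -mulrA; apply: gen_idealM.
move=> g /mapP[i]; rewrite mem_iota /= add0n => il ->; apply: mem_gen_ideal.
apply/mapP; exists i.+1; first by rewrite mem_iota.
by rewrite /= /xprod big_cons mulrAC [X in X * _]mulrC.
Qed.

End StaircaseIdeal.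

Section UnionIdeal.
Variable F : numFieldType.
Local Notation S := {mpoly F[4]}.
Implicit Types (p q : S) (A B : F * F).
Variables (hs vs As Bs : seq (F * F)) (alpha : nat -> nat).
Hypotheses (rhs : all (@prep F) hs) (rvs : all (@prep F) vs).
Hypotheses (rAs : all (@prep F) As) (rBs : all (@prep F) Bs).
Hypotheses (dhs : peq_free hs) (dvs : peq_free vs).
Hypotheses (dAs : peq_free As) (dBs : peq_free Bs).
Hypothesis hsAs : forall A A', A \in As -> A' \in hs -> ~~ peq A A'.
Hypothesis vsBs : forall B B', B \in Bs -> B' \in vs -> ~~ peq B B'.
Hypothesis mono : forall i j, (i <= j)%N -> (j < size As)%N -> (alpha j <= alpha i)%N.
Hypothesis alpha0 : alpha 0%N = size Bs.
Hypothesis alpha_gt0 : forall i, (i < size As)%N -> (0 < alpha i)%N.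
Hypothesis As_gt0 : (0 < size As)%N.

Definition corners : seq (nat * nat) :=
  [seq (k.+1, alpha k.+1) | k <- iota 0 (size As).-1 & (alpha k.+1 < alpha k)%N].

Definition corner_chain := (0%N, size Bs) :: corners ++ [:: (size As, 0%N)].

Lemma cornersP x : x \in corners ->
  exists k, [/\ (k.+1 < size As)%N, (alpha k.+1 < alpha k)%N & x = (k.+1, alpha k.+1)].
Proof.
rewrite /corners => /mapP[k]; rewrite mem_filter mem_iota => /and3P[ak _ kA] ->; exists k.
by split=> //; move: kA As_gt0; clear; lia.
Qed.

Let alpha_le i : (i < size As)%N -> (alpha i <= size Bs)%N.
Proof. by move=> iA; rewrite -alpha0; apply: mono. Qed.

Lemma corner_chain_stairs : pairwise stairs corner_chain.
Proof.
have last_ok x : x \in corners -> stairs x (size As, 0%N).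
  by move=> /cornersP[k [kA ak ->]]; rewrite /stairs /= kA alpha_gt0.
rewrite /= pairwise_cat /= andbT all_cat /= andbT /stairs /= As_gt0.
rewrite -alpha0 alpha_gt0 //= andbT; apply/and3P; split.
- apply/allP => x /cornersP[k [kA ak ->]] /=.
  by apply: leq_trans ak _; apply: mono; rewrite ?(ltnW kA).
- by apply/allrelP => x y xc; rewrite inE => /eqP->; apply: last_ok.
- rewrite /corners pairwise_map.
  apply: (@sub_in_pairwise _ (fun k => (k.+1 < size As)%N && (alpha k.+1 < alpha k)%N) ltn).
  + move=> k k' /andP[kA ak] /andP[k'A ak'] /= kk'; rewrite ltnS kk' /=.
    by apply: leq_trans ak' _; apply: mono => //; apply: ltnW.
  + apply/allP => k; rewrite mem_filter mem_iota => /and3P[-> _ kA]; rewrite andbT.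
    by move: kA As_gt0; clear; lia.
  + apply: pairwise_filter; rewrite -sorted_pairwise ?iota_ltn_sorted //.
    exact: ltn_trans.
Qed.

Lemma corner_chain_inbox : all (inbox As Bs) corner_chain.
Proof.
apply/allP => x; rewrite inE mem_cat inE => /or3P[/eqP->|/cornersP[k [kA _ ->]]|/eqP->].
- by rewrite /inbox /= leqnn.
- by rewrite /inbox /= (ltnW kA) alpha_le.
- by rewrite /inbox /= leqnn.
Qed.

Let gen x : S := xprod (take x.1 As) * yprod (take x.2 Bs).
Let stairs_ideal p : Prop := forall i j, (i < size As)%N -> (j < alpha i)%N ->
  pt_ideal (nth (0, 0) As i, nth (0, 0) Bs j) p.

Lemma corner_gens p : stairs_ideal p -> gen_ideal (map gen corner_chain) p.
Proof.
move=> pI; have := staircase_gens rBs dBs rAs dAs mono alpha_le pI.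
apply: gen_ideal_min; first exact: gen_ideal_ideal_set.
move=> _ /mapP[i + ->]; rewrite mem_iota leq0n add0n ltnS andTb.
elim: i => [_|i IH iA].
  apply: mem_gen_ideal; apply/mapP; exists (0%N, size Bs); first exact: mem_head.
  by rewrite As_gt0 alpha0.
have [iA'|] := boolP (i.+1 < size As)%N; last first.
  rewrite -leqNgt => Ai; apply: mem_gen_ideal; apply/mapP; exists (size As, 0%N).
    by rewrite inE mem_cat inE eqxx !orbT.
  by congr (xprod (take _ _) * _); apply/eqP; rewrite eqn_leq iA Ai.
have [ai|ai] := ltnP (alpha i.+1) (alpha i).
  apply: mem_gen_ideal; apply/mapP; exists (i.+1, alpha i.+1) => //.
  rewrite inE mem_cat; apply/orP; right; apply/orP; left; rewrite /corners; apply/mapP; exists i => //.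
  by rewrite mem_filter ai mem_iota; move: iA'; clear; lia.
have aE : alpha i.+1 = alpha i by apply/eqP; rewrite eqn_leq ai mono.
have := IH (ltnW iA); rewrite (ltnW iA') aE => h.
rewrite (take_nth (0, 0)) ?(ltnW iA') // -cats1 xprod_cat mulrAC mulrC.
exact: gen_idealM.
Qed.

Lemma gens_stairs_ideal x : x \in corner_chain -> stairs_ideal (gen x).
Proof.
move=> xc i j iA ja; have jB := leq_trans ja (alpha_le iA).
have y_in k : (j < k)%N -> pt_ideal (nth (0, 0) As i, nth (0, 0) Bs j) (gen (x.1, k)).
  move=> jk; apply: gen_idealM; apply: yprod_in_pt.
  by rewrite -(nth_take (0, 0) jk) mem_nth // size_take; case: ifP.
have x_in k : (i < k)%N -> pt_ideal (nth (0, 0) As i, nth (0, 0) Bs j) (gen (k, x.2)).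
  move=> ik; rewrite /gen mulrC; apply: gen_idealM; apply: xprod_in_pt.
  by rewrite -(nth_take (0, 0) ik) mem_nth // size_take; case: ifP.
move: x_in y_in; rewrite inE mem_cat inE in xc.
case/or3P: xc => [/eqP->|/cornersP[k [kA _ ->]]|/eqP->] /= x_in y_in.
- exact: y_in.
- have [ik|ki] := leqP i k; first exact: x_in.
  by apply: y_in; apply: leq_trans ja _; apply: mono.
- exact: x_in.
Qed.

Lemma union_ideal p :
  [/\ stairs_ideal p, forall A, A \in hs -> divides (xform A) p
    & forall B, B \in vs -> divides (yform B) p] <->
  gen_ideal (map (step hs vs As Bs) corner_chain) p.
Proof.
have stepE x : step hs vs As Bs x = (xprod hs * yprod vs) * gen x.
  by rewrite /step /stepU /stepW xprod_cat yprod_cat mulrACA.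
have rA i : (i < size As)%N -> prep (nth (0, 0) As i).
  by move=> iA; apply: (allP rAs); rewrite mem_nth.
have rB j : (j < size Bs)%N -> prep (nth (0, 0) Bs j).
  by move=> iA; apply: (allP rBs); rewrite mem_nth.
split=> [[pI px py]|].
  have [b pE] := yprod_divides rvs dvs py.
  have := xprod_divides rhs dhs px; rewrite {1}pE mulrC.
  move=> /(xprod_coprime_yprod rhs rvs)[a bE].
  have aI : stairs_ideal a.
    move=> i j iA ja; have jB := leq_trans ja (alpha_le iA).
    have pr := @pt_ideal_prime F (nth (0, 0) As i, nth (0, 0) Bs j) (rA _ iA) (rB _ jB).
    have [_ [_ Ip]] := pr; have := pI i j iA ja; rewrite pE bE.
    move=> /Ip[/Ip[//|]|] h; exfalso; move: h; apply: (prime_prod_notin pr).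
    - move=> A Ah; apply: xform_notin_pt; auto; first exact: (allP rhs).
      by apply: hsAs; rewrite ?mem_nth.
    - move=> A Ah; apply: yform_notin_pt; auto; first exact: (allP rvs).
      by apply: vsBs; rewrite ?mem_nth.
  have {pE bE} -> : p = (xprod hs * yprod vs) * a by rewrite pE bE -mulrA mulrC.
  have : gen_ideal (map gen corner_chain) a := corner_gens aI.
  move: a {aI}; apply: (gen_ideal_min (I := fun a => gen_ideal _ (xprod hs * yprod vs * a))).
    have [I0 [ID IM]] := gen_ideal_ideal_set (map (step hs vs As Bs) corner_chain).
    split; [|split].
    + by rewrite mulr0.
    + by move=> x y hx hy; rewrite mulrDr; apply: ID.
    + by move=> r x hx; rewrite mulrCA; apply: IM.
  by move=> _ /mapP[x xc ->]; rewrite -stepE; apply: mem_gen_ideal; apply: map_f.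
move: p; apply: gen_ideal_min.
  have dI (f : S) : ideal_set (divides f).
    split; [by exists 0; rewrite mul0r|split=> [_ _ [a ->] [b ->]|r _ [a ->]]].
      by exists (a + b); rewrite mulrDl.
    by exists (r * a); rewrite mulrA.
  split; [|split].
  - split=> [i j _ _|A _|B _]; [|by case: (dI (xform A))|by case: (dI (yform B))].
    by case: (gen_ideal_ideal_set [:: xform (nth (0, 0) As i); yform (nth (0, 0) Bs j)]).
  - move=> a b [a1 a2 a3] [b1 b2 b3]; split=> [i j iA ja|A Ah|B Bv].
    + have [_ [ID _]] := gen_ideal_ideal_set [:: xform (nth (0, 0) As i); yform (nth (0, 0) Bs j)].
      by apply: ID; [apply: a1|apply: b1].
    + by case: (dI (xform A)) => _ [ID _]; apply: ID; auto.
    + by case: (dI (yform B)) => _ [ID _]; apply: ID; auto.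
  - move=> r a [a1 a2 a3]; split=> [i j iA ja|A Ah|B Bv].
    + by apply: gen_idealM; apply: a1.
    + by case: (dI (xform A)) => _ [_ IM]; apply: IM; auto.
    + by case: (dI (yform B)) => _ [_ IM]; apply: IM; auto.
move=> _ /mapP[x xc ->]; rewrite stepE; split=> [i j iA ja|A Ah|B Bv].
- by apply: gen_idealM; apply: gens_stairs_ideal xc _ _ iA ja.
- rewrite -mulrA mulrC; apply: dividesM; rewrite /xprod (big_rem A Ah) /= mulrC.
  by eexists.
- rewrite mulrAC; apply: dividesM; rewrite /yprod (big_rem B Bv) /= mulrC.
  by eexists.
Qed.

End UnionIdeal.

(** * Configurations of points and lines *)

Section LineCount.
Variable F : numFieldType.

Lemma line_count (Q : eqType) (f1 f2 : Q -> F * F) (X : seq Q) (A : F * F)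
    (Bs : seq (F * F)) :
  prep A -> (forall B, B \in Bs -> prep B) -> peq_free Bs -> uniq X ->
  (forall P, P \in X -> prep (f1 P) /\ prep (f2 P)) ->
  (forall P P', P \in X -> P' \in X -> P != P' ->
     ~~ (peq (f1 P) (f1 P') && peq (f2 P) (f2 P'))) ->
  (forall P, P \in X -> has (peq (f2 P)) Bs) ->
  count (fun P => peq (f1 P) A) X =
  size [seq B <- Bs | has (fun P => peq (f1 P) A && peq (f2 P) B) X].
Proof.
move=> rA rBs [uBs dBs] uX rX dX hX; rewrite -size_filter.
pose phi P := nth (0, 0) Bs (find (peq (f2 P)) Bs).
have phiB P : P \in X -> phi P \in Bs /\ peq (f2 P) (phi P).
  by move=> /hX h; split; [rewrite mem_nth // -has_find | apply: nth_find].
rewrite -(size_map phi); apply: perm_size; apply: uniq_perm.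
- rewrite map_inj_in_uniq ?filter_uniq // => P P'.
  rewrite !mem_filter => /andP[PA PX] /andP[PA' PX'] e; apply/eqP/negPn/negP => ne.
  case/negP: (dX P P' PX PX' ne).
  have [B1 e1] := phiB P PX; have [B2 e2] := phiB P' PX'.
  apply/andP; split; first by apply: (peq_trans rA PA); rewrite peq_sym.
  by apply: (peq_trans (rBs _ B1) e1); rewrite peq_sym e.
- exact: filter_uniq.
move=> B; rewrite mem_filter; apply/mapP/andP.
  move=> [P]; rewrite mem_filter => /andP[PA PX] ->; have [B1 e1] := phiB P PX.
  by split=> //; apply/hasP; exists P; rewrite // PA.
move=> [/hasP[P PX /andP[PA PB]] Bi]; exists P; first by rewrite mem_filter PA.
have [B1 e1] := phiB P PX; apply/eqP/negPn/negP => ne.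
case/negP: (dBs _ _ Bi B1 ne); rewrite peq_sym in PB.
by apply: peq_trans PB e1; case: (rX P PX).
Qed.

End LineCount.

Section PrimeChain.
Variable F : numFieldType.
Local Notation S := {mpoly F[4]}.

Lemma exists_not_peq (A : F * F) : prep A -> exists2 B, prep B & ~~ peq A B.
Proof.
rewrite /prep /peq; case: eqP => [->|/eqP a0] /= a1.
  by exists (1, 0); rewrite /= ?oner_eq0 // mul0r mulr1 eq_sym.
by exists (0, 1); rewrite /= ?oner_eq0 ?orbT // mulr0 mulr1.
Qed.

Lemma pt_ideal_chain (P : (F * F) * (F * F)) : prep P.1 -> prep P.2 ->
  exists K1 K2 : S -> Prop, [/\ prime_ideal_set K1, prime_ideal_set K2,
    forall p, pt_ideal P p -> K1 p, forall p, K1 p -> K2 p &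
    (exists p, K1 p /\ ~ pt_ideal P p) /\ (exists p, K2 p /\ ~ K1 p)].
Proof.
move=> r1 r2.
pose t1 : 4.-tuple S := [tuple 0; 0; sub_l P.2 v2 v3; sub_r P.2 v2 v3].
pose t2 : 4.-tuple S := [tuple 0; 0; 0; 0].
have K2 := prime_ker t2.
exists (fun p => (p \mPo t1) = 0), (fun p => (p \mPo t2) = 0); split.
- exact: prime_ker.
- exact: K2.
- apply: gen_ideal_min; first by case: (prime_ker t1).
  move=> g; rewrite !inE => /orP[]/eqP->.
    by rewrite comp_xform !(tnth_nth 0) /= !scaler0 subrr.
  by rewrite comp_yform !(tnth_nth 0) /= sub_lr0.
- move=> p p1; have idK : ideal_set (fun p => (p \mPo t2) = 0) by case: K2.
  have := comp_mpoly_congr (t := t1) idK _ p; rewrite p1 subr0; apply.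
  have X0 i : 'X_i \mPo t2 = 0 :> S.
    by rewrite comp_mpolyXU; move: i; apply: ord4_ind.
  have sl i j : sub_l P.2 i j \mPo t2 = 0 :> S.
    by rewrite /sub_l; case: ifP => _; rewrite ?X0 ?comp_mpoly0.
  have sr i j : sub_r P.2 i j \mPo t2 = 0 :> S.
    by rewrite /sub_r; case: ifP => _; rewrite ?comp_mpolyZ ?X0 ?scaler0.
  by apply: ord4_ind; rewrite comp_mpolyB X0 !(tnth_nth 0) /= ?comp_mpoly0 ?sl ?sr subr0.
- split.
    have [A rA nA] := exists_not_peq r1; exists (xform A); split.
      by rewrite comp_xform !(tnth_nth 0) /= !scaler0 subrr.
    by case: P r1 r2 nA {t1} => P1 P2 /= r1 r2 nA; apply: xform_notin_pt.
  have [B rB nB] := exists_not_peq r2; exists (yform B); split.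
    by rewrite comp_yform !(tnth_nth 0) /= !scaler0 subrr.
  by rewrite comp_yform !(tnth_nth 0) /=; apply/eqP; apply: sub_lr_neq0.
Qed.

End PrimeChain.

Section Configuration.
Variable F : numFieldType.
Local Notation S := {mpoly F[4]}.
Variables (X : seq ((F * F) * (F * F))) (hs vs As Bs : seq (F * F)).
Hypotheses (rhs : forall A, A \in hs -> prep A) (rvs : forall B, B \in vs -> prep B).
Hypotheses (rAs : forall A, A \in As -> prep A) (rBs : forall B, B \in Bs -> prep B).
Hypotheses (dhs : peq_free hs) (dvs : peq_free vs) (dAs : peq_free As) (dBs : peq_free Bs).
Hypothesis uX : uniq X.
Hypothesis rX : forall P, P \in X -> prep P.1 /\ prep P.2.
Hypothesis dX : forall P P', P \in X -> P' \in X -> P != P' ->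
  ~~ (peq P.1 P'.1 && peq P.2 P'.2).
Hypothesis hsX : forall P A, P \in X -> A \in hs -> ~~ peq P.1 A.
Hypothesis vsX : forall P B, P \in X -> B \in vs -> ~~ peq P.2 B.
Hypothesis hasAs : forall P, P \in X -> has (peq P.1) As.
Hypothesis hasBs : forall P, P \in X -> has (peq P.2) Bs.
Hypothesis Ashas : forall A, A \in As -> has (fun P => peq P.1 A) X.
Hypothesis Bshas : forall B, B \in Bs -> has (fun P => peq P.2 B) X.

Definition rowc (k : nat) : nat := count (fun P => peq P.1 (nth (0, 0) As k)) X.
Definition colc (k : nat) : nat := count (fun P => peq P.2 (nth (0, 0) Bs k)) X.

Hypothesis rowc_mono : forall k, (k.+1 < size As)%N -> (rowc k.+1 <= rowc k)%N.
Hypothesis colc_mono : forall k, (k.+1 < size Bs)%N -> (colc k.+1 <= colc k)%N.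
Hypothesis As_gt0 : (0 < size As)%N.

Definition points_ideal (p : S) : Prop := forall P, P \in X -> pt_ideal P p.

Hypothesis regular : exists f g : S,
  [/\ gen_ideal [:: 'X_v0; 'X_v1; 'X_v2; 'X_v3] f,
      gen_ideal [:: 'X_v0; 'X_v1; 'X_v2; 'X_v3] g,
      forall p, points_ideal (f * p) -> points_ideal p &
      forall p, (exists a c, points_ideal a /\ g * p = a + c * f) ->
        exists a c, points_ideal a /\ p = a + c * f].

Definition incident (A B : F * F) : bool := has (fun P => peq P.1 A && peq P.2 B) X.

Lemma points_idealE p : points_ideal p <-> pts_ideal As Bs incident p.
Proof.
split=> [pI A B Ai Bi /hasP[P PX /andP[e1 e2]]|pI P PX].
  have [r1 r2] := rX PX; apply: (@pt_ideal_sub F P (A, B)) (pI P PX); auto.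
have [r1 r2] := rX PX; have /hasP[A Ai e1] := hasAs PX; have /hasP[B Bi e2] := hasBs PX.
apply: (@pt_ideal_sub F (A, B) P); rewrite /= ?(peq_sym _ P.1) ?(peq_sym _ P.2); auto.
by apply: pI => //; apply/hasP; exists P; rewrite // e1.
Qed.

Lemma rowcE k : (k < size As)%N ->
  rowc k = size [seq B <- Bs | incident (nth (0, 0) As k) B].
Proof.
move=> kA; apply: (@line_count F _ fst snd) => //.
by apply: rAs; apply: mem_nth.
Qed.

Lemma colcE k : (k < size Bs)%N ->
  colc k = size [seq A <- As | incident A (nth (0, 0) Bs k)].
Proof.
move=> kB; rewrite /colc (@line_count F _ snd fst X _ As) //.
- congr size; apply: eq_filter => A; apply: eq_has => P; exact: andbC.
- by apply: rBs; apply: mem_nth.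
- by move=> P /rX[].
- by move=> P P' PX PX' ne; rewrite andbC; apply: dX.
Qed.

Lemma incident_staircase i j : (i < size As)%N -> (j < size Bs)%N ->
  incident (nth (0, 0) As i) (nth (0, 0) Bs j) = (j < rowc i)%N.
Proof.
move=> iA jB; rewrite rowcE //; apply: (@staircase _ (0, 0) As Bs incident) => //.
- have [f [g [fm gm freg greg]]] := regular => A A' Ai Ai'.
  apply: (@rows_comparable F As Bs incident rAs rBs dAs dBs f g fm gm) => //.
    by move=> p /points_idealE/freg/points_idealE.
  move=> p [a [c [/points_idealE aI e]]]; have [|a' [c' [/points_idealE ? ?]]] := greg p.
    by exists a, c.
  by exists a', c'.
- by case: dBs.
- by move=> k kA; rewrite -!rowcE //; [apply: rowc_mono | apply: ltnW].
- by move=> k kA; rewrite -!colcE //; [apply: colc_mono | apply: ltnW].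
Qed.

Lemma rowc_le i j : (i <= j)%N -> (j < size As)%N -> (rowc j <= rowc i)%N.
Proof. exact: mono_le rowc_mono i j. Qed.

Lemma rowc0 : rowc 0 = size Bs.
Proof.
apply/eqP; rewrite eqn_leq rowcE // size_filter count_size /= -size_filter -rowcE //.
case Bs0: (size Bs) => [//|n].
have nB : (n < size Bs)%N by rewrite Bs0.
have /hasP[P PX e2] := Bshas (mem_nth (0, 0) nB).
have /hasP[A Ai e1] := hasAs PX.
have iA : (index A As < size As)%N by rewrite index_mem.
apply: leq_trans (rowc_le (leq0n _) iA); rewrite -incident_staircase //.
by rewrite nth_index //; apply/hasP; exists P; rewrite // e1.
Qed.

Lemma rowc_gt0 i : (i < size As)%N -> (0 < rowc i)%N.
Proof. by move=> iA; rewrite -has_count; apply: Ashas; apply: mem_nth. Qed.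

Lemma config_ideal p :
  [/\ points_ideal p, forall A, A \in hs -> divides (xform A) p
    & forall B, B \in vs -> divides (yform B) p] <->
  gen_ideal (map (step hs vs As Bs) (corner_chain As Bs rowc)) p.
Proof.
have hsAs A A' : A \in As -> A' \in hs -> ~~ peq A A'.
  move=> Ai Ah; have /hasP[P PX e] := Ashas Ai; apply: contra (hsX PX Ah).
  exact: peq_trans (rAs Ai) e.
have vsBs B B' : B \in Bs -> B' \in vs -> ~~ peq B B'.
  move=> Ai Ah; have /hasP[P PX e] := Bshas Ai; apply: contra (vsX PX Ah).
  exact: peq_trans (rBs Ai) e.
have stE : points_ideal p <-> forall i j, (i < size As)%N -> (j < rowc i)%N ->
    pt_ideal (nth (0, 0) As i, nth (0, 0) Bs j) p.
  rewrite points_idealE; split=> [h i j iA ja|h A B Ai Bi].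
    have jB : (j < size Bs)%N by apply: leq_trans ja _; rewrite -rowc0; apply: rowc_le.
    by apply: h; rewrite ?mem_nth // incident_staircase.
  rewrite -[A](nth_index (0, 0) Ai) -[B](nth_index (0, 0) Bi).
  by rewrite incident_staircase ?index_mem //; apply: h; rewrite index_mem.
rewrite -union_ideal.
- by split=> -[/stE ? ? ?]; split=> //; apply/stE.
all: try exact/allP; try exact: rowc_le; try exact: rowc0; by [].
Qed.

End Configuration.

Section Partition.
Variable F : numFieldType.
Local Notation S := {mpoly F[4]}.

Lemma peq_free_nth (s : seq (F * F)) :
  (forall k l, (k < size s)%N -> (l < size s)%N -> k <> l -> ~~ peq s`_k s`_l) ->
  peq_free s.
Proof.
move=> h; split=> [|A B As Bs AB].
  apply/(uniqP 0) => k l ks ls e; apply/eqP/negPn/negP => /eqP kl.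
  by move: (h k l ks ls kl); rewrite e peq_refl.
rewrite -(nth_index 0 As) -(nth_index 0 Bs); apply: h; rewrite ?index_mem // => e.
by move: AB; rewrite -(nth_index 0 As) e nth_index // eqxx.
Qed.

Lemma regular_pair (I : S -> Prop) (fs : seq S) : ideal_set I -> (1 < size fs)%N ->
  (forall k, (k < size fs)%N -> gen_ideal [:: 'X_v0; 'X_v1; 'X_v2; 'X_v3] fs`_k) ->
  (forall k, (k < size fs)%N -> forall g,
     (exists a b, I a /\ gen_ideal (take k fs) b /\ fs`_k * g = a + b) ->
     exists a b, I a /\ gen_ideal (take k fs) b /\ g = a + b) ->
  exists f g : S,
  [/\ gen_ideal [:: 'X_v0; 'X_v1; 'X_v2; 'X_v3] f,
      gen_ideal [:: 'X_v0; 'X_v1; 'X_v2; 'X_v3] g,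
      forall p, I (f * p) -> I p &
      forall p, (exists a c, I a /\ g * p = a + c * f) ->
        exists a c, I a /\ p = a + c * f].
Proof.
move=> idI; case: fs => [//|f [//|g fs]] _ irr reg; exists f, g; split.
- exact: (irr 0%N).
- exact: (irr 1%N).
- move=> p fp; have [|a [b [aI [[cs [_ ->]] ->]]]] := reg 0%N isT p.
    exists (f * p), 0; rewrite addr0; split=> //.
    by split=> //; case: (gen_ideal_ideal_set (take 0 [:: f, g & fs])).
  by rewrite big_ord0 addr0.
- move=> p [a [c [aI e]]]; have [|a' [b [aI' [/gen_ideal1P[c' ->] ->]]]] := reg 1%N isT p.
    by exists a, (c * f); split=> //; split=> //; apply/gen_ideal1P; exists c.
  by exists a', c'.
Qed.

Lemma pt_prime_chain (I : S -> Prop) (P : (F * F) * (F * F)) n :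
  prep P.1 -> prep P.2 -> (forall p, I p -> pt_ideal P p) -> (n <= 2)%N ->
  exists ps : seq (S -> Prop), size ps = n.+1 /\
    (forall k, (k < n.+1)%N ->
       prime_ideal_set (nth I ps k) /\ (forall p, I p -> nth I ps k p)) /\
    (forall k, (k < n)%N ->
       (forall p, nth I ps k p -> nth I ps k.+1 p) /\
       exists p, nth I ps k.+1 p /\ ~ nth I ps k p).
Proof.
move=> r1 r2 IP n2; have [K1 [K2 [pr1 pr2 s1 s2 [st1 st2]]]] := pt_ideal_chain r1 r2.
have pr0 := pt_ideal_prime r1 r2.
exists (take n.+1 [:: pt_ideal P; K1; K2]); split; first by rewrite size_takel.
split=> k kn.
  rewrite nth_take //; case: k kn => [|[|[|k]]] kn /=; split=> //; try by auto.
    by exfalso; move: kn n2; clear; lia.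
  by exfalso; move: kn n2; clear; lia.
rewrite !nth_take // ?(ltnW kn) //; last exact: ltnW.
by case: k kn => [|[|k]] kn //=; exfalso; move: kn n2; clear; lia.
Qed.

Variables (X : seq ((F * F) * (F * F))) (hs vs As Bs : seq (F * F)).

Definition ideal_of_union (p : S) : Prop := points_ideal X p /\
  (forall A, A \in hs -> gen_ideal [:: xform A] p) /\
  (forall B, B \in vs -> gen_ideal [:: yform B] p).

Definition corner_gens_list : seq S :=
  [seq (xprod hs * yprod vs) * g | g <- [:: xprod As; yprod Bs] ++
    [seq xprod (take k.+1 As) * yprod (take (rowc X As k.+1) Bs)
       | k <- iota 0 (size As).-1 & (rowc X As k.+1 < rowc X As k)%N]].

Lemma corner_gens_listE :
  corner_gens_list =i map (step hs vs As Bs) (corner_chain As Bs (rowc X As)).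
Proof.
have stepE i j : step hs vs As Bs (i, j) =
    (xprod hs * yprod vs) * (xprod (take i As) * yprod (take j Bs)).
  by rewrite /step /stepU /stepW xprod_cat yprod_cat mulrACA.
move=> g; rewrite /corner_gens_list map_cat /= !(mem_cat, inE) map_cat mem_cat /= inE.
rewrite !stepE !take0 !take_size [xprod [::]]big_nil [yprod [::]]big_nil mul1r mulr1.
rewrite -!map_comp orbCA; congr (_ || _); rewrite orbC; congr (_ || _).
by congr (_ \in _); apply: eq_map => k /=; rewrite stepE.
Qed.

Variable pA : pred S.

Hypotheses (rhs : forall A, A \in hs -> prep A) (rvs : forall B, B \in vs -> prep B).
Hypotheses (rAs : forall A, A \in As -> prep A) (rBs : forall B, B \in Bs -> prep B).
Hypotheses (dhs : peq_free hs) (dvs : peq_free vs) (dAs : peq_free As) (dBs : peq_free Bs).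
Hypothesis uX : uniq X.
Hypothesis rX : forall P, P \in X -> prep P.1 /\ prep P.2.
Hypothesis dX : forall P P', P \in X -> P' \in X -> P != P' ->
  ~~ (peq P.1 P'.1 && peq P.2 P'.2).
Hypothesis hsX : forall P A, P \in X -> A \in hs -> ~~ peq P.1 A.
Hypothesis vsX : forall P B, P \in X -> B \in vs -> ~~ peq P.2 B.
Hypothesis hasAs : forall P, P \in X -> has (peq P.1) As.
Hypothesis hasBs : forall P, P \in X -> has (peq P.2) Bs.
Hypothesis Ashas : forall A, A \in As -> has (fun P => peq P.1 A) X.
Hypothesis Bshas : forall B, B \in Bs -> has (fun P => peq P.2 B) X.
Hypothesis rowc_mono : forall k, (k.+1 < size As)%N -> (rowc X As k.+1 <= rowc X As k)%N.
Hypothesis colc_mono : forall k, (k.+1 < size Bs)%N -> (colc X Bs k.+1 <= colc X Bs k)%N.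
Hypothesis regular : forall P, P \in X -> exists f g : S,
  [/\ gen_ideal [:: 'X_v0; 'X_v1; 'X_v2; 'X_v3] f,
      gen_ideal [:: 'X_v0; 'X_v1; 'X_v2; 'X_v3] g,
      forall p, points_ideal X (f * p) -> points_ideal X p &
      forall p, (exists a c, points_ideal X a /\ g * p = a + c * f) ->
        exists a c, points_ideal X a /\ p = a + c * f].

Let gensA := [seq g <- undup corner_gens_list | pA g].
Let gensN := [seq g <- undup corner_gens_list | ~~ pA g].
Hypotheses (gensA_neq0 : gensA <> [::]) (gensN_neq0 : gensN <> [::]).

Let gens b := [seq g <- undup corner_gens_list | pA g == b].
Let gensT : gens true = gensA. Proof. by apply: eq_filter => g; apply: eqb_id. Qed.
Let gensF : gens false = gensN. Proof. by apply: eq_filter => g; apply: eqbF_neg. Qed.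
Let gens_neq0 b : gens b <> [::].
Proof. by case: b; rewrite (gensT, gensF). Qed.

Let chain := corner_chain As Bs (rowc X As).
Let colour (x : nat * nat) := pA (step hs vs As Bs x).

Let gensE b : gen_ideal (gens b) =
  gen_ideal [seq step hs vs As Bs x | x <- chain & colour x == b].
Proof.
apply: functional_extensionality => p; apply: propositional_extensionality.
split; apply: gen_ideal_sub => g.
  rewrite mem_filter mem_undup corner_gens_listE => /andP[gb /mapP[x xc gE]].
  by apply/mapP; exists x; rewrite // mem_filter xc /colour -gE gb.
move=> /mapP[x]; rewrite mem_filter => /andP[xb xc] ->.
by rewrite mem_filter xb mem_undup corner_gens_listE map_f.
Qed.

Let As_gt0 : (0 < size As)%N.
Proof.
rewrite lt0n; apply/negP => /eqP/size0nil As0.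
have X0 : X = [::].
  by case: (X) hasAs => // P X' /(_ P (mem_head _ _)); rewrite As0.
have Bs0 : Bs = [::].
  by case: (Bs) Bshas => // B Bs' /(_ B (mem_head _ _)); rewrite X0.
have [/= h1 h2] := (@gens_neq0 true, @gens_neq0 false).
move: h1 h2; rewrite /gens /corner_gens_list As0 Bs0 /= /xprod /yprod !big_nil inE eqxx /=.
by case: (pA _).
Qed.

Lemma union_splitting :
  gsplitting ideal_of_union (gen_ideal gensA) (gen_ideal gensN) <->
  exists f : S, f != 0 /\ forall p, cap_ideal (gen_ideal gensA) (gen_ideal gensN) p
    <-> gen_ideal [:: f] p.
Proof.
rewrite -gensT -gensF.
have [P PX] : exists P, P \in X.
  by have /hasP[P PX _] := Ashas (mem_nth (0, 0) As_gt0); exists P.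
have reg := regular PX.
have cfg := config_ideal rhs rvs rAs rBs dhs dvs dAs dBs uX rX dX hsX vsX hasAs hasBs
  Ashas Bshas rowc_mono colc_mono As_gt0 reg.
have le := rowc_le rowc_mono.
have r0 := rowc0 rAs rBs dAs dBs uX rX dX hasAs hasBs Bshas rowc_mono colc_mono As_gt0 reg.
have gt0 := rowc_gt0 Ashas.
have IE : ideal_of_union = gen_ideal (map (step hs vs As Bs) chain).
  apply: functional_extensionality => p; apply: propositional_extensionality.
  rewrite -cfg; split=> [[h1 [h2 h3]]|[h1 h2 h3]].
    by split=> // A Ai; apply/gen_ideal1P; auto.
  by split=> //; split=> A Ai; apply/gen_ideal1P; auto.
have colourP b : has (fun x => colour x == b) chain.
  move: (@gens_neq0 b); rewrite /gens.
  case E: [seq g <- _ | _] => [//|g s] _.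
  have : g \in [seq g <- undup corner_gens_list | pA g == b] by rewrite E mem_head.
  rewrite mem_filter mem_undup corner_gens_listE => /andP[gb /mapP[x xc gE]].
  by apply/hasP; exists x; rewrite // /colour -gE.
have hT : has colour chain.
  by have /hasP[x xc /eqP xT] := colourP true; apply/hasP; exists x.
have hF : has (predC colour) chain.
  by have /hasP[x xc /eqP xT] := colourP false; apply/hasP; exists x; rewrite //= xT.
have box := corner_chain_inbox le r0 As_gt0.
have st := corner_chain_stairs le r0 gt0 As_gt0.
have [ahs avs aAs aBs] : [/\ all (@prep F) hs, all (@prep F) vs, all (@prep F) As &
    all (@prep F) Bs] by split; apply/allP.
rewrite !gensE IE; split.
  move=> /(splitting_principal ahs avs aAs aBs box st hT hF)[f f0 fP].
  by exists f; split=> // p; rewrite fP; apply: iff_sym; apply: gen_ideal1P.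
move=> [f [f0 fP]]; apply: (principal_splitting ahs avs aAs aBs box st f0) => p.
by rewrite fP; apply: gen_ideal1P.
Qed.

End Partition.

(** * Transfer to the complex numbers *)

Section Distinct.
Variable F : numFieldType.

Lemma points_distinct (X : seq ((F * F) * (F * F))) P0 :
  (forall k l, (k < size X)%N -> (l < size X)%N -> k <> l ->
     ~~ (peq (nth P0 X k).1 (nth P0 X l).1 && peq (nth P0 X k).2 (nth P0 X l).2)) ->
  uniq X /\ forall P P', P \in X -> P' \in X -> P != P' ->
    ~~ (peq P.1 P'.1 && peq P.2 P'.2).
Proof.
move=> h; split=> [|P P' PX PX' ne].
  apply/(uniqP P0) => k l ks ls e; apply/eqP/negPn/negP => /eqP kl.
  by move: (h k l ks ls kl); rewrite e !peq_refl.
rewrite -(nth_index P0 PX) -(nth_index P0 PX'); apply: h; rewrite ?index_mem // => e.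
by move: ne; rewrite -(nth_index P0 PX) e nth_index // eqxx.
Qed.

Lemma points_ideal_ideal_set (X : seq ((F * F) * (F * F))) : ideal_set (points_ideal X).
Proof.
split; [|split].
- by move=> P _; case: (gen_ideal_ideal_set [:: xform P.1; yform P.2]).
- move=> a b ha hb P PX; have [_ [ID _]] := gen_ideal_ideal_set [:: xform P.1; yform P.2].
  by apply: ID; [apply: ha|apply: hb].
- by move=> r a ha P PX; apply: gen_idealM; apply: ha.
Qed.

End Distinct.

From mathcomp Require Import complex.
From mathcomp Require Import reals.

Section Transfer.
Variable R : realType.

Definition complex_numField : numFieldType := CC R.
Local Notation F := complex_numField.

Lemma bettiE I i d : @betti R I i d = gbetti (F := F) I i d.
Proof. reflexivity. Qed.

Lemma betti_splittingE I J K : @betti_splitting R I J K <-> gsplitting (F := F) I J K.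
Proof. by split=> h i d; have := h i d; case: i => [|i]; rewrite !bettiE. Qed.

Lemma acm_regular (X : seq (Pt R)) P : P \in X -> P1rep P.1 -> P1rep P.2 -> ACM X ->
  exists f g : {mpoly F[4]},
  [/\ gen_ideal [:: 'X_v0; 'X_v1; 'X_v2; 'X_v3] f,
      gen_ideal [:: 'X_v0; 'X_v1; 'X_v2; 'X_v3] g,
      forall p, points_ideal (F := F) X (f * p) -> points_ideal (F := F) X p &
      forall p, (exists a c, points_ideal (F := F) X a /\ g * p = a + c * f) ->
        exists a c, points_ideal (F := F) X a /\ p = a + c * f].
Proof.
move=> PX r1 r2 [n [[[fs [sfs [irr [reg _]]]] _] [_ nchain]]].
have n2 : (1 < n)%N.
  rewrite ltnNge; apply/negP => n1; apply: nchain.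
  apply: (@pt_prime_chain F (I_X X) P n.+1 r1 r2) => //.
  by move=> p; apply.
apply: (@regular_pair F (points_ideal (F := F) X) fs) => //.
- exact: points_ideal_ideal_set.
- by rewrite sfs.
Qed.

End Transfer.

Theorem theorem5p2 (R : realType) (X : seq (Pt R)) (Hs Vs As Bs : seq (CC R * CC R))
    (pA : pred (Rpoly R)) :
  lines_points X Hs Vs -> ACM X -> labelling X As Bs ->
  [seq g <- std_gens_W X Hs Vs As Bs | pA g] <> [::] ->
  [seq g <- std_gens_W X Hs Vs As Bs | ~~ pA g] <> [::] ->
  (betti_splitting (I_W X Hs Vs)
     (ideal_gen [seq g <- std_gens_W X Hs Vs As Bs | pA g])
     (ideal_gen [seq g <- std_gens_W X Hs Vs As Bs | ~~ pA g])
   <->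
   principal (ideal_cap (ideal_gen [seq g <- std_gens_W X Hs Vs As Bs | pA g])
                        (ideal_gen [seq g <- std_gens_W X Hs Vs As Bs | ~~ pA g]))).
Proof.
move=> [rX [rHs [rVs [dX [dHs [dVs [XH XV]]]]]]] acm.
move=> [rAs [rBs [dAs [dBs [XAB [hA [hB [aM cM]]]]]]]] nA nB.
have [uX dX'] := @points_distinct (complex_numField R) X _ dX.
have reg P (PX : P \in X) := acm_regular PX (rX P PX).1 (rX P PX).2 acm.
rewrite betti_splittingE.
apply: (@union_splitting (complex_numField R) X Hs Vs As Bs pA rHs rVs rAs rBs
  (peq_free_nth dHs) (peq_free_nth dVs) (peq_free_nth dAs) (peq_free_nth dBs)
  uX rX dX' XH XV (fun P PX => (XAB P PX).1) (fun P PX => (XAB P PX).2) hA hB aM cM reg).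
- exact: nA.
- exact: nB.
Qed.
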